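(* Let $\mathbb K$ be a field of characteristic zero and let $\varphi:\mathfrak S=(\mathcal S,d_{\mathcal S})\to\mathfrak R=(\mathcal R,d_{\mathcal R})$ be a morphism of unital DG commutative $\mathbb K$-algebras. (1) There exists an adjunction between the categories of $L_\infty[1]$ $\mathfrak R$-algebras and of $L_\infty[1]$ $\mathfrak S$-algebras, in which the right adjoint functor ($L_\infty[1]$ $\mathfrak R$-algebras $\to$ $L_\infty[1]$ $\mathfrak S$-algebras) is the restriction of scalars and the left adjoint functor ($L_\infty[1]$ $\mathfrak S$-algebras $\to$ $L_\infty[1]$ $\mathfrak R$-algebras) is the extension of scalars. (2) The restriction of scalars functor from $L_\infty[1]$ $\mathfrak R$-algebras to $L_\infty[1]$ $\mathfrak S$-algebras preserves quasi-isomorphisms.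
   Context: DG $\mathfrak R$-module: graded $\mathcal R$-module $V$ with degree $+1$ differential, $d_V(rx)=d_{\mathcal R}(r)x+(-1)^{|r|}r\,d_V(x)$. An $L_\infty[1]$ $\mathfrak R$-algebra is a DG $\mathfrak R$-module $(V,d_V)$ with graded symmetric $\mathcal R$-multilinear degree $1$ maps $q_n:V^{\odot_{\mathcal R}n}\to V$, $n\ge2$, such that (with $q_1=d_V$) for all $n\ge2$: $\sum_{i=1}^n\sum_{\sigma\in Sh(i,n-i)}\epsilon(\sigma)q_{n-i+1}(q_i(x_{\sigma(1)},\ldots,x_{\sigma(i)}),x_{\sigma(i+1)},\ldots,x_{\sigma(n)})=0$ ($\epsilon$ = Koszul sign). An $L_\infty[1]$ $\mathfrak R$-morphism $(V,d_V,q_2,\ldots)\to(W,d_W,r_2,\ldots)$ is a family of graded symmetric $\mathcal R$-multilinear degree $0$ maps $f_n:V^{\odot_{\mathcal R}n}\to W$, $n\ge1$, satisfying (with $q_1=d_V$, $r_1=d_W$) for all $n\ge1$ $$\sum_{k=1}^n\sum_{i_1+\cdots+i_k=n}\frac1{k!}\sum_{\sigma\in Sh(i_1,\ldots,i_k)}\epsilon(\sigma)r_k(f_{i_1}(x_{\sigma(1)},\ldots),\ldots,f_{i_k}(\ldots,x_{\sigma(n)}))=\sum_{j=1}^n\sum_{\sigma\in Sh(j,n-j)}\epsilon(\sigma)f_{n-j+1}(q_j(x_{\sigma(1)},\ldots,x_{\sigma(j)}),x_{\sigma(j+1)},\ldots,x_{\sigma(n)}),$$ with the usual composition of $L_\infty[1]$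 morphisms. It is a quasi-isomorphism if $f_1$ is a quasi-isomorphism of complexes. Restriction of scalars: an $L_\infty[1]$ $\mathfrak R$-algebra $(V,d_V,q_2,\ldots)$ is sent to $(V,d_V)$ with $\mathcal S$-action $sx=\varphi(s)x$ and brackets obtained by composing $q_n$ with the natural projection $V^{\odot_{\mathcal S}n}\twoheadrightarrow V^{\odot_{\mathcal R}n}$; likewise for the components of morphisms. Extension of scalars: an $L_\infty[1]$ $\mathfrak S$-algebra $(V,d_V,q_2,\ldots)$ is sent to $(\mathcal R\otimes_{\mathcal S}V,d_{\mathcal R}\otimes\mathrm{id}+\mathrm{id}\otimes d_V)$ with brackets $q_n^{\mathcal R}(r_1\otimes x_1,\ldots,r_n\otimes x_n)=(-1)^{\sum_i|r_i|+\sum_{i<j}|x_i||r_j|}r_1\cdots r_n\otimes q_n(x_1,\ldots,x_n)$; a morphism with components $f_n$ is sent to the one with components $f_n^{\mathcal R}(r_1\otimes x_1,\ldots,r_n\otimes x_n)=(-1)^{\sum_{i<j}|x_i||r_j|}r_1\cdots r_n\otimes f_n(x_1,\ldots,x_n)$. *)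

(* Defs.v *)
From HB Require Import structures.
From mathcomp Require Import all_boot perm all_algebra.
From mathcomp Require Import boolp.

Set Implicit Arguments.
Unset Strict Implicit.
Unset Printing Implicit Defensive.

Import GRing.Theory.
Local Open Scope ring_scope.
Local Open Scope quotient_scope.

(* Gradings are internal: an element of a graded object is a finite sum of
   homogeneous ones.  Signs are written  x *~ (-1) ^ k,  with k : int. *)

Section Categories.

Record category (ob : Type) (hom : ob -> ob -> Type) := Category {
  idm : forall X, hom X X;
  compm : forall X Y Z, hom Y Z -> hom X Y -> hom X Z;
  compm1 : forall X Y (f : hom X Y), compm f (idm X) = f;
  comp1m : forall X Y (f : hom X Y), compm (idm Y) f = f;
  compmA : forall X Y Z T (h : hom Z T) (g : hom Y Z) (f : hom X Y),
    compm h (compm g f) = compm (compm h g) f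
}.

Record is_functor obC homC (C : @category obC homC)
    obD homD (D : @category obD homD) (F : obC -> obD)
    (Fm : forall X Y, homC X Y -> homD (F X) (F Y)) : Prop := IsFunctor {
  functor_id : forall X, Fm X X (idm C X) = idm D (F X);
  functor_comp : forall X Y Z (g : homC Y Z) (f : homC X Y),
    Fm X Z (compm C g f) = compm D (Fm Y Z g) (Fm X Y f)
}.

(* L, acting on morphisms by Lm, is left adjoint to G, acting by Gm, through
   the natural bijection Phi. *)
Record is_adjunction obC homC (C : @category obC homC)
    obD homD (D : @category obD homD)
    (L : obC -> obD) (Lm : forall X Y, homC X Y -> homD (L X) (L Y))
    (G : obD -> obC) (Gm : forall X Y, homD X Y -> homC (G X) (G Y))
    (Phi : forall X Y, homD (L X) Y -> homC X (G Y)) : Prop := IsAdjunction {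
  adj_left : is_functor C D Lm;
  adj_right : is_functor D C Gm;
  adj_bij : forall X Y, bijective (Phi X Y);
  adj_nat : forall X X' Y Y'
      (h : homC X' X) (f : homD (L X) Y) (g : homD Y Y'),
    Phi X' Y' (compm D g (compm D f (Lm X' X h))) =
      compm C (Gm Y Y' g) (compm C (Phi X Y f) h)
}.

End Categories.

Record grading (V : zmodType) := Grading {
  homog : int -> V -> Prop;
  homog0 : forall i, homog i 0;
  homogB : forall i x y, homog i x -> homog i y -> homog i (x - y);
  homog_span : forall x, exists (I : seq int) (c : int -> V),
    (forall i, homog i (c i)) /\ x = \sum_(i <- I) c i;
  homog_free : forall (I : seq int) (c : int -> V),
    uniq I -> (forall i, homog i (c i)) -> \sum_(i <- I) c i = 0 ->
    forall i, i \in I -> c i = 0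
}.

(* The K-algebra structure is the unit morphism K -> R, whose values have
   degree 0, hence are central by graded commutativity.  Since pzRingType is
   used, the zero algebra is allowed. *)
Record dgca (K : fieldType) := Dgca {
  dgca_sort :> pzRingType;
  dgca_unit : {rmorphism K -> dgca_sort};
  dgca_gr : grading dgca_sort;
  dgca_d : dgca_sort -> dgca_sort;
  dgca_homog_unit : forall k, homog dgca_gr 0 (dgca_unit k);
  dgca_homogM : forall i j x y,
    homog dgca_gr i x -> homog dgca_gr j y -> homog dgca_gr (i + j) (x * y);
  dgca_mulC : forall i j x y,
    homog dgca_gr i x -> homog dgca_gr j y -> x * y = (y * x) *~ (-1) ^ (i * j);
  dgca_dD : forall x y, dgca_d (x + y) = dgca_d x + dgca_d y;
  dgca_d_unit : forall k, dgca_d (dgca_unit k) = 0;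
  dgca_homog_d : forall i x, homog dgca_gr i x -> homog dgca_gr (i + 1) (dgca_d x);
  dgca_dd : forall x, dgca_d (dgca_d x) = 0;
  dgca_leibniz : forall i x y, homog dgca_gr i x ->
    dgca_d (x * y) = dgca_d x * y + (x * dgca_d y) *~ (-1) ^ i
}.

Arguments dgca_d {K} R x : rename.

Record dgcaHom (K : fieldType) (S R : dgca K) := DgcaHom {
  dgca_fun :> {rmorphism S -> R};
  dgca_fun_unit : forall k, dgca_fun (dgca_unit S k) = dgca_unit R k;
  dgca_fun_homog : forall i x,
    homog (dgca_gr S) i x -> homog (dgca_gr R) i (dgca_fun x);
  dgca_fun_d : forall x, dgca_fun (dgca_d S x) = dgca_d R (dgca_fun x)
}.

Record dgStr (K : fieldType) (R : dgca K) (V : lmodType R) := DgStr {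
  dg_gr :> grading V;
  dg_d : V -> V;
  dg_homogZ : forall i j r x,
    homog (dgca_gr R) i r -> homog dg_gr j x -> homog dg_gr (i + j) (r *: x);
  dg_dD : forall x y, dg_d (x + y) = dg_d x + dg_d y;
  dg_homog_d : forall i x, homog dg_gr i x -> homog dg_gr (i + 1) (dg_d x);
  dg_dd : forall x, dg_d (dg_d x) = 0;
  dg_leibniz : forall i r x, homog (dgca_gr R) i r ->
    dg_d (r *: x) = dgca_d R r *: x + (r *: dg_d x) *~ (-1) ^ i
}.

Definition homogs (V : zmodType) (G : grading V) (e : seq int) (s : seq V) :=
  size e = size s /\ forall k, (k < size s)%N -> homog G e`_k s`_k.

(* A family of maps f_n : V^n -> W, n >= 1, is encoded by a single function on
   sequences, f_n(x_1, ..., x_n) = f [:: x_1; ...; x_n]; the missing component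
   f_0 is normalised to 0.  The record says that every f_n is additive in each
   variable, graded symmetric and of degree a, and that f_n is R-multilinear
   for n >= m (the bracket q_1 = d is only additive).  As usual in the graded
   setting, scalars pick up a sign when they move past the map, of degree a,
   and past its first arguments. *)
Record gsym_family (K : fieldType) (R : dgca K) (V W : lmodType R)
    (GV : grading V) (GW : grading W) (m : nat) (a : int) (f : seq V -> W) :
    Prop := GsymFamily {
  gsym_nil : f [::] = 0;
  gsymD : forall s1 x y s2,
    f (s1 ++ (x + y) :: s2) = f (s1 ++ x :: s2) + f (s1 ++ y :: s2);
  gsymZ : forall e s1 i r x s2, (m <= size (s1 ++ x :: s2))%N ->
    homogs GV e s1 -> homog (dgca_gr R) i r ->
    f (s1 ++ (r *: x) :: s2) =
      (r *: f (s1 ++ x :: s2)) *~ (-1) ^ (i * (a + \sum_(j <- e) j));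
  gsym_homog : forall e s, homogs GV e s -> homog GW (a + \sum_(j <- e) j) (f s);
  gsymC : forall i j s1 x y s2, homog GV i x -> homog GV j y ->
    f (s1 ++ x :: y :: s2) = f (s1 ++ y :: x :: s2) *~ (-1) ^ (i * j)
}.

(* Sh(c_1, ..., c_k): the permutations s such that s 0 < ... < s (c_1 - 1),
   s c_1 < ... < s (c_1 + c_2 - 1), and so on. *)
Definition shuffles (n : nat) (c : seq nat) : {set 'S_n} :=
  [set s : 'S_n | all (sorted ltn) (reshape c [seq val (s i) | i : 'I_n])].

(* x_(s 0) ... x_(s (n-1)) = (-1) ^ koszul e s * x_0 ... x_(n-1), |x_i| = e i *)
Definition koszul (n : nat) (e : 'I_n -> int) (s : 'S_n) : int :=
  \sum_(i < n) \sum_(j < n | (i < j)%N && (s j < s i)%N) e (s i) * e (s j).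

(* sum_(j = 1)^n sum_(s in Sh(j, n - j))
     eps(s) f_(n-j+1)(q_j(x_(s 1), ..., x_(s j)), x_(s (j+1)), ..., x_(s n)) *)
Definition insertion_sum (V W : zmodType) (q : seq V -> V) (f : seq V -> W)
    (n : nat) (e : 'I_n -> int) (x : 'I_n -> V) : W :=
  \sum_(1 <= j < n.+1) \sum_(s in shuffles n [:: j; n - j]%N)
    let xs := [seq x (s i) | i : 'I_n] in
    f (q (take j xs) :: drop j xs) *~ (-1) ^ koszul e s.

(* sum_(k = 1)^n sum_(c_1 + ... + c_k = n) 1/k! sum_(s in Sh(c_1, ..., c_k))
     eps(s) g_k(f_(c_1)(x_(s 1), ...), ..., f_(c_k)(..., x_(s n))) *)
Definition composition_sum (K : fieldType) (R : dgca K) (U V : zmodType)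
    (W : lmodType R) (g : seq V -> W) (f : seq U -> V)
    (n : nat) (e : 'I_n -> int) (x : 'I_n -> U) : W :=
  \sum_(1 <= k < n.+1)
  \sum_(t : k.-tuple 'I_n.+1 |
         (sumn (map val t) == n) && all (leq 1) (map val t))
    dgca_unit R (k`!%:R^-1) *:
    \sum_(s in shuffles n (map val t))
      g [seq f b | b <- reshape (map val t) [seq x (s i) | i : 'I_n]]
        *~ (-1) ^ koszul e s.

Record linfStr (K : fieldType) (R : dgca K) (V : lmodType R) := LinfStr {
  linf_dg :> dgStr V;
  linf_q : seq V -> V;
  linf_q1 : forall x, linf_q [:: x] = dg_d linf_dg x;
  linf_q_gsym : gsym_family linf_dg linf_dg 2 1 linf_q;
  linf_jacobi : forall n (e : 'I_n -> int) (x : 'I_n -> V), (2 <= n)%N ->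
    (forall i, homog linf_dg (e i) (x i)) ->
    insertion_sum linf_q linf_q e x = 0
}.

Record linfAlg (K : fieldType) (R : dgca K) := LinfAlg {
  linf_sort :> lmodType R;
  linf_str :> linfStr linf_sort
}.

Record linfHom (K : fieldType) (R : dgca K) (V W : linfAlg R) := LinfHom {
  linf_fun :> seq V -> W;
  linf_fun_gsym : gsym_family V W 1 0 linf_fun;
  linf_fun_eq : forall n (e : 'I_n -> int) (x : 'I_n -> V), (1 <= n)%N ->
    (forall i, homog V (e i) (x i)) ->
    composition_sum (linf_q W) linf_fun e x = insertion_sum (linf_q V) linf_fun e x
}.

Record linf_category (K : fieldType) (R : dgca K)
    (C : category (@linfHom K R)) : Prop := LinfCategory {
  linf_idE : forall (V : linfAlg R) (s : seq V),
    idm C V s = if s is [:: x] then x else 0;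
  linf_compE : forall (U V W : linfAlg R) (g : linfHom V W) (f : linfHom U V)
      n (e : 'I_n -> int) (x : 'I_n -> U), (1 <= n)%N ->
    (forall i, homog U (e i) (x i)) ->
    compm C g f [seq x i | i : 'I_n] = composition_sum g f e x
}.

(* The linear component induces a bijection H^i(V) -> H^i(W) for all i. *)
Definition quasi_iso (K : fieldType) (R : dgca K) (V W : linfAlg R)
    (f : linfHom V W) : Prop :=
  forall i : int,
    (forall x, homog V i x -> dg_d V x = 0 ->
       (exists2 y, homog W (i - 1) y & f [:: x] = dg_d W y) ->
       exists2 y, homog V (i - 1) y & x = dg_d V y) /\
    (forall y, homog W i y -> dg_d W y = 0 ->
       exists x z, [/\ homog V i x, dg_d V x = 0, homog W (i - 1) z
                     & y = f [:: x] + dg_d W z]).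

Definition restr_mod (S R : pzRingType) (phi : {rmorphism S -> R})
  (V : lmodType R) : Type := V.

Section RestrictionModule.
Variables (S R : pzRingType) (phi : {rmorphism S -> R}) (V : lmodType R).
Local Notation VS := (restr_mod phi V).

HB.instance Definition _ := GRing.Zmodule.copy VS V.

Definition restr_scale (s : S) (x : VS) : VS :=
  phi s *: (x : V).

Fact restr_scaleA a b x :
  restr_scale a (restr_scale b x) = restr_scale (a * b) x.
Proof. by rewrite /restr_scale scalerA rmorphM. Qed.
Fact restr_scale1 : left_id 1 restr_scale.
Proof. by move=> x; rewrite /restr_scale rmorph1 scale1r. Qed.
Fact restr_scaleDr : right_distributive restr_scale +%R.
Proof. by move=> a x y; rewrite /restr_scale scalerDr. Qed.
Fact restr_scaleDl x : {morph restr_scale^~ x : a b / a + b}.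
Proof. by move=> a b; rewrite /restr_scale rmorphD scalerDl. Qed.

HB.instance Definition _ := GRing.Zmodule_isLmodule.Build S VS
  restr_scaleA restr_scale1 restr_scaleDr restr_scaleDl.

End RestrictionModule.

Section Restriction.
Variables (K : fieldType) (S R : dgca K) (phi : dgcaHom S R).

Section Objects.
Variable V : linfAlg R.
Local Notation VS := (restr_mod phi V).

Definition restr_gr : grading VS :=
  @Grading VS (homog V) (@homog0 _ V) (@homogB _ V) (@homog_span _ V)
    (@homog_free _ V).

Fact restr_homogZ i j (r : S) (x : VS) : homog (dgca_gr S) i r ->
  homog restr_gr j x -> homog restr_gr (i + j) (r *: x).
Proof. by move=> /(dgca_fun_homog phi) hr hx; apply: (dg_homogZ hr hx). Qed.

Fact restr_leibniz i (r : S) (x : VS) : homog (dgca_gr S) i r ->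
  dg_d V (r *: x) = dgca_d S r *: x + (r *: (dg_d V x : VS)) *~ (-1) ^ i :> VS.
Proof.
move=> /(dgca_fun_homog phi) hr; rewrite [LHS](dg_leibniz V x hr).
by rewrite -(dgca_fun_d phi).
Qed.

Definition restr_dg : dgStr VS :=
  @DgStr K S VS restr_gr (dg_d V) restr_homogZ (@dg_dD _ _ _ V)
    (@dg_homog_d _ _ _ V) (@dg_dd _ _ _ V) restr_leibniz.

End Objects.

Fact restr_gsym (V W : linfAlg R) m a (f : seq V -> W) :
  gsym_family V W m a f ->
  @gsym_family K S (restr_mod phi V) (restr_mod phi W)
    (restr_gr V) (restr_gr W) m a f.
Proof.
case=> f0 fD fZ fh fC; split => // e s1 i r x s2 hm he /(dgca_fun_homog phi) hr.
exact: fZ hm he hr.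
Qed.

Definition restr_linfStr (V : linfAlg R) : linfStr (restr_mod phi V) :=
  @LinfStr K S (restr_mod phi V) (restr_dg V) (linf_q V) (@linf_q1 _ _ _ V)
    (restr_gsym (linf_q_gsym V)) (@linf_jacobi _ _ _ V).

Definition restr (V : linfAlg R) : linfAlg S := LinfAlg (restr_linfStr V).

Fact restr_hom_eq (V W : linfAlg R) (f : linfHom V W) n (e : 'I_n -> int)
    (x : 'I_n -> V) : (1 <= n)%N -> (forall i, homog V (e i) (x i)) ->
  @composition_sum K S _ _ (restr_mod phi W) (linf_q W) f n e x =
    insertion_sum (linf_q V) f e x.
Proof.
move=> hn hx; rewrite -(linf_fun_eq f hn hx).
apply: eq_bigr => k _; apply: eq_bigr => t _.
by rewrite -(dgca_fun_unit phi).
Qed.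

Definition restr_hom (V W : linfAlg R) (f : linfHom V W) :
    linfHom (restr V) (restr W) :=
  @LinfHom K S (restr V) (restr W) f (restr_gsym (linf_fun_gsym f))
    (@restr_hom_eq V W f).

End Restriction.

Section TensorProduct.
Variables (S R : pzRingType) (phi : {rmorphism S -> R}) (V : lmodType S).

(* The congruence on formal sums of pure tensors whose quotient is the
   tensor product over S of R and V. *)
Inductive tens_rel : seq (R * V) -> seq (R * V) -> Prop :=
| tens_refl u : tens_rel u u
| tens_sym u v : tens_rel u v -> tens_rel v u
| tens_trans u v w : tens_rel u v -> tens_rel v w -> tens_rel u w
| tens_cat u u' v v' : tens_rel u u' -> tens_rel v v' ->
    tens_rel (u ++ v) (u' ++ v')
| tens_catC u v : tens_rel (u ++ v) (v ++ u)
| tens_0 x : tens_rel [:: (0, x)] [::]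
| tens_Dl r r' x : tens_rel [:: (r + r', x)] [:: (r, x); (r', x)]
| tens_Dr r x x' : tens_rel [:: (r, x + x')] [:: (r, x); (r, x')]
| tens_bal r s x : tens_rel [:: (r * phi s, x)] [:: (r, s *: x)].

Definition tens_relb u v := `[< tens_rel u v >].

Fact tens_rel_refl : reflexive tens_relb.
Proof. by move=> u; apply/asboolP; apply: tens_refl. Qed.
Fact tens_rel_sym : symmetric tens_relb.
Proof. by move=> u v; apply/asboolP/asboolP; apply: tens_sym. Qed.
Fact tens_rel_trans : transitive tens_relb.
Proof.
by move=> v u w /asboolP h1 /asboolP h2; apply/asboolP; apply: tens_trans h2.
Qed.

Definition tens_equiv := EquivRel tens_relb tens_rel_refl tens_rel_sym tens_rel_trans.

Definition tens := {eq_quot tens_equiv}.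
HB.instance Definition _ := Choice.on tens.

Definition tens_class (u : seq (R * V)) : tens := \pi u.

Lemma tens_classP u v : tens_class u = tens_class v <-> tens_rel u v.
Proof. by split=> [/eqquotP/asboolP|h]//; apply/eqquotP/asboolP. Qed.

Lemma tens_ind (P : tens -> Prop) : (forall u, P (tens_class u)) -> forall t, P t.
Proof. by move=> h t; rewrite -[t]reprK; apply: h. Qed.

Lemma repr_class u : tens_rel (repr (tens_class u)) u.
Proof. by apply/tens_classP; rewrite /tens_class reprK. Qed.

Definition tens_lmul (r : R) (u : seq (R * V)) := [seq (r * p.1, p.2) | p <- u].

Lemma tens_lmul_rel r u v : tens_rel u v -> tens_rel (tens_lmul r u) (tens_lmul r v).
Proof.
rewrite /tens_lmul; elim=> {u v} /=.
- by move=> u; apply: tens_refl.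
- by move=> u v _; apply: tens_sym.
- by move=> u v w _ h1 _; apply: tens_trans h1.
- by move=> u u' v v' _ h1 _ h2; rewrite !map_cat; apply: tens_cat.
- by move=> u v; rewrite !map_cat; apply: tens_catC.
- by move=> x; rewrite mulr0; apply: tens_0.
- by move=> a b x; rewrite mulrDr; apply: tens_Dl.
- by move=> a x y; apply: tens_Dr.
- by move=> a s x; rewrite mulrA; apply: tens_bal.
Qed.

Definition tens_add (t u : tens) : tens := tens_class (repr t ++ repr u).
Definition tens_zero : tens := tens_class [::].
Definition tens_scale (r : R) (t : tens) : tens := tens_class (tens_lmul r (repr t)).
Definition tens_opp (t : tens) : tens := tens_scale (-1) t.

Lemma tens_addE u v : tens_add (tens_class u) (tens_class v) = tens_class (u ++ v).
Proof. by apply/tens_classP/tens_cat; apply: repr_class. Qed.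

Lemma tens_scaleE r u : tens_scale r (tens_class u) = tens_class (tens_lmul r u).
Proof. by apply/tens_classP/tens_lmul_rel/repr_class. Qed.

Lemma tens_lmulD_rel a b u :
  tens_rel (tens_lmul (a + b) u) (tens_lmul a u ++ tens_lmul b u).
Proof.
elim: u => [|[r x] u ih] /=; first exact: tens_refl.
rewrite mulrDl; set y := (a * r, x); set z := (b * r, x).
set A := tens_lmul a u in ih *; set B := tens_lmul b u in ih *.
apply: (@tens_trans _ ([:: y; z] ++ (A ++ B))).
  by rewrite -cat1s; apply: tens_cat ih; apply: tens_Dl.
change (tens_rel ([:: y] ++ ([:: z] ++ (A ++ B))) ([:: y] ++ (A ++ ([:: z] ++ B)))).
rewrite (catA [:: z] A B) (catA A [:: z] B).
apply: tens_cat; first exact: tens_refl.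
by apply: tens_cat; [exact: tens_catC | exact: tens_refl].
Qed.

Lemma tens_lmul0_rel u : tens_rel (tens_lmul 0 u) [::].
Proof.
elim: u => [|[r x] u ih] /=; first exact: tens_refl.
rewrite mul0r -cat1s -[[::]]cat0s; apply: tens_cat ih; exact: tens_0.
Qed.

Fact tens_addA : associative tens_add.
Proof.
by elim/tens_ind=> u; elim/tens_ind=> v; elim/tens_ind=> w; rewrite !tens_addE catA.
Qed.
Fact tens_addC : commutative tens_add.
Proof.
by elim/tens_ind=> u; elim/tens_ind=> v; rewrite !tens_addE; apply/tens_classP/tens_catC.
Qed.
Fact tens_add0 : left_id tens_zero tens_add.
Proof. by elim/tens_ind=> u; rewrite tens_addE. Qed.
Fact tens_addN : left_inverse tens_zero tens_opp tens_add.
Proof.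
elim/tens_ind=> u; rewrite /tens_opp tens_scaleE tens_addE; apply/tens_classP.
have -> : u = tens_lmul 1 u.
  by rewrite /tens_lmul -[LHS]map_id; apply: eq_map => -[r x] /=; rewrite mul1r.
have -> : tens_lmul (-1) (tens_lmul 1 u) = tens_lmul (-1) u.
  by rewrite /tens_lmul -map_comp; apply: eq_map => p /=; rewrite mul1r.
apply: tens_trans (tens_lmul0_rel u).
by have := tens_lmulD_rel (-1) 1 u; rewrite addNr; apply: tens_sym.
Qed.

HB.instance Definition _ :=
  GRing.isZmodule.Build tens tens_addA tens_addC tens_add0 tens_addN.

Fact tens_scaleA a b t : tens_scale a (tens_scale b t) = tens_scale (a * b) t.
Proof.
elim/tens_ind: t => u; rewrite !tens_scaleE /tens_lmul -map_comp; congr tens_class.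
by apply: eq_map => p /=; rewrite mulrA.
Qed.
Fact tens_scale1 : left_id 1 tens_scale.
Proof.
elim/tens_ind=> u; rewrite tens_scaleE; congr tens_class.
by rewrite /tens_lmul -[RHS]map_id; apply: eq_map => -[r x] /=; rewrite mul1r.
Qed.
Fact tens_scaleDr : right_distributive tens_scale +%R.
Proof.
move=> a; elim/tens_ind=> u; elim/tens_ind=> v.
rewrite [X in tens_scale _ X]tens_addE !tens_scaleE [RHS]tens_addE.
by rewrite /tens_lmul map_cat.
Qed.
Fact tens_scaleDl t : {morph tens_scale^~ t : a b / a + b}.
Proof.
move=> a b; elim/tens_ind: t => u; rewrite /= !tens_scaleE [RHS]tens_addE.
exact/tens_classP/tens_lmulD_rel.
Qed.

HB.instance Definition _ := GRing.Zmodule_isLmodule.Build R tens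
  tens_scaleA tens_scale1 tens_scaleDr tens_scaleDl.

Definition tensor (r : R) (x : V) : tens := tens_class [:: (r, x)].

End TensorProduct.

Section Extension.
Variables (K : fieldType) (S R : dgca K) (phi : dgcaHom S R).
Local Notation "r ⊗ x" := (tensor phi r x) (at level 40).

(* Together with R-multilinearity these equations determine E. *)
Record extension_str (V : linfAlg S) (E : linfStr (R := R) (tens phi V)) : Prop :=
  ExtensionStr {
  ext_homog : forall n t, homog E n t <->
    exists l : seq (R * V),
      (forall p, p \in l -> exists i j,
         [/\ homog (dgca_gr R) i p.1, homog V j p.2 & i + j = n]) /\
      t = \sum_(p <- l) p.1 ⊗ p.2;
  ext_d : forall i r x, homog (dgca_gr R) i r ->
    dg_d E (r ⊗ x) = dgca_d R r ⊗ x + (r ⊗ dg_d V x) *~ (-1) ^ i;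
  ext_q : forall n (a b : 'I_n -> int) (r : 'I_n -> R) (x : 'I_n -> V),
    (2 <= n)%N -> (forall i, homog (dgca_gr R) (a i) (r i)) ->
    (forall i, homog V (b i) (x i)) ->
    linf_q E [seq r i ⊗ x i | i : 'I_n] =
      ((\prod_(i < n) r i) ⊗ linf_q V [seq x i | i : 'I_n])
        *~ (-1) ^ (\sum_(i < n) a i
                   + \sum_(i < n) \sum_(j < n | (i < j)%N) b i * a j)
}.

Definition extension_hom (E : forall V : linfAlg S, linfStr (R := R) (tens phi V))
    (V W : linfAlg S) (f : linfHom V W)
    (F : linfHom (LinfAlg (E V)) (LinfAlg (E W))) : Prop :=
  forall n (a b : 'I_n -> int) (r : 'I_n -> R) (x : 'I_n -> V),
    (1 <= n)%N -> (forall i, homog (dgca_gr R) (a i) (r i)) ->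
    (forall i, homog V (b i) (x i)) ->
    F [seq r i ⊗ x i | i : 'I_n] =
      ((\prod_(i < n) r i) ⊗ f [seq x i | i : 'I_n])
        *~ (-1) ^ (\sum_(i < n) \sum_(j < n | (i < j)%N) b i * a j).

End Extension.

(* Main.v *)
(* Unshuffling a list by deciding, from its head on, which elements go left, with
   the Koszul sign, gives a coproduct that is coassociative and cocommutative.
   A family of maps is lifted to lists by grouping the entries into unordered
   blocks, which are listed by their first entries; this lift is a morphism of
   coalgebras on the nose, without any use of graded symmetry.  Hence the lift
   of a composite is the composite of the lifts, and the equations of morphisms
   compose, by coassociativity alone.  The 1/k! in the definition of the
   composition turns ordered blocks into unordered ones.

   Moving scalars to the front, with the Koszul sign, commutes with unshuffling
   and with lifting, up to one term in which the differential hits a scalar and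
   which is computed by the Leibniz rule.  This yields the Jacobi identities of
   the extension and the transpose of a morphism V -> restr W; functoriality of
   the extension follows from the injectivity of transposition. *)

Require Import Defs.
From mathcomp Require Import all_boot perm all_algebra.
From mathcomp Require Import boolp zify ring.

Set Implicit Arguments.
Unset Strict Implicit.
Unset Printing Implicit Defensive.

Import GRing.Theory.
Local Open Scope ring_scope.

(** * Signs and signed formal sums *)

(** Since 0 lies in every degree, a degree cannot be read off an element, whereas the Koszul signs
    need one. All computations therefore take place on lists of elements tagged with degrees, while
    brackets and morphisms are functions on arbitrary sequences. The passage back decomposes every
    entry into homogeneous ones by an arbitrary choice ([multilin]). It is sound as soon as the
    tagged map is, in each slot, the trace of an additive map ([slotted]), and graded symmetry
    reduces this condition to the first slot. The tensor product is treated in the same way, with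
    pure tensors of homogeneous elements as tagged entries; there the condition on the first slot is
    to be biadditive and balanced. *)

Definition parity (k : int) : bool := odd `|k|%N.

Lemma parityD i j : parity (i + j) = parity i (+) parity j.
Proof. rewrite /parity; lia. Qed.
Lemma parityM i j : parity (i * j) = parity i && parity j.
Proof. by rewrite /parity abszM oddM. Qed.
Lemma parity0 : parity 0 = false. Proof. by []. Qed.
Lemma parity1 : parity 1 = true. Proof. by []. Qed.

(** With signs as booleans, composing signs is exclusive or, and every sign identity is settled by a
    finite case analysis on parities. *)
Definition signed (V : zmodType) (b : bool) (x : V) : V := if b then - x else x.

Lemma signE (V : zmodType) (x : V) k : x *~ (-1) ^ k = signed (parity k) x.
Proof.
suff -> : (-1) ^ k = (if parity k then -1 else 1) :> int.
  by rewrite /signed; case: parity; rewrite ?mulrN1z ?mulr1z.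
case: k => n; rewrite /parity.
  by rewrite -exprnP -signr_odd /absz; case: odd.
(* A negative exponent: -1 is its own inverse. *)
by rewrite NegzE abszN -exprz_inv invrN1 -exprnP -signr_odd /absz; case: (odd _);
  rewrite ?expr1 ?expr0.
Qed.

Section Sign.
Variable V : zmodType.
Implicit Types x y : V.

Lemma signedD b : {morph @signed V b : x y / x + y}.
Proof. by case: b => x y //=; rewrite opprD. Qed.
Lemma signed0 b : signed b 0 = 0 :> V. Proof. by case: b; rewrite //= oppr0. Qed.
Lemma signedN b x : signed b (- x) = - signed b x. Proof. by case: b. Qed.
Lemma signed_signed a b x : signed a (signed b x) = signed (a (+) b) x.
Proof. by case: a; case: b; rewrite //= opprK. Qed.
Lemma signed_sum b I (r : seq I) (F : I -> V) :
  signed b (\sum_(i <- r) F i) = \sum_(i <- r) signed b (F i).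
Proof. exact: (big_morph _ (signedD b) (signed0 b)). Qed.
Lemma signed_eq a b x : a = b -> signed a x = signed b x. Proof. by move=> ->. Qed.
End Sign.

Lemma signedZ (R : pzRingType) (V : lmodType R) b (r : R) (x : V) :
  r *: signed b x = signed b (r *: x).
Proof. by case: b; rewrite //= scalerN. Qed.
Lemma signedZl (R : pzRingType) (V : lmodType R) b (r : R) (x : V) :
  signed b r *: x = signed b (r *: x).
Proof. by case: b; rewrite //= scaleNr. Qed.

Lemma signedMl (R : pzRingType) b (x y : R) : signed b x * y = signed b (x * y).
Proof. by case: b; rewrite //= mulNr. Qed.
Lemma signedMr (R : pzRingType) b (x y : R) : x * signed b y = signed b (x * y).
Proof. by case: b; rewrite //= mulrN. Qed.

Definition additive_fun (U V : zmodType) (h : U -> V) := forall x y, h (x + y) = h x + h y.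

Section Addf.
Variables (U V : zmodType) (h : U -> V) (hD : additive_fun h).
Lemma addf0 : h 0 = 0.
Proof. by apply: (addIr (h 0)); rewrite -hD !add0r. Qed.
Lemma addfN x : h (- x) = - h x.
Proof. by apply: (addIr (h x)); rewrite -hD !addNr addf0. Qed.
Lemma addf_signed b x : h (signed b x) = signed b (h x).
Proof. by case: b; rewrite //= addfN. Qed.
Lemma addf_sum I (r : seq I) (F : I -> U) :
  h (\sum_(i <- r) F i) = \sum_(i <- r) h (F i).
Proof. exact: (big_morph _ hD addf0). Qed.
End Addf.

Section Eval.
Variables (X : Type) (U : zmodType).
Implicit Types (c : seq (bool * X)) (phi psi : X -> U).

(* A formal sum of elements of [X] with signs [+-1] is a list of pairs, where [true]
   stands for [-1]. *)
Definition ev c phi : U := \sum_(p <- c) signed p.1 (phi p.2).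

Lemma evD c phi psi : ev c (fun x => phi x + psi x) = ev c phi + ev c psi.
Proof. by rewrite -big_split; apply: eq_bigr => p _; rewrite signedD. Qed.
Lemma ev_signed b c phi : ev c (fun x => signed b (phi x)) = signed b (ev c phi).
Proof. by rewrite signed_sum; apply: eq_bigr => p _; rewrite !signed_signed addbC. Qed.
Lemma ev0 c : ev c (fun=> 0) = 0.
Proof. by apply: big1 => p _; rewrite signed0. Qed.
Lemma ev_sum c I (r : seq I) (P : pred I) (F : I -> X -> U) :
  ev c (fun x => \sum_(i <- r | P i) F i x) = \sum_(i <- r | P i) ev c (F i).
Proof.
by rewrite /ev exchange_big; apply: eq_bigr => p _;
  rewrite (big_morph _ (signedD _) (signed0 _ _)).
Qed.
Lemma eq_ev c phi psi : phi =1 psi -> ev c phi = ev c psi.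
Proof. by move=> e; apply: eq_bigr => p _; rewrite e. Qed.
Lemma ev_cat c c' phi : ev (c ++ c') phi = ev c phi + ev c' phi.
Proof. exact: big_cat. Qed.
End Eval.

Lemma ev_map (X Y : Type) (U : zmodType) (h : X -> Y) (b : X -> bool)
    (c : seq (bool * X)) (phi : Y -> U) :
  ev [seq (p.1 (+) b p.2, h p.2) | p <- c] phi = ev c (fun x => signed (b x) (phi (h x))).
Proof. by rewrite /ev big_map; apply: eq_bigr => p _ /=; rewrite signed_signed. Qed.

Lemma ev_morph (X : Type) (U V : zmodType) (h : U -> V) (c : seq (bool * X)) phi :
  additive_fun h -> h (ev c phi) = ev c (fun x => h (phi x)).
Proof. by move=> hD; rewrite (addf_sum hD); apply: eq_bigr => p _; rewrite addf_signed. Qed.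

Lemma ev_exchange (X Y : Type) (U : zmodType) (c : seq (bool * X)) (c' : seq (bool * Y))
    (phi : X -> Y -> U) :
  ev c (fun x => ev c' (phi x)) = ev c' (fun y => ev c (phi^~ y)).
Proof.
rewrite /ev; under eq_bigr do rewrite signed_sum.
rewrite exchange_big; apply: eq_bigr => p _; rewrite signed_sum.
by apply: eq_bigr => q _; rewrite !signed_signed addbC.
Qed.

Lemma perm_cat_cons (T : eqType) x (A B s : seq T) :
  perm_eq (A ++ x :: B) (x :: s) = perm_eq (A ++ B) s.
Proof. by rewrite perm_catC cat_cons perm_cons perm_catC. Qed.

(** * Unshuffles *)

Section Unshuffle.
Variables (T : eqType) (d : T -> int).
Implicit Types (s A B C : seq T).

Definition degsum s : int := \sum_(x <- s) d x.
Lemma degsum_cons x s : degsum (x :: s) = d x + degsum s. Proof. exact: big_cons. Qed.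
Lemma degsum_nil : degsum [::] = 0. Proof. exact: big_nil. Qed.
Lemma degsum_cat s s' : degsum (s ++ s') = degsum s + degsum s'. Proof. exact: big_cat. Qed.
Lemma degsum_perm s s' : perm_eq s s' -> degsum s = degsum s'. Proof. exact: perm_big. Qed.

(* An element sent to the right jumps over the elements already sent to the left. *)
Fixpoint unshuffle s : seq (bool * (seq T * seq T)) :=
  if s is x :: s' then
    [seq (p.1 (+) false, (x :: p.2.1, p.2.2)) | p <- unshuffle s'] ++
    [seq (p.1 (+) (parity (d x) &&
      parity (degsum p.2.1)), (p.2.1, x :: p.2.2)) | p <- unshuffle s']
  else [:: (false, ([::], [::]))].

Lemma unshuffle_perm s p : p \in unshuffle s -> perm_eq (p.2.1 ++ p.2.2) s.
Proof.
elim: s p => [|x s ih] p /=; first by rewrite inE => /eqP->.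
rewrite mem_cat => /orP[] /mapP[q /ih hq ->] /=; first by rewrite perm_cons.
by rewrite perm_cat_cons.
Qed.

Variable U : zmodType.
Implicit Types phi psi : seq T -> seq T -> U.

(** The coproduct of [s] paired with [phi]. Coalgebra identities are stated after pairing with an
    arbitrary function, so that they are equalities in [U] instead of rearrangements of formal
    sums. *)
Definition unsh_sum s phi : U := ev (unshuffle s) (fun p => phi p.1 p.2).

Lemma unsh_sum_nil phi : unsh_sum [::] phi = phi [::] [::].
Proof. by rewrite /unsh_sum /ev big_seq1. Qed.

Lemma unsh_sum_cons x s phi : unsh_sum (x :: s) phi =
  unsh_sum s (fun A B => phi (x :: A) B) +
  unsh_sum s (fun A B => signed (parity (d x) && parity (degsum A)) (phi A (x :: B))).
Proof.
rewrite /unsh_sum ev_cat.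
rewrite (ev_map (fun p => (x :: p.1, p.2)) (fun=> false)).
by rewrite (ev_map (fun p => (p.1, x :: p.2)) (fun p => parity (d x) && parity (degsum p.1))).
Qed.

(** The permutation hypothesis is how sizes, degrees and homogeneity of the entries of [s] become
    available under the sum. *)
Lemma unsh_sum_ext s phi psi :
  (forall A B, perm_eq (A ++ B) s -> phi A B = psi A B) -> unsh_sum s phi = unsh_sum s psi.
Proof.
move=> h; apply: eq_big_seq => p hp; congr signed; apply: h; exact: unshuffle_perm.
Qed.
Lemma unsh_sumD s phi psi : unsh_sum s (fun A B =>
  phi A B + psi A B) = unsh_sum s phi + unsh_sum s psi.
Proof. exact: evD. Qed.
Lemma unsh_sum_signed b s phi : unsh_sum s (fun A B =>
  signed b (phi A B)) = signed b (unsh_sum s phi).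
Proof. exact: ev_signed. Qed.
Lemma unsh_sum0 s phi : (forall A B, perm_eq (A ++ B) s -> phi A B = 0) -> unsh_sum s phi = 0.
Proof. by move=> h; rewrite (unsh_sum_ext h); exact: ev0. Qed.

Lemma unsh_sum_Anil s phi : (forall x A B, perm_eq (x :: A ++ B) s -> phi (x :: A) B = 0) ->
  unsh_sum s phi = phi [::] s.
Proof.
elim: s phi => [|x s ih] phi h; first by rewrite unsh_sum_nil.
rewrite unsh_sum_cons unsh_sum0 ?add0r => [|A B hp]; last by apply: h; rewrite perm_cons.
rewrite ih => [|y A B hp]; first by rewrite degsum_nil parity0 andbF.
by rewrite h ?signed0 // -cat_cons perm_cat_cons.
Qed.

Lemma unsh_sum_Bnil s phi : (forall x A B, perm_eq (A ++ x :: B) s -> phi A (x :: B) = 0) ->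
  unsh_sum s phi = phi s [::].
Proof.
elim: s phi => [|x s ih] phi h; first by rewrite unsh_sum_nil.
rewrite unsh_sum_cons [X in _ + X]unsh_sum0 ?addr0 => [|A B hp]; last first.
  by rewrite h ?signed0 // perm_cat_cons.
by rewrite ih // => y A B hp; apply: h; rewrite perm_cons.
Qed.
End Unshuffle.

Lemma unsh_sum_morph (T : eqType) (d : T -> int) (U V : zmodType) (h : U -> V) s phi :
  additive_fun h -> h (unsh_sum d s phi) = unsh_sum d s (fun A B => h (phi A B)).
Proof. by move=> hD; rewrite /unsh_sum ev_morph. Qed.

Section Coassoc.
Variables (T : eqType) (d : T -> int) (U : zmodType).
Implicit Types (s A B C : seq T).
Local Notation unsh_sum := (unsh_sum d).
Local Notation degsum := (degsum d).

(** Exchanging the two sides exchanges the two summands of [unsh_sum_cons]. *)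
Lemma unsh_sum_cocomm s (phi : seq T -> seq T -> U) :
  unsh_sum s phi = unsh_sum s (fun A B =>
    signed (parity (degsum A) && parity (degsum B)) (phi B A)).
Proof.
elim: s phi => [|x s ih] phi; first by rewrite !unsh_sum_nil degsum_nil parity0.
rewrite !unsh_sum_cons addrC; congr (_ + _); rewrite [LHS]ih;
  apply: unsh_sum_ext => A B _; rewrite !signed_signed ?degsum_cons ?parityD; apply: signed_eq;
  by case: parity; case: parity; case: parity.
Qed.

(** Both sides distribute the entries of [s] over three bins with the same sign. *)
Lemma unsh_sum_coassoc s (phi : seq T -> seq T -> seq T -> U) :
  unsh_sum s (fun A B => unsh_sum A (fun A1 A2 => phi A1 A2 B)) =
  unsh_sum s (fun A B => unsh_sum B (fun B1 B2 => phi A B1 B2)).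
Proof.
elim: s phi => [|x s ih] phi; first by rewrite !unsh_sum_nil.
rewrite !unsh_sum_cons.
(* The head goes to the first, second or third bin. *)
transitivity (unsh_sum s (fun A B => unsh_sum A (fun A1 A2 => phi (x :: A1) A2 B))
  + unsh_sum s (fun A B => unsh_sum A (fun A1 A2 =>
    signed (parity (d x) && parity (degsum A1)) (phi A1 (x :: A2) B)))
  + unsh_sum s (fun A B => unsh_sum A (fun A1 A2 =>
    signed (parity (d x) &&
      (parity (degsum A1) (+) parity (degsum A2))) (phi A1 A2 (x :: B))))).
  congr (_ + _); first by rewrite -unsh_sumD; apply: unsh_sum_ext => A B _;
    rewrite unsh_sum_cons.
  apply: unsh_sum_ext => A B _; rewrite -unsh_sum_signed;
    apply: unsh_sum_ext => A1 A2 /degsum_perm <-.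
  by rewrite degsum_cat parityD.
rewrite !ih -addrA; congr (_ + _).
rewrite -unsh_sumD; apply: unsh_sum_ext => A B _;
  rewrite unsh_sum_cons signedD -!unsh_sum_signed; congr (_ + _).
apply: unsh_sum_ext => B1 B2 _; rewrite !signed_signed.
by apply: signed_eq; case: parity; case: parity; case: parity.
Qed.

End Coassoc.

(** * The lift of a family of maps to lists *)

Lemma perm_size_leq (T : eqType) (A B s : seq T) : perm_eq (A ++ B) s ->
  (size A <= size s)%N /\ (size B <= size s)%N.
Proof. by move=> /perm_size <-; rewrite size_cat leq_addl leq_addr. Qed.

Section Lift.
Variables (T T' : eqType) (d : T -> int) (b : seq T -> T').
Implicit Types (s A B C : seq T).

(* The blocks are listed by their first entries; [n] is fuel, the intended value being
   [size s]. *)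
Fixpoint lift n s : seq (bool * seq T') :=
  match n, s with
  | n'.+1, x :: s' => flatten [seq [seq (q.1 (+) p.1, b (x :: p.2.1) :: q.2)
      | q <- lift n' p.2.2] | p <- unshuffle d s']
  | _, [::] => [:: (false, [::])]
  | 0%N, _ :: _ => [::]
  end.

Lemma lift_fuel n m s : (size s <= n)%N -> (size s <= m)%N -> lift n s = lift m s.
Proof.
elim: n m s => [|n ih] [|m] [|x s] //= hn hm; congr flatten; apply/eq_in_map => p hp.
have [_ hB] := perm_size_leq (unshuffle_perm hp).
by rewrite (ih m) ?(leq_trans hB).
Qed.

Variable U : zmodType.
Implicit Types phi psi : seq T' -> U.

Definition lift_sum s phi : U := ev (lift (size s) s) phi.

Lemma lift_sum_nil phi : lift_sum [::] phi = phi [::].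
Proof. by rewrite /lift_sum /ev big_seq1. Qed.

(** The recursion without fuel: [A] completes the block of [x], and [B] is left for the other
    blocks. *)
Lemma lift_sum_cons x s phi : lift_sum (x :: s) phi =
  unsh_sum d s (fun A B => lift_sum B (fun l => phi (b (x :: A) :: l))).
Proof.
rewrite /lift_sum /ev /= big_flatten big_map /unsh_sum /ev; apply: eq_big_seq => p hp /=.
have [_ hB] := perm_size_leq (unshuffle_perm hp).
rewrite big_map signed_sum (lift_fuel hB (leqnn _)); apply: eq_bigr => q _ /=.
by rewrite signed_signed addbC.
Qed.

Lemma lift_sum_ext s phi psi :
  (forall P, perm_eq (flatten P) s -> all (fun A => A != [::]) P ->
     phi (map b P) = psi (map b P)) -> lift_sum s phi = lift_sum s psi.
Proof.
have [n] := ubnP (size s); elim: n s phi psi => // n ih [|x s] phi psi /ltnSE hs h.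
  by rewrite !lift_sum_nil (h [::]).
rewrite !lift_sum_cons; apply: unsh_sum_ext => A B hp; apply: ih => [|P hP hP0].
  by have [_ hB] := perm_size_leq hp; apply: leq_ltn_trans hs.
apply: (h ((x :: A) :: P)) => //=; rewrite perm_cons.
by apply: perm_trans hp; rewrite perm_cat2l.
Qed.
Lemma lift_sumD s phi psi : lift_sum s (fun l =>
  phi l + psi l) = lift_sum s phi + lift_sum s psi.
Proof. exact: evD. Qed.
Lemma lift_sum_signed c s phi : lift_sum s (fun l =>
  signed c (phi l)) = signed c (lift_sum s phi).
Proof. exact: ev_signed. Qed.

(** Serves for functions that only see one block, such as the identity morphism, the unit of the
    adjunction, or a differential. *)
Lemma lift_sum_single x s phi :
  (forall A B P, perm_eq (flatten (A :: B :: P)) (x :: s) -> A != [::] -> B != [::] ->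
     phi [seq b C | C <- A :: B :: P] = 0) ->
  lift_sum (x :: s) phi = phi [:: b (x :: s)].
Proof.
move=> h; rewrite lift_sum_cons unsh_sum_Bnil ?lift_sum_nil // => y A B hp.
rewrite lift_sum_cons unsh_sum0 // => C D hD; rewrite -[RHS](ev0 _ (lift (size D) D)).
apply: lift_sum_ext => P hP _; apply: (h (x :: A) (y :: C) P) => //=.
rewrite perm_cons -(permPr hp) perm_cat2l perm_cons.
by rewrite -(permPr hD) perm_cat2l.
Qed.
End Lift.

Lemma lift_sum_morph (T T' : eqType) (d : T -> int) (b : seq T -> T') (U V : zmodType)
  (h : U -> V) s phi : additive_fun h -> h (lift_sum d b s phi) = lift_sum d b s (fun l =>
    h (phi l)).
Proof. by move=> hD; rewrite /lift_sum ev_morph. Qed.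

Section Coalgebra.
Variables (T T' : eqType) (d : T -> int) (d' : T' -> int) (b : seq T -> T').
Hypothesis db : forall A, d' (b A) = degsum d A.
Variable U : zmodType.
Implicit Types (s A B C : seq T).
Local Notation lift_sum := (lift_sum d b).

Lemma degsum_blocks (P : seq (seq T)) : degsum d' (map b P) = degsum d (flatten P).
Proof. by elim: P => [|A P ih] //=; rewrite ?degsum_nil // degsum_cons degsum_cat db ih. Qed.

Lemma lift_sum_evu (V : zmodType) s s2 (d2 : T -> int) (phi : seq T' -> seq T -> seq T -> V) :
  lift_sum s (fun l => unsh_sum d2 s2 (phi l)) = unsh_sum d2 s2 (fun A B =>
    lift_sum s (fun l => phi l A B)).
Proof. exact: ev_exchange. Qed.

Lemma lift_sum_coalg s (phi : seq T' -> seq T' -> U) :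
  lift_sum s (fun l => unsh_sum d' l phi) =
  unsh_sum d s (fun A B => lift_sum A (fun l => lift_sum B (phi l))).
Proof.
have [n] := ubnP (size s); elim: n s phi => // n ih [|x s] phi /ltnSE hs.
  by rewrite lift_sum_nil !unsh_sum_nil !lift_sum_nil.
(* The block of [x] goes left in the first summand; in the second it goes right and jumps over the
   blocks already on the left. *)
transitivity
  (unsh_sum d s (fun A B => unsh_sum d B (fun B1 B2 =>
     lift_sum B1 (fun l => lift_sum B2 (fun m => phi (b (x :: A) :: l) m)))) +
   unsh_sum d s (fun A B => unsh_sum d B (fun B1 B2 =>
     signed (parity (degsum d (x :: A)) && parity (degsum d B1))
     (lift_sum B1 (fun l => lift_sum B2 (fun m => phi l (b (x :: A) :: m))))))).
  rewrite lift_sum_cons -unsh_sumD; apply: unsh_sum_ext => A B hp.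
  have hB : (size B < n)%N.
    by have [_ hB] := perm_size_leq hp; apply: leq_ltn_trans hs.
  transitivity (lift_sum B (fun l0 => unsh_sum d' l0 (fun l m => phi (b (x :: A) :: l) m)) +
     lift_sum B (fun l0 => unsh_sum d' l0 (fun l m =>
       signed (parity (degsum d (x :: A)) && parity (degsum d' l)) (phi l (b (x :: A) :: m))))).
    by rewrite -lift_sumD; apply: lift_sum_ext => P _ _; rewrite unsh_sum_cons db.
  rewrite !ih //; congr (_ + _); apply: unsh_sum_ext => B1 B2 _.
  rewrite -lift_sum_signed; apply: lift_sum_ext => P hP _.
  by rewrite -lift_sum_signed; apply: lift_sum_ext => Q hQ _;
    rewrite degsum_blocks (degsum_perm _ hP).
rewrite unsh_sum_cons -!unsh_sum_coassoc; congr (_ + _).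
  apply: unsh_sum_ext => A B hp; rewrite lift_sum_cons; apply: unsh_sum_ext => A1 A2 _.
  by [].
(* Cocommutativity draws the left part before the block of [x], as the right-hand side does; of the
   sign of the whole block only that of [x] survives. *)
transitivity (unsh_sum d s (fun A B => unsh_sum d A (fun A1 A2 =>
   signed (parity (d x) && parity (degsum d A1)) (lift_sum A1 (fun l => lift_sum B (fun m =>
     phi l (b (x :: A2) :: m))))))).
  apply: unsh_sum_ext => A B hp; rewrite [LHS]unsh_sum_cocomm; apply: unsh_sum_ext => A1 A2 _.
  by rewrite signed_signed degsum_cons parityD; apply: signed_eq; case: parity; case: parity;
    case: parity.
rewrite unsh_sum_coassoc; apply: unsh_sum_ext => A B _; rewrite unsh_sum_signed; congr signed.
rewrite -lift_sum_evu; apply: lift_sum_ext => P _ _.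
by rewrite lift_sum_cons.
Qed.
End Coalgebra.

(** * Graded symmetry *)

Lemma signed_false (V : zmodType) b (x : V) : b = false -> signed b x = x.
Proof. by move=> ->. Qed.

Ltac parity_case :=
  repeat first [rewrite parityD | rewrite parityM]; rewrite ?parity0 ?parity1;
  repeat match goal with |- context [parity ?k] => case: (parity k) end; by [].
Ltac signed_case := repeat rewrite signed_signed;
  first [apply: signed_eq | apply: signed_false]; parity_case.

Section Symmetry.
Variables (T : eqType) (d : T -> int) (x y : T).
Implicit Types (s A B C : seq T).
Local Notation sxy := (signed (parity (d x) && parity (d y))).

Lemma perm_swap s1 s2 : perm_eq (s1 ++ x :: y :: s2) (s1 ++ y :: x :: s2).
Proof. by rewrite perm_cat2l -(cat1s x) -(cat1s y s2) perm_catCA. Qed.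

(** If [x] and [y] land on the same side, the hypotheses on [psi] apply. If they are separated, the
    swap exchanges two terms, and the sign is that of one of them jumping over the other. *)
Lemma unsh_sum_swap (U : zmodType) s1 s2 (psi : seq T -> seq T -> U) :
  (forall A1 A2 B, perm_eq ((A1 ++ x :: y :: A2) ++ B) (s1 ++ x :: y :: s2) ->
     psi (A1 ++ x :: y :: A2) B = sxy (psi (A1 ++ y :: x :: A2) B)) ->
  (forall A B1 B2, perm_eq (A ++ B1 ++ x :: y :: B2) (s1 ++ x :: y :: s2) ->
     psi A (B1 ++ x :: y :: B2) = sxy (psi A (B1 ++ y :: x :: B2))) ->
  unsh_sum d (s1 ++ x :: y :: s2) psi = sxy (unsh_sum d (s1 ++ y :: x :: s2) psi).
Proof.
elim: s1 psi => [|z s1 ih] psi hA hB /=.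
  rewrite !unsh_sum_cons !signedD -!unsh_sum_signed -!addrA; congr (_ + _);
    last rewrite addrCA; last congr (_ + (_ + _)).
  - by apply: unsh_sum_ext => A B hp; apply: (hA [::]); rewrite /= !perm_cons.
  - by apply: unsh_sum_ext => A B hp; rewrite degsum_cons; signed_case.
  - by apply: unsh_sum_ext => A B hp; rewrite degsum_cons; signed_case.
  - apply: unsh_sum_ext => A B hp; rewrite !signed_signed (hB A [::]) /=; first by signed_case.
    by rewrite !perm_cat_cons.
rewrite !unsh_sum_cons signedD; congr (_ + _).
  apply: ih => [A1 A2 B hp|A B1 B2 hp]; first by apply: (hA (z :: A1)); rewrite perm_cons.
  by apply: hB; rewrite perm_cons.
apply: ih => [A1 A2 B hp|A B1 B2 hp].
  rewrite hA ?perm_cat_cons // !(degsum_perm _ (perm_swap A1 A2)); first by signed_case.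
by rewrite (hB A (z :: B1)) ?perm_cat_cons //; signed_case.
Qed.

(** If [x] and [y] share a block, the second hypothesis applies. If they start two blocks, the swap
    changes the order in which these blocks are listed, and the first hypothesis applies. *)
Lemma lift_sum_swap (T' : eqType) (b : seq T -> T') (U : zmodType) s1 s2 (phi : seq T' -> U) :
  (forall P1 A B P2, perm_eq (flatten (P1 ++ A :: B :: P2)) (s1 ++ x :: y :: s2) ->
     phi (map b (P1 ++ A :: B :: P2)) =
     signed (parity (degsum d A) && parity (degsum d B)) (phi (map b (P1 ++ B :: A :: P2)))) ->
  (forall P1 A1 A2 P2,
     perm_eq (flatten (P1 ++ (A1 ++ x :: y :: A2) :: P2)) (s1 ++ x :: y :: s2) ->
     phi (map b (P1 ++ (A1 ++ x :: y :: A2) :: P2)) =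
     sxy (phi (map b (P1 ++ (A1 ++ y :: x :: A2) :: P2)))) ->
  lift_sum d b (s1 ++ x :: y :: s2) phi = sxy (lift_sum d b (s1 ++ y :: x :: s2) phi).
Proof.
have [n] := ubnP (size (s1 ++ x :: y :: s2)).
elim: n s1 s2 phi => // n ih [|z s1] s2 phi /ltnSE hs hphi hb /=; last first.
  rewrite !lift_sum_cons; apply: unsh_sum_swap => [A1 A2 B hp|A B1 B2 hp].
    rewrite -lift_sum_signed; apply: lift_sum_ext => P hP _;
      apply: (hb [::] (z :: A1) A2 P) => /=.
    by rewrite perm_cons; apply: perm_trans hp; rewrite perm_cat2l.
  apply: ih => [|P1 C D P2 hP|P1 C1 C2 P2 hP].
  - by have [_ hB] := perm_size_leq hp; apply: leq_ltn_trans hB hs.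
  - apply: (hphi ((z :: A) :: P1)); rewrite /= perm_cons.
    by apply: perm_trans hp; rewrite perm_cat2l.
  - apply: (hb ((z :: A) :: P1)); rewrite /= perm_cons.
    by apply: perm_trans hp; rewrite perm_cat2l.
rewrite /= in hphi hb; rewrite !lift_sum_cons !unsh_sum_cons signedD; congr (_ + _).
  rewrite -unsh_sum_signed; apply: unsh_sum_ext => A B hp; rewrite -lift_sum_signed.
  apply: lift_sum_ext => P hP _; apply: (hb [::] [::] A P); rewrite /= !perm_cons.
  by apply: perm_trans hp; rewrite perm_cat2l.
(* Different blocks: [x :: A] and [y :: C] come first, and [D] is left for the others. *)
transitivity (unsh_sum d s2 (fun A B => unsh_sum d B (fun C D =>
  signed (parity (d y) && parity (degsum d A))
    (lift_sum d b D (fun l => phi (b (x :: A) :: b (y :: C) :: l)))))).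
  by apply: unsh_sum_ext => A B hp; rewrite unsh_sum_signed lift_sum_cons.
transitivity (sxy (unsh_sum d s2 (fun A B => unsh_sum d B (fun C D =>
  signed (parity (d x) && parity (degsum d A))
    (lift_sum d b D (fun l => phi (b (y :: A) :: b (x :: C) :: l))))))); last first.
  by congr signed; apply: unsh_sum_ext => A B hp; rewrite unsh_sum_signed lift_sum_cons.
(* [E] gathers the remaining entries of both blocks, so that cocommutativity can exchange [A] and
   [C]. *)
rewrite -!unsh_sum_coassoc -unsh_sum_signed; apply: unsh_sum_ext => E D hE.
rewrite [in RHS]unsh_sum_cocomm -unsh_sum_signed; apply: unsh_sum_ext => A C hA;
  rewrite !signed_signed.
transitivity (signed (parity (d y) &&
  parity (degsum d A)) (signed (parity (degsum d (x :: A)) && parity (degsum d (y :: C)))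
  (lift_sum d b D (fun l => phi (b (y :: C) :: b (x :: A) :: l))))).
  congr signed; rewrite -lift_sum_signed; apply: lift_sum_ext => P hP _.
  apply: (hphi [::] (x :: A) (y :: C) P) => /=; rewrite perm_cons perm_cat_cons.
  apply: perm_trans hE; rewrite catA; apply: perm_cat => //.
by rewrite !degsum_cons; signed_case.
Qed.
End Symmetry.

Section Move.
Variables (T : eqType) (d : T -> int) (good : T -> Prop) (U : zmodType).
Implicit Types (H : seq T -> U) (s : seq T).

Definition all_good s := forall z, z \in s -> good z.

Lemma all_good_perm s s' : perm_eq s s' -> all_good s' -> all_good s.
Proof. by move=> h g z; rewrite (perm_mem h); apply: g. Qed.
Lemma all_good_cons x s : all_good (x :: s) <-> good x /\ all_good s.
Proof.
split=> [h|[hx hs] z]; first by split=> [|z hz]; apply: h; rewrite inE ?eqxx // hz orbT.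
by rewrite inE => /orP[/eqP->|]; [|apply: hs].
Qed.
Lemma all_good_cat s s' : all_good (s ++ s') <-> all_good s /\ all_good s'.
Proof.
split=> [h|[hx hs] z]; first by split=> z hz; apply: h; rewrite mem_cat hz ?orbT.
by rewrite mem_cat => /orP[/hx|/hs].
Qed.

Definition graded_symm H := forall s1 x y s2, all_good (s1 ++ x :: y :: s2) ->
  H (s1 ++ x :: y :: s2) = signed (parity (d x) && parity (d y)) (H (s1 ++ y :: x :: s2)).

(** Reduces what is to be checked in an arbitrary slot to the first slot. *)
Lemma graded_symm_move H s1 x s2 : graded_symm H -> all_good (s1 ++ x :: s2) ->
  H (s1 ++ x :: s2) = signed (parity (d x) && parity (degsum d s1)) (H (x :: s1 ++ s2)).
Proof.
move=> hH; elim/last_ind: s1 s2 => [|s1 y ih] s2; first by rewrite degsum_nil andbF.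
rewrite -!cats1 -!catA /= => hg; rewrite hH // ih; last first.
  by apply: all_good_perm hg; rewrite perm_sym perm_swap.
by rewrite degsum_cat /degsum big_seq1; signed_case.
Qed.
End Move.

(** * Multilinear extension from homogeneous elements *)

Definition multiadd (X U : zmodType) (f : seq X -> U) := forall s1 x y s2,
  f (s1 ++ (x + y) :: s2) = f (s1 ++ x :: s2) + f (s1 ++ y :: s2).

Section Madd.
Variables (X U : zmodType) (f : seq X -> U) (fD : multiadd f).
Lemma multiadd_slot s1 s2 : additive_fun (fun x => f (s1 ++ x :: s2)).
Proof. by move=> x y; apply: fD. Qed.
Lemma multiadd_head s : additive_fun (fun x => f (x :: s)).
Proof. exact: (multiadd_slot [::]). Qed.
Lemma multiadd_cons x : multiadd (fun s => f (x :: s)).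
Proof. by move=> s1 y z s2; rewrite -!cat_cons fD. Qed.
End Madd.

Section Lin.
Variables (X : zmodType) (T : eqType) (dec : X -> seq T) (pure : T -> X).
Variable good : T -> Prop.
Hypothesis dec_good : forall x t, t \in dec x -> good t.
Hypothesis decE : forall x, x = \sum_(t <- dec x) pure t.
Local Notation all_good := (all_good good).

(* [k] is the restriction to tagged homogeneous elements of an additive map on [X]. *)
Definition liftable (U : zmodType) (k : T -> U) :=
  additive_fun (fun x => \sum_(t <- dec x) k t) /\
  forall t, good t -> \sum_(u <- dec (pure t)) k u = k t.

Lemma liftable_sum (U : zmodType) (k : T -> U) (ts : seq T) : liftable k -> all_good ts ->
  \sum_(u <- dec (\sum_(t <- ts) pure t)) k u = \sum_(t <- ts) k t.
Proof.
case=> kD kE hts; rewrite (addf_sum kD); apply: eq_big_seq => t /hts; exact: kE.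
Qed.

(* [h] is given on lists of tagged homogeneous elements; every entry of [s] is decomposed
   into such elements. *)
Fixpoint multilin (U : zmodType) (s : seq X) (h : seq T -> U) : U :=
  if s is x :: s' then \sum_(t <- dec x) multilin s' (fun l => h (t :: l)) else h [::].

Lemma multilin_ext (U : zmodType) s (h h' : seq T -> U) :
  (forall l, size l = size s -> all_good l -> h l = h' l) -> multilin s h = multilin s h'.
Proof.
elim: s h h' => [|x s ih] h h' e /=; first by rewrite e.
apply: eq_big_seq => t ht; apply: ih => l hl gl; apply: e => /=; first by rewrite hl.
by apply/all_good_cons; split=> //; apply: dec_good ht.
Qed.

Lemma multilin_sum (U : zmodType) s I (r : seq I) (h : I -> seq T -> U) :
  multilin s (fun l => \sum_(i <- r) h i l) = \sum_(i <- r) multilin s (h i).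
Proof.
elim: s h => [|x s ih] h //=; under eq_bigr do rewrite ih.
exact: exchange_big.
Qed.
Lemma multilinD (U : zmodType) s (h h' : seq T -> U) :
  multilin s (fun l => h l + h' l) = multilin s h + multilin s h'.
Proof.
elim: s h h' => [|x s ih] h h' //=; under eq_bigr do rewrite ih.
exact: big_split.
Qed.
Lemma multilin_signed (U : zmodType) s b (h : seq T -> U) :
  multilin s (fun l => signed b (h l)) = signed b (multilin s h).
Proof. by elim: s h => [|x s ih] h //=; under eq_bigr do rewrite ih; rewrite signed_sum. Qed.

Lemma multilin_cat (U : zmodType) s1 s2 (h : seq T -> U) :
  multilin (s1 ++ s2) h = multilin s1 (fun l1 => multilin s2 (fun l2 => h (l1 ++ l2))).
Proof. by elim: s1 h => [|x s ih] h //=; apply: eq_bigr => t _; rewrite ih. Qed.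

(** The condition under which [multilin] does not depend on the decompositions chosen by [dec]. *)
Definition slotted (U : zmodType) (h : seq T -> U) :=
  forall s1 s2, all_good (s1 ++ s2) -> liftable (fun t => h (s1 ++ t :: s2)).

Lemma multilin_slot (U : zmodType) s1 x s2 (h : seq T -> U) :
  multilin (s1 ++ x :: s2) h =
  multilin s1 (fun l1 => multilin s2 (fun l2 => \sum_(t <- dec x) h (l1 ++ t :: l2))).
Proof. by rewrite multilin_cat; apply: multilin_ext => l1 _ _ /=; rewrite -multilin_sum. Qed.

Lemma multilin_madd (U : zmodType) (h : seq T -> U) : slotted h -> multiadd (fun s =>
  multilin s h).
Proof.
move=> hh s1 x y s2; rewrite !multilin_slot -multilinD; apply: multilin_ext => l1 _ g1.
rewrite -multilinD; apply: multilin_ext => l2 _ g2; apply: (proj1 (hh _ _ _)).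
by apply/all_good_cat.
Qed.

(** [dec] need not return a pure entry unchanged; liftability of each slot makes up for that. *)
Lemma multilin_pure (U : zmodType) (h : seq T -> U) l : slotted h -> all_good l ->
  multilin (map pure l) h = h l.
Proof.
elim: l h => [|t l ih] h hh //= /all_good_cons[ht hl].
rewrite -[RHS](proj2 (hh [::] l hl)) //=; apply: eq_big_seq => u hu.
apply: ih => // s1 s2 hs; apply: (hh (u :: s1)); apply/all_good_cons; split=> //.
exact: dec_good hu.
Qed.

Definition spanned (C : T -> Prop) x :=
  exists ts, (forall t, t \in ts -> C t) /\ x = \sum_(t <- ts) pure t.

Lemma spanned_good x : spanned good x.
Proof. by exists (dec x); split=> // t; apply: dec_good. Qed.

(** [Cs] prescribes, slot by slot, the class from which the pure summands are taken; with classes of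
    fixed degree this yields the homogeneity of values. *)
Lemma multiadd_ind (U : zmodType) (P : U -> Prop) (f : seq X -> U)
    (Cs : seq (T -> Prop)) s : P 0 -> (forall u v, P u -> P v -> P (u + v)) ->
  multiadd f -> List.Forall2 spanned Cs s ->
  (forall l, List.Forall2 (fun C t => C t) Cs l -> P (f (map pure l))) -> P (f s).
Proof.
move=> P0 PD fD h; elim: h f fD => {Cs s} [|C x Cs s [ts [hts ->]] _ ih] f fD hf.
  by apply: (hf [::]).
rewrite (addf_sum (multiadd_head fD s)) big_seq; elim/big_ind: _ => // t ht.
apply: (ih (fun s => f (pure t :: s)) (multiadd_cons fD _)) => l hl.
by apply: (hf (t :: l)); constructor=> //; apply: hts.
Qed.

Lemma multiadd_ind_good (U : zmodType) (P : U -> Prop) (f : seq X -> U) s :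
  P 0 -> (forall u v, P u -> P v -> P (u + v)) -> multiadd f ->
  (forall l, size l = size s -> all_good l -> P (f (map pure l))) -> P (f s).
Proof.
move=> P0 PD fD hf; apply: (@multiadd_ind _ _ f (nseq (size s) good)) => //.
  by elim: (s) => //= x s' ih; constructor=> //; apply: spanned_good.
move=> l hl; have [hs hg] : size l = size s /\ all_good l; last exact: hf.
move: hl {hf}; move: (size s) => n; move eC: (nseq n good) => Cs hl.
elim: hl n eC => {Cs l} [|C t Cs l Ct _ ih] [|n] //.
case=> eC eCs; have [hl hg] := ih n eCs; split; first by rewrite /= hl.
by apply/all_good_cons; split=> //; rewrite eC.
Qed.
End Lin.

Section GradingDec.
Variables (V : zmodType) (G : grading V).
Definition homog_tag (p : int * V) := homog G p.1 p.2.

Lemma homogN i x : homog G i x -> homog G i (- x).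
Proof. by move=> h; rewrite -sub0r; apply: homogB => //; apply: homog0. Qed.
Lemma homogD i x y : homog G i x -> homog G i y -> homog G i (x + y).
Proof. by move=> hx hy; rewrite -[y]opprK; apply: homogB => //; apply: homogN. Qed.
Lemma homog_signed b i x : homog G i x -> homog G i (signed b x).
Proof. by case: b => //; apply: homogN. Qed.
Lemma homog_sum i I (r : seq I) (P : pred I) F :
  (forall j, P j -> homog G i (F j)) -> homog G i (\sum_(j <- r | P j) F j).
Proof. by move=> h; elim/big_ind: _ => //; [apply: homog0|apply: homogD]. Qed.

Lemma homog_dec_exists x : exists s : seq (int * V), all_good homog_tag s /\ x =
  \sum_(p <- s) p.2.
Proof.
have [I [c [hc ->]]] := homog_span G x.
exists [seq (i, c i) | i <- I]; split; last by rewrite big_map.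
by move=> p /mapP[i _ ->]; apply: hc.
Qed.

(** Chosen once for each [x], without any additivity in [x]; [homog_dec_liftable] shows that sums
    over it behave as if there were. *)
Definition homog_dec x := projT1 (cid (homog_dec_exists x)).
Lemma homog_dec_good x t : t \in homog_dec x -> homog_tag t.
Proof. by move: t; apply: (projT2 (cid (homog_dec_exists x))).1. Qed.
Lemma homog_decE x : x = \sum_(t <- homog_dec x) t.2.
Proof. exact: (projT2 (cid (homog_dec_exists x))).2. Qed.

Definition homog_additive (U : zmodType) (k : int * V -> U) := forall i x y,
  homog G i x -> homog G i y -> k (i, x + y) = k (i, x) + k (i, y).

Lemma homog_additive0 (U : zmodType) (k : int * V -> U) i : homog_additive k -> k (i, 0) = 0.
Proof.
by move=> hk; apply: (addIr (k (i, 0))); rewrite -hk ?add0r //; apply: homog0.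
Qed.

(** Collecting the entries of equal degree gives homogeneous components, which vanish by
    [homog_free]; within one degree [k] is additive. *)
Lemma hadd_free (U : zmodType) (k : int * V -> U) s : homog_additive k ->
  all_good homog_tag s ->
  \sum_(p <- s) p.2 = 0 -> \sum_(p <- s) k p = 0.
Proof.
move=> hk hs s0.
pose J := undup (map fst s).
have split_sum (W : zmodType) (F : int * V -> W) :
    \sum_(p <- s) F p = \sum_(i <- J) \sum_(p <- s | p.1 == i) F p.
  rewrite (exchange_big_dep xpredT) //=; apply: eq_big_seq => p hp.
  rewrite -big_filter (bigD1_seq p.1) /= ?filter_uniq ?undup_uniq //; last first.
    by rewrite mem_filter eqxx mem_undup map_f.
  rewrite big_filter_cond big1 ?addr0 // => i /andP[/eqP->].
  by rewrite eqxx.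
have hc i : homog G i (\sum_(p <- s | p.1 == i) p.2).
  rewrite big_seq_cond; apply: homog_sum => p /andP[/hs hp /eqP <-]; exact: hp.
rewrite split_sum big_seq big1 // => i hi.
transitivity (k (i, \sum_(p <- s | p.1 == i) p.2)); last first.
  have := homog_free (undup_uniq _) hc _ hi; rewrite -split_sum => -> //.
  exact: homog_additive0.
rewrite big_seq_cond [in RHS]big_seq_cond.
suff [] : k (i, \sum_(p <- s | (p \in s) && (p.1 == i)) p.2) =
  \sum_(p <- s | (p \in s) && (p.1 == i)) k p /\ homog G i
   (\sum_(p <- s | (p \in s) && (p.1 == i)) p.2) by move=> ->.
elim/big_rec2: _ => [|p u v /andP[/hs hp /eqP hpi] [<- hv]].
  by split; [apply: homog_additive0|apply: homog0].
move: hp; rewrite /homog_tag hpi => hp; split; last exact: homogD.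
by rewrite hk // -hpi; case: (p).
Qed.

Lemma homog_dec_liftable (U : zmodType) (k : int * V -> U) : homog_additive k ->
  liftable homog_dec snd homog_tag k.
Proof.
move=> hk.
(* Two decompositions of one element: listing the second with opposite entries after the first gives
   a vanishing sum. *)
have key s s' : all_good homog_tag s -> all_good homog_tag s' ->
  \sum_(p <- s) p.2 = \sum_(p <- s') p.2 ->
    \sum_(p <- s) k p = \sum_(p <- s') k p.
  move=> hs hs' e; apply/eqP; rewrite -subr_eq0; apply/eqP.
  have eN (W : zmodType) (F : int * V -> W) :
    - (\sum_(p <- s') F p) = \sum_(p <- s') - F p by rewrite sumrN.
  transitivity (\sum_(p <- s ++ [seq (p.1, - p.2) | p <- s']) k p).
    rewrite eN big_cat big_map; congr (_ + _); apply: eq_big_seq => -[i x] /hs' hx /=.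
    by apply/esym/eqP; rewrite -addr_eq0 -hk ?addNr ?homog_additive0 //; apply: homogN.
  apply: hadd_free => //; last by rewrite big_cat big_map /= -eN e subrr.
  apply/all_good_cat; split=> // p /mapP[q /hs' hq ->]; exact: homogN.
split=> [x y|[i x] hx] /=.
  rewrite -big_cat; apply: key; last by rewrite big_cat -!homog_decE.
    exact: homog_dec_good.
  by apply/all_good_cat; split; apply: homog_dec_good.
transitivity (\sum_(p <- [:: (i, x)]) k p); last by rewrite big_seq1.
apply: key; first exact: homog_dec_good.
  by move=> p; rewrite inE => /eqP->.
by rewrite -homog_decE big_seq1.
Qed.
End GradingDec.

(** * Shuffle permutations and ordered blocks *)

Section OrderedBlocks.
Variables (T : eqType) (d : T -> int) (U : zmodType).
Implicit Types (s A B C : seq T) (psi : seq (seq T) -> U).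

(** The iterated coproduct with [k] factors: in contrast to [lift_sum], the blocks are ordered and
    may be empty. *)
Fixpoint block_sum k s psi : U :=
  if k is k'.+1 then unsh_sum d s (fun A B => block_sum k' B (fun P => psi (A :: P)))
  else if s is [::] then psi [::] else 0.

Lemma block_sumS k s psi :
  block_sum k.+1 s psi = unsh_sum d s (fun A B => block_sum k B (fun P => psi (A :: P))).
Proof. by []. Qed.

Lemma block_sum_ext k s psi psi' :
  (forall P, perm_eq (flatten P) s -> size P = k -> psi P = psi' P) ->
  block_sum k s psi = block_sum k s psi'.
Proof.
elim: k s psi psi' => [|k ih] s psi psi' h /=; first by case: s h => // h; rewrite h.
apply: unsh_sum_ext => A B hp; apply: ih => P hP hs; apply: h => /=; last by rewrite hs.
by apply: perm_trans hp; rewrite perm_cat2l.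
Qed.
Lemma block_sum_signed k s c psi : block_sum k s (fun P =>
  signed c (psi P)) = signed c (block_sum k s psi).
Proof.
elim: k s psi => [|k ih] s psi /=; first by case: s; rewrite ?signed0.
by rewrite -unsh_sum_signed; apply: unsh_sum_ext => A B _; rewrite ih.
Qed.
Lemma block_sum0 k s psi : (forall P, perm_eq (flatten P) s -> size P = k -> psi P = 0) ->
  block_sum k s psi = 0.
Proof.
elim: k s psi => [|k ih] s psi h /=; first by case: s h => // h; rewrite h.
apply: unsh_sum0 => A B hp; apply: ih => P hP hs; apply: h => /=; last by rewrite hs.
by apply: perm_trans hp; rewrite perm_cat2l.
Qed.

Definition block_symm s psi := forall P1 A B P2,
  perm_eq (flatten (P1 ++ A :: B :: P2)) s ->
  psi (P1 ++ A :: B :: P2) =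
    signed (parity (degsum d A) && parity (degsum d B)) (psi (P1 ++ B :: A :: P2)).

Lemma block_symm_cons A B s psi : perm_eq (A ++ B) s -> block_symm s psi ->
  block_symm B (fun P => psi (A :: P)).
Proof.
move=> hp h P1 C D P2 hP; apply: (h (A :: P1)) => /=.
by apply: perm_trans hp; rewrite perm_cat2l.
Qed.

(** The block of [x] can stand in any of [k.+1] positions, and symmetry brings it to the front, sign
    included. *)
Lemma block_sum_cons k x s psi : block_symm (x :: s) psi ->
  block_sum k.+1 (x :: s) psi =
  unsh_sum d s (fun A B => block_sum k B (fun P => psi ((x :: A) :: P))) *+ k.+1.
Proof.
elim: k s psi => [|k ih] s psi hpsi.
  rewrite [LHS]unsh_sum_cons [X in _ + X]unsh_sum0 ?addr0 // => A B _.
  by rewrite /= signed0.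
rewrite [LHS]block_sumS unsh_sum_cons mulrS; congr (_ + _).
(* Here [x] is not in the first block [A]; by induction its block is brought to the second place. *)
transitivity (unsh_sum d s (fun A B => unsh_sum d B (fun C D =>
  signed (parity (d x) && parity (degsum d A))
    (block_sum k D (fun P => psi (A :: (x :: C) :: P))))) *+ k.+1).
  have hM : additive_fun (fun u : U => u *+ k.+1) by move=> u v; rewrite mulrnDl.
  rewrite (unsh_sum_morph _ _ _ hM); apply: unsh_sum_ext => A B hp; rewrite unsh_sum_signed ih.
    by case: (_ && _) => //=; rewrite mulNrn.
  by apply: block_symm_cons hpsi; rewrite perm_cat_cons.
congr (_ *+ _); rewrite -!unsh_sum_coassoc; apply: unsh_sum_ext => E D hE.
rewrite [LHS]unsh_sum_cocomm; apply: unsh_sum_ext => A C hA;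
  rewrite signed_signed -block_sum_signed.
apply: block_sum_ext => P hP _; rewrite (hpsi [::]) /=; first by rewrite degsum_cons;
  signed_case.
rewrite perm_cat_cons -(permPr hE) catA; apply: perm_cat => //.
by rewrite -(permPr hA) perm_catC.
Qed.

(** Lists with an empty block contribute nothing, and [k] nonempty blocks can be ordered in [k!]
    ways with equal contributions. *)
Lemma block_sum_evf k s psi : block_symm s psi ->
  (forall P1 P2, psi (P1 ++ [::] :: P2) = 0) ->
  block_sum k s psi = lift_sum d id s (fun P => if size P == k then psi P else 0) *+ k`!.
Proof.
elim: k s psi => [|k ih] [|x s] psi hpsi h0.
- by rewrite lift_sum_nil.
- rewrite fact0 mulr1n -[LHS](ev0 _ (lift d id (size (x :: s)) (x :: s)));
    apply: lift_sum_ext => -[] //=.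
  by move=> /perm_size.
(* No entries but at least one block: this block is empty. *)
- transitivity (0 : U); last by rewrite lift_sum_nil mul0rn.
  by apply: block_sum0 => -[|[|y A] P] // hP _; [apply: (h0 [::])|have := perm_size hP].
rewrite block_sum_cons // lift_sum_cons factS mulnC mulrnA; congr (_ *+ _).
have hM : additive_fun (fun u : U => u *+ k`!) by move=> u v; rewrite mulrnDl.
rewrite (unsh_sum_morph _ _ _ hM); apply: unsh_sum_ext => A B hp; rewrite ih //.
  by apply: block_symm_cons hpsi; rewrite perm_cons.
by move=> P1 P2; apply: (h0 (_ :: P1)).
Qed.

Lemma block_sum_two s psi : block_sum 2 s psi = unsh_sum d s (fun A B => psi [:: A; B]).
Proof. by apply: unsh_sum_ext => A B _ /=; rewrite unsh_sum_Bnil. Qed.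
End OrderedBlocks.

(** Separates the choice of the blocks from the map applied to them, so that lifts of different maps
    can be compared block by block. *)
Lemma lift_sum_blocks (T T' : eqType) (d : T -> int) (b : seq T -> T') (U : zmodType) s
    (phi : seq T' -> U) :
  lift_sum d b s phi = lift_sum d id s (fun P => phi (map b P)).
Proof.
have [n] := ubnP (size s); elim: n s phi => // n ih [|x s] phi /ltnSE hs.
  by rewrite !lift_sum_nil.
rewrite !lift_sum_cons; apply: unsh_sum_ext => A B hp; rewrite ih //.
by have [_ hB] := perm_size_leq hp; apply: leq_ltn_trans hs.
Qed.

Lemma unsh_sum_map (T T' : eqType) (d : T' -> int) (h : T -> T') (U : zmodType) s
    (phi : seq T' -> seq T' -> U) :
  unsh_sum d (map h s) phi = unsh_sum (d \o h) s (fun A B => phi (map h A) (map h B)).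
Proof.
elim: s phi => [|x s ih] phi; first by rewrite !unsh_sum_nil.
rewrite !unsh_sum_cons !ih; congr (_ + _); apply: unsh_sum_ext => A B _.
by rewrite /degsum big_map.
Qed.

(** * Shuffle permutations as lists of increasing blocks *)

Section Permutations.
Variables (n : nat) (e : 'I_n -> int).
Implicit Types (l A B : seq 'I_n).

Definition ord_lt : rel 'I_n := fun i j => (i < j)%N.
Lemma ord_lt_trans : transitive ord_lt. Proof. by move=> j i k; apply: ltn_trans. Qed.
Lemma sorted_olt l : sorted ord_lt l = sorted ltn (map val l).
Proof. by rewrite sorted_map. Qed.
Lemma enum_olt : sorted ord_lt (enum 'I_n).
Proof. by rewrite sorted_olt val_enum_ord iota_ltn_sorted. Qed.

Definition cross_inversions A B : int := \sum_(a <- A) \sum_(b <- B | (b < a)%N) e a * e b.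
Fixpoint inversions l : int :=
  if l is a :: l' then \sum_(b <- l' | (b < a)%N) e a * e b + inversions l' else 0.

Lemma inversions_cat A B : inversions (A ++ B) =
  inversions A + inversions B + cross_inversions A B.
Proof.
elim: A => [|a A ih] /=; first by rewrite /cross_inversions big_nil add0r addr0.
rewrite big_cat ih /cross_inversions big_cons /=; ring.
Qed.

Lemma ord_lt_path x l : path ord_lt x l -> all (fun y : 'I_n => (x < y)%N) l.
Proof. by move=> /(order_path_min ord_lt_trans). Qed.

Lemma inversions_sorted l : sorted ord_lt l -> inversions l = 0.
Proof.
elim: l => //= x l ih hx; rewrite ih ?(path_sorted hx) // addr0 big_seq_cond big1 //.
by move=> y /andP[/(allP (ord_lt_path hx)) /ltnW]; rewrite leqNgt => /negbTE ->.
Qed.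

Lemma perm_all_min x l A B : path ord_lt x l -> perm_eq (A ++ B) l ->
  (forall y, y \in A -> (x < y)%N) /\ (forall y, y \in B -> (x < y)%N).
Proof.
move=> hx hp; split=> y hy; apply: (allP (ord_lt_path hx));
  by rewrite -(perm_mem hp) mem_cat hy ?orbT.
Qed.

(** The head of an increasing list is its minimum: sent left it creates no inversion, sent right it
    creates one with every entry on the left, which is the sign recorded by [unshuffle]. *)
Lemma unshuffle_inv l p : sorted ord_lt l -> p \in unshuffle e l ->
  [/\ sorted ord_lt p.2.1, sorted ord_lt p.2.2 & p.1 = parity (cross_inversions p.2.1 p.2.2)].
Proof.
elim: l p => [|x l ih] p hl /=.
  by rewrite inE => /eqP-> /=; rewrite /cross_inversions big_nil.
have hl' := path_sorted hl; rewrite mem_cat => /orP[] /mapP[q hq ->] /=.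
  have [hA hB ->] := ih q hl' hq; have [mA mB] := perm_all_min hl (unshuffle_perm hq).
  split=> //.
    by rewrite (path_sortedE ord_lt_trans) hA andbT; apply/allP.
  rewrite addbF /cross_inversions big_cons [X in parity (X + _)](_ : _ = 0) ?add0r //.
  by rewrite big_seq_cond big1 // => y /andP[/mB /ltnW]; rewrite leqNgt => /negbTE->.
have [hA hB ->] := ih q hl' hq; have [mA mB] := perm_all_min hl (unshuffle_perm hq).
split=> //; first by rewrite (path_sortedE ord_lt_trans) hB andbT; apply/allP.
rewrite -parityM -parityD /cross_inversions; congr parity;
  rewrite /degsum mulr_sumr addrC -big_split.
by apply: eq_big_seq => y /mA hy; rewrite big_cons hy mulrC.
Qed.

(** The lists of blocks over which [block_sum] runs, without the signs, which are recovered from the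
    inversions. *)
Fixpoint ordered_splits k l : seq (seq (seq 'I_n)) :=
  if k is k'.+1 then
    flatten [seq [seq p.2.1 :: P | P <- ordered_splits k' p.2.2] | p <- unshuffle e l]
  else if l is [::] then [:: [::]] else [::].

Lemma block_sum_ounsh (U : zmodType) k l (psi : seq (seq 'I_n) -> U) : sorted ord_lt l ->
  block_sum e k l psi = \sum_(P <- ordered_splits k l) signed (parity (inversions (flatten
    P))) (psi P).
Proof.
(* The permutation property is proved along: the inversions between the first block and the rest
   must not depend on how the rest is cut. *)
suff : sorted ord_lt l ->
  block_sum e k l psi = \sum_(P <- ordered_splits k l) signed (parity (inversions (flatten
    P))) (psi P)
  /\ forall P, P \in ordered_splits k l -> perm_eq (flatten P) l.
  by move=> h /h[].
elim: k l psi => [|k ih] l psi hl /=.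
  case: l hl => [|x l] hl; first by rewrite big_seq1; split=> // P; rewrite inE => /eqP->.
  by rewrite big_nil.
split; last first.
  move=> P /flatten_mapP[p hp /mapP[Q hQ ->]] /=.
  have [hA hB _] := unshuffle_inv hl hp.
  have [_ /(_ _ hQ) hQp] := ih p.2.2 (fun P => psi (p.2.1 :: P)) hB.
  by apply: perm_trans (unshuffle_perm hp); rewrite perm_cat2l.
rewrite /unsh_sum /ev big_flatten big_map; apply: eq_big_seq => p hp.
have [hA hB ->] := unshuffle_inv hl hp.
have [-> hQ] := ih p.2.2 (fun P => psi (p.2.1 :: P)) hB.
rewrite big_map signed_sum; apply: eq_big_seq => Q /hQ hQp /=.
rewrite signed_signed inversions_cat (inversions_sorted hA) add0r parityD addbC;
  congr (signed (_ (+) parity _) _).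
by apply: eq_bigr => a _; apply/esym; apply: perm_big.
Qed.

(** The minimum of [l] is the head of [A] or of [B], which tells to which side [unshuffle] has to
    send it. *)
Lemma unshuffle_mem l A B : sorted ord_lt l -> sorted ord_lt A -> sorted ord_lt B ->
  perm_eq (A ++ B) l -> (A, B) \in map snd (unshuffle e l).
Proof.
elim: l A B => [|x l ih] A B hl hA hB hp.
  by have := perm_size hp; rewrite size_cat; case: A hA hp => //; case: B hB.
rewrite /= map_cat mem_cat -!map_comp.
have hl' := path_sorted hl.
have xmin y : y \in A ++ B -> (x <= y)%N.
  by rewrite (perm_mem hp) inE => /orP[/eqP->|/(allP (ord_lt_path hl)) /ltnW].
have: x \in A ++ B by rewrite (perm_mem hp) mem_head.
have head C : sorted ord_lt C -> x \in C -> {subset C <= A ++ B} ->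
    exists2 C', C = x :: C' & sorted ord_lt C'.
  case: C => // y C hC; rewrite inE => /orP[/eqP<-|hx] hs; first by exists C => //;
    apply: path_sorted hC.
  have := xmin y (hs _ (mem_head _ _)); rewrite leqNgt.
  by rewrite (allP (ord_lt_path hC) _ hx).
rewrite mem_cat => /orP[] hx.
  have [|A' eA hA'] := head A hA hx; first by move=> y hy; rewrite mem_cat hy.
  rewrite {}eA perm_cons in hp *; apply/orP; left.
  by have /mapP[p hp' ep] := ih A' B hl' hA' hB hp; apply/mapP; exists p; rewrite //= -ep.
have [|B' eB hB'] := head B hB hx; first by move=> y hy; rewrite mem_cat hy orbT.
rewrite {}eB perm_cat_cons in hp *; apply/orP; right.
by have /mapP[p hp' ep] := ih A B' hl' hA hB' hp; apply/mapP; exists p; rewrite //= -ep.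
Qed.

Lemma unshuffle_uniq l : uniq l -> uniq (map snd (unshuffle e l)).
Proof.
elim: l => //= x l ih /andP[hx hl]; rewrite map_cat cat_uniq -!map_comp.
rewrite (eq_map (g := (fun p => (x :: p.1, p.2)) \o snd)) //.
rewrite [X in uniq X && _]map_comp map_inj_uniq ?ih //; last by move=> [A B] [C D] [-> ->].
rewrite (eq_map (f := snd \o _) (g := (fun p => (p.1, x :: p.2)) \o snd)) //.
rewrite [X in _ && uniq X]map_comp map_inj_uniq ?ih //; last by move=> [A B] [C D] [-> ->].
rewrite andbT; apply/hasPn => p /mapP[q hq ->]; apply/mapP => -[r hr /= [hA hB]].
case/negP: hx; rewrite -(perm_mem (unshuffle_perm hq)) mem_cat hA mem_head //.
Qed.

Lemma ordered_splits_mem k l P : sorted ord_lt l -> (P \in ordered_splits k l) =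
  [&& size P == k, all (sorted ord_lt) P & perm_eq (flatten P) l].
Proof.
elim: k l P => [|k ih] l P hl /=.
  case: P => [|A P] /=; case: l hl => [|x l] hl //=.
  by apply/esym/negbTE/negP => /perm_size.
apply/flatten_mapP/and3P => [[p hp /mapP[Q hQ ->]]|[]].
  have [hA hB _] := unshuffle_inv hl hp; move: hQ; rewrite ih // => /and3P[/eqP hs hQ hp'].
  rewrite /= hs hA; split=> //.
  by apply: perm_trans (unshuffle_perm hp); rewrite perm_cat2l.
case: P => //= A P; rewrite eqSS => hs /andP[hA hP] hp.
(* [unshuffle] keeps entries in order, so what remains after the first block must be the increasing
   rearrangement of the other blocks. *)
pose B := sort (fun i j : 'I_n => i <= j)%N (flatten P).
have hB : perm_eq (flatten P) B by rewrite perm_sym perm_sort.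
have hAB : perm_eq (A ++ B) l by rewrite -(permPr hp) perm_cat2l perm_sym.
have ul : uniq l by apply: sorted_uniq hl; [exact: ord_lt_trans|move=> i; rewrite /ord_lt ltnn].
have uB : uniq B by move: ul; rewrite -(perm_uniq hAB) cat_uniq => /and3P[].
have sB : sorted ord_lt B.
  rewrite sorted_olt ltn_sorted_uniq_leq map_inj_uniq ?uB //; last exact: val_inj.
  rewrite sorted_map; apply: sort_sorted => i j; exact: leq_total.
have /mapP[p hp' ep] := unshuffle_mem hl hA sB hAB;
  have [eA eB] := (congr1 fst ep, congr1 snd ep).
rewrite /= in eA eB.
by exists p => //; apply/mapP; exists P; rewrite -?eA // ih -?eB // hs hP.
Qed.

Lemma ordered_splits_uniq k l : sorted ord_lt l -> uniq (ordered_splits k l).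
Proof.
elim: k l => [|k ih] l hl /=; first by case: l hl.
have ul : uniq l by apply: sorted_uniq hl; [exact: ord_lt_trans|move=> i; rewrite /ord_lt ltnn].
have := unshuffle_uniq ul.
have : {subset unshuffle e l <= unshuffle e l} by [].
(* The induction runs over a sublist, whose members remain unshuffles of [l] by [hs]. *)
elim: {1 3 4}(unshuffle e l) => //= p c ihc hs /andP[hp hc].
rewrite cat_uniq ihc ?andbT //; last by move=> q hq; apply: hs; rewrite inE hq orbT.
have [hA hB _] := unshuffle_inv hl (hs _ (mem_head _ _)).
rewrite map_inj_uniq ?ih //=; last by move=> P Q [].
apply/hasPn => P /flatten_mapP[q hq /mapP[Q hQ ->]]; apply/mapP => -[Q' hQ' [eA eQ]].
have [hA' hB' _] : [/\ sorted ord_lt q.2.1, sorted ord_lt q.2.2 & _] :=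
  unshuffle_inv hl (hs q (mem_behead (s := p :: c) hq)).
case/negP: hp; apply/mapP; exists q => //.
(* With equal first blocks, both right parts are increasing rearrangements of the same list, hence
   equal. *)
rewrite [p.2]surjective_pairing [q.2]surjective_pairing eA; congr (_, _).
apply: (sorted_eq (leT := ord_lt)) => //; first exact: ord_lt_trans.
  move=> i j /andP[]; rewrite /ord_lt => h1 h2; have := ltn_trans h1 h2; by rewrite ltnn.
move: hQ hQ'; rewrite !ordered_splits_mem // -eQ => /and3P[_ _ h1] /and3P[_ _ h2].
by rewrite -(permPl h2).
Qed.

Definition perm_seq (s : 'S_n) := [seq s i | i : 'I_n].

Lemma perm_seqE s : perm_seq s = map s (enum 'I_n). Proof. by []. Qed.

Lemma koszul_inv (s : 'S_n) : koszul e s = inversions (perm_seq s).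
Proof.
have key l : sorted ord_lt l -> inversions (map s l) =
    \sum_(i <- l) \sum_(j <- l | (i < j)%N && (s j < s i)%N) e (s i) * e (s j).
  elim: l => [|x l ih] hl /=; first by rewrite big_nil.
  rewrite big_cons big_map ih ?(path_sorted hl) // big_cons ltnn /=; congr (_ + _).
    rewrite big_seq_cond [RHS]big_seq_cond; apply: eq_bigl => y.
    by case hy: (y \in l) => //=; rewrite (allP (ord_lt_path hl) _ hy).
  apply: eq_big_seq => y hy; rewrite big_cons.
  by have /ltnW := allP (ord_lt_path hl) _ hy; rewrite leqNgt => /negbTE ->.
rewrite perm_seqE key ?enum_olt // big_enum.
by apply: eq_bigr => i _; rewrite big_enum_cond.
Qed.

(** A shuffle of type [t] is determined by its list of values, and cutting this list according to
    [t] gives exactly the lists of increasing blocks of shape [t]. *)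
Lemma shuffles_ounsh (U : zmodType) (t : seq nat) (H : seq (seq 'I_n) -> U) :
  sumn t = n ->
  \sum_(s in shuffles n t) H (reshape t (perm_seq s)) =
  \sum_(P <- ordered_splits (size t) (enum 'I_n) | shape P == t) H P.
Proof.
move=> ht; rewrite -big_enum -[in RHS]big_filter.
rewrite -(big_map (fun s => reshape t (perm_seq s)) xpredT H); apply: perm_big.
have sz s : size (perm_seq s) = sumn t by rewrite size_map -cardE card_ord ht.
have inj : injective (fun s => reshape t (perm_seq s)).
  move=> s s' /(congr1 flatten); rewrite !reshapeKr ?sz // => h.
  by apply/permP => i; move/eq_in_map: h; apply; rewrite mem_enum.
apply: uniq_perm.
- by rewrite map_inj_uniq ?enum_uniq.
- by rewrite filter_uniq // ordered_splits_uniq // enum_olt.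
move=> P; rewrite mem_filter ordered_splits_mem ?enum_olt //; apply/mapP/andP.
  move=> [s hs ->]; rewrite reshapeKl ?sz //; split=> //.
  rewrite size_reshape eqxx reshapeKr ?sz //=; apply/andP; split; last first.
    apply: uniq_perm; rewrite ?enum_uniq // perm_seqE.
      by rewrite map_inj_uniq ?enum_uniq //; apply: perm_inj.
    move=> i; rewrite mem_enum; apply/mapP; exists (s^-1%g i); rewrite ?mem_enum //.
    by rewrite permKV.
  move: hs; rewrite mem_enum inE.
  rewrite [X in reshape _ X](map_comp val s) -map_reshape all_map.
  by apply: sub_all => A /=; rewrite sorted_olt.
move=> [/eqP hsh /and3P[_ hsort hperm]].
have szP : size (flatten P) = n by rewrite (perm_size hperm) -cardE card_ord.
have uP : uniq (flatten P) by rewrite (perm_uniq hperm) enum_uniq.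
(* Conversely, the permutation is read off the concatenation of the blocks. *)
pose f (i : 'I_n) := tnth (Tuple (introT eqP szP)) i.
have finj : injective f by apply/tuple_uniqP.
pose s := perm finj.
have eP : perm_seq s = flatten P.
  rewrite -[RHS]/(tval (Tuple (introT eqP szP))) -map_tnth_enum.
  by apply: eq_map => i; rewrite permE.
exists s; last by rewrite eP -hsh flattenK.
rewrite mem_enum inE [X in reshape _ X](map_comp val s) -[map s _]/(perm_seq s) eP.
rewrite -map_reshape -hsh flattenK all_map.
by apply: sub_all hsort => A /=; rewrite sorted_olt.
Qed.
End Permutations.

(* A homogeneous element [x] of degree [i] is represented by the pair [(i, x)]. *)
Definition untag (V : Type) (s : seq (int * V)) : seq V := map snd s.
Definition tag_seq (V : Type) n (e : 'I_n -> int) (x : 'I_n -> V) :=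
  [seq (e i, x i) | i <- enum 'I_n].
(** The tag is the degree of the block itself because [f] is meant to have degree 0. *)
Definition tag_block (V W : zmodType) (f : seq V -> W) (A : seq (int * V)) : int * W :=
  (degsum fst A, f (untag A)).

Lemma untag_tl (V : Type) n (e : 'I_n -> int) (x : 'I_n -> V) (l : seq 'I_n) :
  untag [seq (e i, x i) | i <- l] = map x l.
Proof. by rewrite /untag -map_comp. Qed.

Lemma lift_sum_map (T T' T'' : eqType) (d : T' -> int) (b : seq T' -> T'') (h : T -> T')
    (U : zmodType) s (phi : seq T'' -> U) :
  lift_sum d b (map h s) phi = lift_sum (d \o h) (b \o map h) s phi.
Proof.
have [n] := ubnP (size s); elim: n s phi => // n ih [|x s] phi /ltnSE hs.
  by rewrite !lift_sum_nil.
rewrite /= !lift_sum_cons unsh_sum_map; apply: unsh_sum_ext => A B hp; rewrite ih //.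
by have [_ hB] := perm_size_leq hp; apply: leq_ltn_trans hs.
Qed.

Lemma size_flatten_leq (T : eqType) (P : seq (seq T)) :
  all (fun A => A != [::]) P -> (size P <= size (flatten P))%N.
Proof.
elim: P => //= A P ih /andP[A0 /ih h]; rewrite size_cat -add1n leq_add //.
by rewrite lt0n size_eq0.
Qed.

(** * The sums over shuffles in the definitions as sums over lists *)

Section Links.
Variables (n : nat) (e : 'I_n -> int).

(** The unshuffles of the list are the shuffles of all types (j, n - j) together, sorted by the size
    of the left part. *)
Lemma insertion_sumE (V W : zmodType) (q : seq V -> V) (f : seq V -> W) (x : 'I_n -> V) :
  q [::] = 0 -> (forall s, f (0 :: s) = 0) ->
  insertion_sum q f e x =
  unsh_sum fst (tag_seq e x) (fun A B => f (q (untag A) :: untag B)).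
Proof.
move=> q0 f0; rewrite unsh_sum_map.
pose psi (P : seq (seq 'I_n)) := f (q (map x (nth [::] P 0)) :: map x (nth [::] P 1)).
transitivity (block_sum e 2 (enum 'I_n) psi); last first.
  by rewrite block_sum_two; apply: unsh_sum_ext => A B _; rewrite !untag_tl.
rewrite block_sum_ounsh ?enum_olt //.
pose H (P : seq (seq 'I_n)) := signed (parity (inversions e (flatten P))) (psi P).
transitivity (\sum_(1 <= j < n.+1) \sum_(P <- ordered_splits e 2 (enum 'I_n) | shape P == [::
  j; n - j]%N) H P).
  apply: eq_big_nat => j /andP[_ hj].
  have hs : sumn [:: j; n - j]%N = n by rewrite /= addn0 subnKC.
  rewrite -[2%N]/(size [:: j; n - j]%N) -shuffles_ounsh //; apply: eq_bigr => s _.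
  have sz : size (perm_seq s) = n by rewrite size_map -cardE card_ord.
  rewrite /H reshapeKr ?sz ?hs // signE koszul_inv; congr (signed _ (f (q _ :: _))).
    by rewrite /= map_take /perm_seq -map_comp.
  rewrite /= take_oversize ?size_drop ?sz // map_drop /perm_seq -map_comp //.
under eq_bigr do rewrite big_mkcond.
rewrite exchange_big; apply: eq_big_seq => P.
rewrite ordered_splits_mem ?enum_olt // => /and3P[/eqP sP _ hP] /=.
case: P sP hP => [|A [|B []]] //= _ hP.
have szP : (size A + size B)%N = n by have := perm_size hP;
  rewrite size_enum_ord cats0 size_cat.
have [nB leA] : (n - size A = size B /\ size A <= n)%N by lia.
rewrite -big_mkcond /= (eq_bigl (fun j => j == size A)); last first.
  by move=> j; rewrite eqseq_cons eq_sym; case: eqP => // ->; rewrite nB eqxx.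
rewrite big_nat1_eq ltnS leA andbT.
(* The sum over j starts at 1, so an empty left part is missing on one side; on the other its term
   vanishes since [q [::] = 0]. *)
by case: A {hP szP nB leA} => //=; rewrite /psi /= q0 f0 signed0.
Qed.

Variables (K : fieldType) (R : dgca K).
Hypothesis charK : [pchar K] =i pred0.

(** This is where characteristic zero enters: [k!] is invertible in [K]. *)
Lemma unit_fact_scale (W : lmodType R) k (u : W) :
  dgca_unit R (k`!%:R^-1) *: (u *+ k`!) = u.
Proof.
rewrite -scalerMnr scalerMnl -rmorphMn -mulr_natr mulVf ?rmorph1 ?scale1r //.
by have /pcharf0P -> := charK; rewrite -lt0n fact_gt0.
Qed.

Variables (U V : lmodType R) (W : lmodType R).
Variables (GU : grading U) (GV : grading V) (GW : grading W).
Variables (mf mg : nat) (ag : int) (f : seq U -> V) (g : seq V -> W) (x : 'I_n -> U).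
Hypothesis (hf : @gsym_family K R U V GU GV mf 0 f).
Hypothesis (hg : @gsym_family K R V W GV GW mg ag g).
Hypothesis (n_gt0 : (1 <= n)%N) (hx : forall i, homog GU (e i) (x i)).

Lemma composition_sumE :
  composition_sum g f e x = lift_sum fst (tag_block f) (tag_seq e x) (fun l => g (untag l)).
Proof.
rewrite lift_sum_map lift_sum_blocks.
pose psi (P : seq (seq 'I_n)) := g [seq f (map x A) | A <- P].
have fh (l : seq 'I_n) : homog GV (degsum e l) (f (map x l)).
  have := gsym_homog hf (e := map e l) (s := map x l); rewrite add0r big_map; apply.
  split=> [|k]; rewrite !size_map // => hk.
  by case: l hk => // i0 l hk; rewrite !(nth_map i0).
have psi_symm l : block_symm e l psi.
  move=> P1 A B P2 _; rewrite /psi !map_cat /= (gsymC hg _ _ (fh A) (fh B)).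
  by rewrite signE parityM.
have psi0 P1 P2 : psi (P1 ++ [::] :: P2) = 0.
  rewrite /psi map_cat /= (gsym_nil hf).
  exact: (addf0 (multiadd_slot (gsymD hg) _ _)).
transitivity (lift_sum e id (enum 'I_n) psi); last first.
  apply: lift_sum_ext => P _ _; rewrite map_id /psi /untag -map_comp; congr g.
  by apply: eq_map => A /=; rewrite untag_tl.
(* Families of unordered blocks are sorted by the number of blocks, and below, once ordered, by the
   tuple of their sizes. *)
transitivity (\sum_(1 <= k < n.+1)
    lift_sum e id (enum 'I_n) (fun P => if size P == k then psi P else 0)); last first.
  rewrite -ev_sum; apply: lift_sum_ext => P hP P0; rewrite map_id -big_mkcond /=.
  rewrite (eq_bigl (fun j => j == size P)) => [|j]; last by rewrite eq_sym.
  rewrite big_nat1_eq ltnS (leq_trans (size_flatten_leq P0)) ?andbT; last first.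
    by rewrite (perm_size hP) size_enum_ord.
  (* There is at least one block, since [n] is positive. *)
  by case: P hP {P0} => // /perm_size; rewrite size_enum_ord => n0; have := n_gt0;
    rewrite -{1}n0.
apply: eq_big_nat => k /andP[k_gt0 hk].
rewrite -[RHS](unit_fact_scale k) -block_sum_evf // -scaler_sumr; congr (_ *: _).
rewrite block_sum_ounsh ?enum_olt //.
pose H (P : seq (seq 'I_n)) := signed (parity (inversions e (flatten P))) (psi P).
transitivity (\sum_(t : k.-tuple 'I_n.+1 | (sumn (map val t) == n) && all (leq 1) (map val t))
   \sum_(P <- ordered_splits e k (enum 'I_n) | shape P == map val t) H P).
  apply: eq_bigr => t /andP[/eqP ht _].
  rewrite -[in ordered_splits e k _](size_tuple t) -(size_map val t) -shuffles_ounsh //.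
  apply: eq_bigr => s _.
  have sz : size (perm_seq s) = n by rewrite size_map -cardE card_ord.
  rewrite /H reshapeKr ?sz ?ht // signE koszul_inv /psi; congr (signed _ (g _)).
  have -> : [seq x (s i) | i : 'I_n] = map x (perm_seq s) by rewrite /perm_seq -map_comp.
  by rewrite -map_reshape -map_comp.
under eq_bigr do rewrite big_mkcond.
rewrite exchange_big; apply: eq_big_seq => P.
rewrite ordered_splits_mem ?enum_olt // => /and3P[/eqP sP _ hP] /=.
have szP : sumn (shape P) = n by rewrite -size_flatten (perm_size hP) size_enum_ord.
rewrite -big_mkcondr /=.
(* Lists with an empty block match no admissible tuple, and [psi] vanishes on them. *)
case P0: (all (leq 1) (shape P)); last first.
  rewrite big_pred0 => [|t]; last first.
    by apply/negbTE/negP => /andP[/andP[_ h] /eqP e0]; rewrite e0 h in P0.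
  have : has (fun A => A == [::]) P.
    move/negbT: P0; rewrite -has_predC has_map; apply: sub_has => A /=.
    by rewrite lt0n negbK size_eq0.
  move=> /hasP[A hA /eqP A0]; rewrite A0 in hA.
  by case/splitPr: hA => P1 P2; rewrite psi0 signed0.
(* All other lists match exactly one tuple, their shape, whose entries are at most [n]. *)
have st : size (map (inord : nat -> 'I_n.+1) (shape P)) == k by rewrite !size_map sP.
have et : map val (map (inord : nat -> 'I_n.+1) (shape P)) = shape P.
  rewrite -map_comp -[RHS]map_id; apply/eq_in_map => m hm /=; rewrite inordK // ltnS.
  by rewrite -szP sumnE (big_rem _ hm) leq_addr.
rewrite (big_pred1 (Tuple st)) // => t.
rewrite pred1E -val_eqE /= -(inj_eq (inj_map val_inj)) et.
have szPn : sumn (shape P) == n by rewrite szP.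
case: (shape P =P map val t) => [e0|]; last by rewrite andbF.
have e1 : shape P = [seq nat_of_ord i | i <- t] by [].
by rewrite -e1 szPn P0.
Qed.
End Links.

(** * Graded symmetric families from their values on homogeneous lists *)

Section GsymFromHead.
Variables (K : fieldType) (R : dgca K) (X W : lmodType R) (GX : grading X).
Variables (m : nat) (a : int) (f : seq X -> W).
Hypothesis homogZ : forall i j r x,
  homog (dgca_gr R) i r -> homog GX j x -> homog GX (i + j) (r *: x).
Hypothesis fD : multiadd f.
Hypothesis fC : forall i j s1 x y s2, homog GX i x -> homog GX j y ->
  f (s1 ++ x :: y :: s2) = f (s1 ++ y :: x :: s2) *~ (-1) ^ (i * j).

Lemma gsym_move (l : seq (int * X)) j x s1 s2 : all_good (homog_tag GX) l -> homog GX j x ->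
  f (s1 ++ untag l ++ x :: s2) =
  signed (parity j && parity (degsum fst l)) (f (s1 ++ x :: untag l ++ s2)).
Proof.
move=> hl hx; elim: l s1 hl => [|y l ih] s1 /=; first by rewrite degsum_nil andbF.
move=> /all_good_cons[hy hl]; rewrite -cat_rcons ih // cat_rcons (fC _ _ hy hx).
by rewrite signE degsum_cons; signed_case.
Qed.

(** Decompose [x] into homogeneous parts and move [r *: x] and [x] to the head: the two Koszul signs
    differ by the sign of moving [r] alone. *)
Lemma gsymZ_of_head :
  (forall i r x s, homog (dgca_gr R) i r -> (m <= (size s).+1)%N ->
     f (r *: x :: s) = signed (parity i && parity a) (r *: f (x :: s))) ->
  forall e s1 i r x s2, (m <= size (s1 ++ x :: s2))%N ->
    homogs GX e s1 -> homog (dgca_gr R) i r ->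
    f (s1 ++ (r *: x) :: s2) =
      (r *: f (s1 ++ x :: s2)) *~ (-1) ^ (i * (a + \sum_(j <- e) j)).
Proof.
move=> hZ e s1 i r x s2 hm [he hs1] hr; rewrite signE.
have [l [ee es hl]] : exists l, [/\ e = map fst l, s1 = untag l & all_good (homog_tag GX) l].
  exists (zip e s1); split.
  - by rewrite [RHS]unzip1_zip ?he.
  - by rewrite [RHS]unzip2_zip ?he.
  - move=> p /(nthP (0, 0)) [k]; rewrite size_zip he minnn => hk <-.
    by rewrite nth_zip // /homog_tag /=; apply: hs1.
subst e s1; rewrite big_map -/(degsum fst l).
rewrite {1 2}(homog_decE GX x) scaler_sumr !(addf_sum (multiadd_slot fD _ _)).
rewrite scaler_sumr signed_sum; apply: eq_big_seq => t /homog_dec_good ht.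
have := gsym_move [::] s2 hl ht; rewrite /= => ->.
have hrt := homogZ hr ht.
have := gsym_move [::] s2 hl hrt; rewrite /= => ->.
rewrite (hZ i) //; first by rewrite signedZ; signed_case.
by move: hm; rewrite !size_cat /= addnS.
Qed.
End GsymFromHead.

Section GsymLin.
Variables (K : fieldType) (R : dgca K) (X W : lmodType R).
Variables (GX : grading X) (GW : grading W).
Variables (T : eqType) (dec : X -> seq T) (pure : T -> X) (good : T -> Prop) (d : T -> int).
Hypothesis dec_good : forall x t, t \in dec x -> good t.
Hypothesis decE : forall x, x = \sum_(t <- dec x) pure t.
Hypothesis homogZ : forall i j r x,
  homog (dgca_gr R) i r -> homog GX j x -> homog GX (i + j) (r *: x).
Hypothesis homog_span : forall i x, homog GX i x ->
  spanned pure (fun t => good t /\ d t = i) x.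
Local Notation multilin := (multilin dec).

Lemma homogs_span e s : homogs GX e s ->
  List.Forall2 (spanned pure) [seq (fun t => good t /\ d t = i) | i <- e] s.
Proof.
elim: e s => [|i e ih] [|x s] [] //= [hs] h; constructor.
  by apply: homog_span; apply: (h 0).
by apply: ih; split=> // k hk; apply: (h k.+1).
Qed.

Lemma Forall2_deg e l :
  List.Forall2 (fun C t => C t) [seq (fun t => good t /\ d t = i) | i <- e] l ->
  all_good good l /\ degsum d l = \sum_(i <- e) i.
Proof.
elim: e l => [|i e ih] [|t l] /= h; try by inversion h.
  by rewrite /degsum !big_nil.
have [[ht <-] hl] : (good t /\ d t = i) /\
    List.Forall2 (fun C t => C t) [seq (fun t => good t /\ d t = i) | i <- e] l.
  by inversion h.
have [gl dl] := ih _ hl; rewrite degsum_cons big_cons dl; split=> //.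
by apply/all_good_cons.
Qed.

Variables (m : nat) (a : int) (h : seq T -> W).
Hypothesis hs : graded_symm d good h.
Hypothesis hslot : slotted dec pure good h.
Let f s := multilin s h.

Lemma multilin_C i j s1 x y s2 : homog GX i x -> homog GX j y ->
  f (s1 ++ x :: y :: s2) = f (s1 ++ y :: x :: s2) *~ (-1) ^ (i * j).
Proof.
move=> /homog_span[ts [hts ->]] /homog_span[us [hus ->]];
  rewrite signE /f !multilin_cat /= -multilin_signed.
apply: (multilin_ext dec_good) => l1 _ g1.
have gts : all_good good ts by move=> t /hts[].
have gus : all_good good us by move=> t /hus[].
(* The decompositions by [dec] are traded for the given ones, whose members have degrees [i] and
   [j], so that the symmetry of [h] yields the right sign. *)
have key (ts' us' : seq T) : all_good good ts' -> all_good good us' ->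
   multilin (\sum_(t <- ts') pure t :: \sum_(t <- us') pure t :: s2) (fun l => h (l1 ++ l)) =
   multilin s2 (fun l => \sum_(t <- ts') \sum_(u <- us') h (l1 ++ t :: u :: l)).
  move=> gt gu /=; under eq_bigr do rewrite -multilin_sum; rewrite -multilin_sum.
  apply: (multilin_ext dec_good) => l _ gl.
  transitivity (\sum_(t <- dec (\sum_(t <- ts') pure t)) \sum_(u <- us') h (l1 ++ t :: u :: l)).
    apply: eq_big_seq => t /dec_good ht.
    apply: (liftable_sum (k := fun u => h (l1 ++ t :: u :: l)) _ gu).
    have := hslot (s1 := rcons l1 t) (s2 := l); rewrite cat_rcons.
    under eq_fun do rewrite cat_rcons.
    by apply; apply/all_good_cat; split=> //; apply/all_good_cons.
  rewrite exchange_big [RHS]exchange_big; apply: eq_big_seq => u /gu hu.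
  apply: (liftable_sum (k := fun t => h (l1 ++ t :: u :: l)) _ gt).
  by apply: hslot; apply/all_good_cat; split=> //; apply/all_good_cons.
move: (key ts us gts gus) (key us ts gus gts) => /= -> ->; rewrite -multilin_signed.
apply: (multilin_ext dec_good) => l _ gl; rewrite signed_sum exchange_big.
apply: eq_big_seq => u hu; rewrite signed_sum; apply: eq_big_seq => t ht.
have [[gt dt] [gu du]] := (hts _ ht, hus _ hu).
by rewrite hs ?dt ?du -?parityM //; apply/all_good_cat; split=> //; do !(apply/all_good_cons;
  split=> //).
Qed.

Hypothesis h0 : h [::] = 0.
Hypothesis hhom : forall l, all_good good l -> homog GW (a + degsum d l) (h l).
Hypothesis hZ : forall i r t l, homog (dgca_gr R) i r -> good t -> all_good good l ->
  (m <= (size l).+1)%N ->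
  multilin ((r *: pure t) :: map pure l) h = signed (parity i && parity a) (r *: h (t :: l)).

Lemma gsym_lin : gsym_family GX GW m a (fun s => multilin s h).
Proof.
have fD : multiadd (fun s => multilin s h) by exact: (multilin_madd dec_good hslot).
split=> //; last exact: multilin_C.
  apply: (gsymZ_of_head homogZ fD) => [i j s1 x y s2 hx hy|i r x s hr hm].
    exact: multilin_C.
  (* [F] measures the failure of linearity in the head slot. It is multiadditive, hence zero once it
     vanishes on pure entries. *)
  pose F (s : seq X) : W := if s is x :: s' then
    multilin (r *: x :: s') h - signed (parity i &&
      parity a) (r *: multilin (x :: s') h) else 0.
  have FD : multiadd F.
    move=> [|y s1] u v s2; rewrite /F /=.
      rewrite scalerDr -[\sum_(t <- dec (u + v)) _]/(multilin (u + v :: s2) h).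
      rewrite -[\sum_(t <- dec (_ + _)) _]/(multilin (r *: u + r *: v :: s2) h).
      rewrite !(multiadd_head fD) scalerDr signedD opprD addrACA //.
    rewrite -[\sum_(t <- dec (r *: y)) _]/(multilin ((r *: y :: s1) ++ (u + v :: s2)) h).
    rewrite -[\sum_(t <- dec y) _]/(multilin ((y :: s1) ++ (u + v :: s2)) h).
    by rewrite !fD scalerDr signedD opprD addrACA.
  apply/eqP; rewrite -subr_eq0; apply/eqP;
    apply: (@multiadd_ind_good _ _ _ _ _ dec_good decE _ (eq^~ 0) F (x :: s)) => //.
    by move=> u v -> ->; rewrite addr0.
  move=> [|t l] //= [hl] /all_good_cons[gt gl].
  rewrite -[\sum_(t <- dec (r *: _)) _]/(multilin (r *: pure t :: map pure l) h).
  rewrite -[\sum_(t <- dec (pure t)) _]/(multilin (map pure (t :: l)) h).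
  rewrite (multilin_pure dec_good) //; last by apply/all_good_cons.
  by rewrite (hZ hr) ?subrr // hl.
move=> e s he; have hF := homogs_span he.
apply: (multiadd_ind (P := homog GW _) _ _ fD hF) => [||l].
- exact: homog0.
- exact: homogD.
by move=> /Forall2_deg[gl <-]; rewrite (multilin_pure dec_good) //; apply: hhom.
Qed.
End GsymLin.

(** * The category of algebras *)

Section EvalClosed.
Variables (T : eqType) (d : T -> int) (U : zmodType) (Q : U -> Prop).
Hypotheses (Q0 : Q 0) (QD : forall u v, Q u -> Q v -> Q (u + v)) (Qsg : forall b u, Q u ->
  Q (signed b u)).

Lemma unsh_sum_closed s phi : (forall A B, perm_eq (A ++ B) s -> Q (phi A B)) ->
  Q (unsh_sum d s phi).
Proof.
move=> h; rewrite /unsh_sum /ev big_seq; elim/big_ind: _ => // p hp; apply: Qsg; apply: h.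
exact: unshuffle_perm hp.
Qed.

Lemma lift_sum_closed (T' : eqType) (b : seq T -> T') s phi :
  (forall P, perm_eq (flatten P) s -> Q (phi (map b P))) -> Q (lift_sum d b s phi).
Proof.
have [n] := ubnP (size s); elim: n s phi => // n ih [|x s] phi /ltnSE hs h.
  by rewrite lift_sum_nil; apply: (h [::]).
rewrite lift_sum_cons; apply: unsh_sum_closed => A B hp; apply: ih => [|P hP].
  by have [_ hB] := perm_size_leq hp; apply: leq_ltn_trans hs.
apply: (h ((x :: A) :: P)) => //=; rewrite perm_cons.
by apply: perm_trans hp; rewrite perm_cat2l.
Qed.
End EvalClosed.

Definition tagged_add (W U : zmodType) (phi : seq (int * W) -> U) := forall l1 i v w l2,
  phi (l1 ++ (i, v + w) :: l2) = phi (l1 ++ (i, v) :: l2) + phi (l1 ++ (i, w) :: l2).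

Lemma tagged_add_head (W U : zmodType) (phi : seq (int * W) -> U) i l :
  tagged_add phi -> additive_fun (fun w => phi ((i, w) :: l)).
Proof. by move=> h v w; apply: (h [::]). Qed.

Lemma tagged_add_cons (W U : zmodType) (phi : seq (int * W) -> U) x :
  tagged_add phi -> tagged_add (fun l => phi (x :: l)).
Proof. by move=> h l1 i v w l2; apply: (h (x :: l1)). Qed.

Lemma tagged_add_unt (W U : zmodType) (g : seq W -> U) : multiadd g -> tagged_add (fun l =>
  g (untag l)).
Proof. by move=> h l1 i v w l2; rewrite /untag !map_cat /= h. Qed.

Lemma additive_fun_ev (X : Type) (U V : zmodType) (c : seq (bool * X)) (F : X -> U -> V) :
  (forall x, additive_fun (F x)) -> additive_fun (fun u => ev c (fun x => F x u)).
Proof. by move=> h u v; rewrite -evD; apply: eq_ev => x; apply: h. Qed.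

(** * The lift of a composite, and composition of morphisms *)

Section Composition.
Variables (T T' : eqType) (d : T -> int) (d' : T' -> int) (b : seq T -> T').
Hypothesis db : forall A, d' (b A) = degsum d A.
Variables (W U : zmodType) (g : seq T' -> W).

(** The outer block of the first entry consists of its inner block and some of the other inner
    blocks. [lift_sum_coalg] turns this choice of inner blocks into a choice of entries. *)
Lemma lift_sum_comp s (phi : seq (int * W) -> U) : tagged_add phi ->
  lift_sum d b s (fun l => lift_sum d' (fun m => (degsum d' m, g m)) l phi) =
  lift_sum d (fun A => (degsum d A, lift_sum d b A g)) s phi.
Proof.
have [n] := ubnP (size s); elim: n s phi => // n ih [|x s] phi /ltnSE hs hphi.
  by rewrite !lift_sum_nil.
rewrite !lift_sum_cons.
transitivity (unsh_sum d s (fun A B => unsh_sum d B (fun B1 B2 => lift_sum d b B1 (fun C =>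
   lift_sum d b B2 (fun D => lift_sum d' (fun m => (degsum d' m, g m)) D (fun m =>
     phi ((degsum d (x :: A) + degsum d B1, g (b (x :: A) :: C)) :: m))))))).
  apply: unsh_sum_ext => A B hp.
  under [LHS]eq_ev do rewrite lift_sum_cons.
  rewrite -/(lift_sum _ _ _ _) lift_sum_coalg //; apply: unsh_sum_ext => B1 B2 _.
  apply: lift_sum_ext => P hP _; rewrite degsum_cons db.
  by rewrite (degsum_blocks db) (degsum_perm _ hP).
(* [E] collects all entries of the outer block of [x] other than [x]. *)
rewrite -unsh_sum_coassoc; apply: unsh_sum_ext => E B hE.
have hB : (size B < n)%N by have [_ hB] := perm_size_leq hE; apply: leq_ltn_trans hs.
rewrite lift_sum_cons -(ih B (fun m => phi ((degsum d (x :: E), _) :: m))) //;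
  last exact: tagged_add_cons.
(* Additivity of [phi] pulls the sum that defines the value on the outer block out of its slot. *)
have hD : additive_fun (fun w => lift_sum d b B (fun D => lift_sum d' (fun m =>
  (degsum d' m, g m)) D (fun m =>
     phi ((degsum d (x :: E), w) :: m)))).
  apply: additive_fun_ev => D; apply: additive_fun_ev => m; exact: tagged_add_head.
rewrite (unsh_sum_morph _ _ _ hD); apply: unsh_sum_ext => A1 A2 hA.
rewrite (lift_sum_morph _ _ _ _ hD); apply: lift_sum_ext => P hP _.
by rewrite !degsum_cons -(degsum_perm d hA) degsum_cat addrA.
Qed.
End Composition.

Section TaggedFamilies.
Variables (K : fieldType) (R : dgca K) (V W : lmodType R) (GV : grading V) (GW : grading W).
Variables (m : nat) (a : int) (f : seq V -> W).
Hypothesis hf : @gsym_family K R V W GV GW m a f.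

Lemma gsym_madd : multiadd f. Proof. exact: gsymD hf. Qed.
Lemma gsym0 s : f (0 :: s) = 0. Proof. exact: addf0 (multiadd_head gsym_madd s). Qed.
Lemma gsym_symm : graded_symm fst (homog_tag GV) (fun l => f (untag l)).
Proof.
move=> s1 x y s2 /all_good_cat[_ /all_good_cons[hx /all_good_cons[hy _]]].
by rewrite /untag !map_cat /= (gsymC hf _ _ hx hy) signE parityM.
Qed.
Lemma gsym_hom l : all_good (homog_tag GV) l -> homog GW (a + degsum fst l) (f (untag l)).
Proof.
move=> hl; have := gsym_homog hf (e := map fst l) (s := untag l); rewrite big_map; apply.
split=> [|k]; rewrite !size_map // => hk.
by rewrite !(nth_map (0, 0)) //; apply: hl; rewrite mem_nth.
Qed.
Lemma gsym_headZ i r x s : homog (dgca_gr R) i r -> (m <= (size s).+1)%N ->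
  f (r *: x :: s) = signed (parity i && parity a) (r *: f (x :: s)).
Proof.
move=> hr hm; have := gsymZ hf (e := [::]) (s1 := [::]) (x := x) (s2 := s) hm _ hr.
by rewrite big_nil addr0 signE parityM; apply.
Qed.
End TaggedFamilies.

Section GdecFamilies.
Variables (V : zmodType) (G : grading V).

Lemma slotted_gdec (U : zmodType) (h : seq (int * V) -> U) :
  graded_symm fst (homog_tag G) h ->
  (forall s, all_good (homog_tag G) s -> homog_additive G (fun t => h (t :: s))) ->
  slotted (homog_dec G) snd (homog_tag G) h.
Proof.
move=> hs hD s1 s2 /all_good_cat[g1 g2]; apply: homog_dec_liftable => i x y hx hy.
have gx z : homog G i z -> all_good (homog_tag G) (s1 ++ (i, z) :: s2).
  by move=> hz; apply/all_good_cat; split=> //; apply/all_good_cons.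
rewrite !(graded_symm_move hs) ?hD ?signedD //; try by apply: gx => //; apply: homogD.
by apply/all_good_cat.
Qed.

Lemma spanned_gdec i x : homog G i x ->
  spanned snd (fun t => homog_tag G t /\ t.1 = i) x.
Proof.
move=> hx; exists [:: (i, x)]; rewrite big_seq1; split=> // t.
by rewrite inE => /eqP->.
Qed.

Lemma multilin_gdec (U : zmodType) (h : seq (int * V) -> U) l :
  slotted (homog_dec G) snd (homog_tag G) h -> all_good (homog_tag G) l ->
  multilin (homog_dec G) (untag l) h = h l.
Proof. exact: (multilin_pure (@homog_dec_good _ G)). Qed.
End GdecFamilies.

Lemma eq_madd (V : zmodType) (G : grading V) (U : zmodType) (f g : seq V -> U) :
  multiadd f -> multiadd g -> (forall l, all_good (homog_tag G) l ->
    f (untag l) = g (untag l)) -> f = g.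
Proof.
move=> fD gD h; apply/funext => s; apply/eqP; rewrite -subr_eq0; apply/eqP.
apply: (multiadd_ind_good (@homog_dec_good _ G) (homog_decE G) (P := eq^~ 0)
  (f := fun s => f s - g s)) => //.
- by move=> u v -> ->; rewrite addr0.
- by move=> s1 x y s2; rewrite fD gD opprD addrACA.
- by move=> l _ hl; rewrite [map _ _]/(untag l) h ?subrr.
Qed.

(** Multiadditivity reduces the comparison to homogeneous entries; the proof fields agree by proof
    irrelevance. *)
Lemma linfHom_eq (K : fieldType) (R : dgca K) (V W : linfAlg R) (f g : linfHom V W) :
  (forall l, all_good (homog_tag V) l -> f (untag l) = g (untag l)) -> f = g.
Proof.
move: f g => [f hf ef] [g hg eg] /= h.
have e : f = g := eq_madd (gsym_madd hf) (gsym_madd hg) h.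
subst g; congr LinfHom; exact: Prop_irrelevance.
Qed.

Lemma tagged_seq (V : zmodType) (s : seq (int * V)) :
  s = tag_seq (fun i => (tnth (in_tuple s) i).1) (fun i => (tnth (in_tuple s) i).2).
Proof.
rewrite -[LHS]/(tval (in_tuple s)) -[LHS]map_tnth_enum.
by apply: eq_map => i; rewrite -surjective_pairing.
Qed.

Lemma all_good_tl (V : zmodType) (G : grading V) n (e : 'I_n -> int) (x : 'I_n -> V) :
  (forall i, homog G (e i) (x i)) -> all_good (homog_tag G) (tag_seq e x).
Proof. by move=> h p /mapP[i _ ->]; apply: h. Qed.

Section Morphisms.
Variables (K : fieldType) (R : dgca K).
Hypothesis charK : [pchar K] =i pred0.

(** The equations of a morphism for all arities at once; at the empty list both sides vanish. *)
Definition hom_eqn (V W : linfAlg R) (f : seq V -> W) := forall s, all_good (homog_tag V) s ->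
  lift_sum fst (tag_block f) s (fun l => linf_q W (untag l)) =
  unsh_sum fst s (fun A B => f (linf_q V (untag A) :: untag B)).

Lemma linfHom_eqn (V W : linfAlg R) (f : linfHom V W) : hom_eqn f.
Proof.
move=> s hs; have hf := linf_fun_gsym f.
case: (posnP (size s)) => [/eqP|s_gt0].
  rewrite size_eq0 => /eqP->; rewrite lift_sum_nil unsh_sum_nil !(gsym_nil (linf_q_gsym _)).
  by rewrite (gsym0 hf).
have hx i : homog V (tnth (in_tuple s) i).1 (tnth (in_tuple s) i).2.
  by apply: hs; apply: mem_tnth.
rewrite (tagged_seq s) -(composition_sumE charK hf (linf_q_gsym W)) //.
rewrite -insertion_sumE ?(gsym_nil (linf_q_gsym _)) ?linf_fun_eq //.
exact: gsym0 hf.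
Qed.

(** Kept transparent, so that the underlying function of the morphism is found by conversion. *)
Definition mk_hom (V W : linfAlg R) (f : seq V -> W)
  (hf : gsym_family V W 1 0 f) (ef : hom_eqn f) : linfHom V W.
Proof.
exists f => // n e x n_gt0 hx.
rewrite (composition_sumE charK hf (linf_q_gsym W)) // ef; last exact: all_good_tl.
rewrite -insertion_sumE ?(gsym_nil (linf_q_gsym _)) //; exact: gsym0 hf.
Defined.

(** The record gives arities at least 2; arity 1 is the vanishing of the square of the
    differential. *)
Lemma jacobi_ev (V : linfAlg R) s : all_good (homog_tag V) s ->
  unsh_sum fst s (fun A B => linf_q V (linf_q V (untag A) :: untag B)) = 0.
Proof.
move=> hs; have hq := linf_q_gsym V.
case: s hs => [|x [|y s]] hs.
- by rewrite unsh_sum_nil (gsym_nil hq) (gsym0 hq).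
- rewrite unsh_sum_cons !unsh_sum_nil /= (gsym_nil hq) (gsym0 hq) signed0 addr0.
  by rewrite !linf_q1 dg_dd.
have hx i : homog V (tnth (in_tuple [:: x, y & s]) i).1 (tnth (in_tuple [:: x, y & s]) i).2.
  by apply: hs; apply: mem_tnth.
rewrite (tagged_seq [:: x, y & s]) -insertion_sumE ?(gsym_nil hq) ?linf_jacobi //.
exact: gsym0 hq.
Qed.
End Morphisms.

Section Composite.
Variables (K : fieldType) (R : dgca K) (U V W : lmodType R).
Variables (GU : grading U) (GV : grading V) (GW : grading W).
Variables (mg : nat) (ag : int) (g : seq V -> W) (f : seq U -> V).
Hypothesis (hg : @gsym_family K R V W GV GW mg ag g).
Hypothesis (hf : @gsym_family K R U V GU GV 1 0 f).

(** The composite involves Koszul signs, so it is first given on tagged lists, and [comp_fun]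
    extends it to all sequences. *)
Definition comp_term (s : seq (int * U)) : W := lift_sum fst (tag_block f) s (fun l =>
  g (untag l)).
Definition comp_fun s := multilin (homog_dec GU) s comp_term.

Lemma homog_tag_blk A : all_good (homog_tag GU) A -> homog_tag GV (tag_block f A).
Proof. by move=> hA; have := gsym_hom hf hA; rewrite add0r. Qed.

Lemma all_good_blocks P s : perm_eq (flatten P) s -> all_good (homog_tag GU) s ->
  all_good (homog_tag GV) (map (tag_block f) P).
Proof.
move=> hP hs p /mapP[A hA ->]; apply: homog_tag_blk => z hz; apply: hs.
by rewrite -(perm_mem hP); apply/flattenP; exists A.
Qed.

Lemma comp_term_symm : graded_symm fst (homog_tag GU) comp_term.
Proof.
move=> s1 x y s2 hs; apply: lift_sum_swap => [P1 A B P2 hP|P1 A1 A2 P2 hP].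
  have := all_good_blocks hP hs; rewrite !map_cat => hgd.
  by rewrite (gsym_symm hg).
have hA : all_good (homog_tag GU) (A1 ++ x :: y :: A2).
  by move=> z hz; apply: hs; rewrite -(perm_mem hP) flatten_cat mem_cat /= mem_cat hz orbT.
rewrite /untag !map_cat /= (gsym_symm hf hA).
by rewrite (addf_signed (multiadd_slot (gsym_madd hg) _ _)).
Qed.

Lemma comp_term_headD s : homog_additive GU (fun t => comp_term (t :: s)).
Proof.
move=> i x y hx hy; rewrite /comp_term !lift_sum_cons -unsh_sumD; apply: unsh_sum_ext => A B _.
rewrite -lift_sumD; apply: lift_sum_ext => P _ _ /=.
by rewrite (multiadd_head (gsym_madd hf)) (multiadd_head (gsym_madd hg)).
Qed.

Lemma comp_term_slotted : slotted (homog_dec GU) snd (homog_tag GU) comp_term.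
Proof. by apply: slotted_gdec comp_term_symm _ => s _; apply: comp_term_headD. Qed.

Lemma comp_unt l : all_good (homog_tag GU) l -> comp_fun (untag l) = comp_term l.
Proof. exact: (multilin_gdec comp_term_slotted). Qed.

End Composite.

Lemma comp_gsym (K : fieldType) (R : dgca K) (U V W : lmodType R)
    (GU : grading U) (GV : grading V) (GW : grading W) (g : seq V -> W) (f : seq U -> V)
    (hg : @gsym_family K R V W GV GW 1 0 g) (hf : @gsym_family K R U V GU GV 1 0 f)
    (homogZ : forall i j r x,
      homog (dgca_gr R) i r -> homog GU j x -> homog GU (i + j) (r *: x)) :
  gsym_family GU GW 1 0 (comp_fun GU g f).
Proof.
apply: (gsym_lin (@homog_dec_good _ GU) (homog_decE GU) homogZ (@spanned_gdec _ GU)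
  (comp_term_symm hg hf) (comp_term_slotted hg hf)).
- by rewrite /comp_term lift_sum_nil (gsym_nil hg).
- move=> l hl; apply: lift_sum_closed => [|u v hu hv|b u hu|P hP];
    [exact: homog0|exact: homogD|exact: homog_signed|].
  have := gsym_hom hg (all_good_blocks hf hP hl).
  by rewrite (@degsum_blocks _ _ fst fst (tag_block f)) // (degsum_perm _ hP).
move=> i r [j x] l hr hx hl _; rewrite andbF /=.
have := comp_unt hg hf (l := (i + j, r *: x) :: l); rewrite /comp_fun /= => ->; last first.
  by apply/all_good_cons; split=> //; apply: homogZ.
have hZ : additive_fun (fun w : W => r *: w) by move=> u v; rewrite scalerDr.
rewrite /comp_term !lift_sum_cons (unsh_sum_morph _ _ _ hZ).
apply: unsh_sum_ext => A B _; rewrite (lift_sum_morph _ _ _ _ hZ);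
  apply: lift_sum_ext => P _ _ /=.
by rewrite (gsym_headZ hf _ hr) // andbF /= (gsym_headZ hg _ hr) // andbF.
Qed.

Section Category.
Variables (K : fieldType) (R : dgca K).
Hypothesis charK : [pchar K] =i pred0.
Local Notation Alg := (linfAlg R).

Lemma lift_sum_blk_comp (U V W : zmodType) (g : seq V -> W) (f : seq U -> V) (Z : zmodType) s
    (phi : seq (int * W) -> Z) : tagged_add phi ->
  lift_sum fst (tag_block f) s (fun l => lift_sum fst (tag_block g) l phi) =
  lift_sum fst (fun A => (degsum fst A, lift_sum fst (tag_block f) A (fun l =>
    g (untag l)))) s phi.
Proof. exact: (lift_sum_comp (b := tag_block f) (d' := fst)). Qed.

Lemma eq_evf_blk (U W Z : zmodType) (b b' : seq (int * U) ->
  int * W) s (phi : seq (int * W) -> Z) :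
  (forall A, {subset A <= s} -> b A = b' A) -> lift_sum fst b s phi = lift_sum fst b' s phi.
Proof.
move=> h; rewrite [LHS]lift_sum_blocks [RHS]lift_sum_blocks; apply: lift_sum_ext => P hP _.
rewrite !map_id; congr phi; apply/eq_in_map => A hA; apply: h => z hz.
by rewrite -(perm_mem hP); apply/flattenP; exists A.
Qed.

Lemma lift_sum_blk_cmp (U V W : Alg) (g : linfHom V W) (f : linfHom U V) (Z : zmodType) s
    (phi : seq (int * W) -> Z) : tagged_add phi -> all_good (homog_tag U) s ->
  lift_sum fst (tag_block (comp_fun U g f)) s phi = lift_sum fst (tag_block f) s (fun l =>
    lift_sum fst (tag_block g) l phi).
Proof.
move=> hphi hs; rewrite lift_sum_blk_comp //; apply: eq_evf_blk => A hA.
congr pair; apply: (comp_unt (linf_fun_gsym g) (linf_fun_gsym f)).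
by move=> z /hA; apply: hs.
Qed.

Lemma comp_mor (U V W : Alg) (g : linfHom V W) (f : linfHom U V) :
  hom_eqn (V := U) (W := W) (comp_fun U g f).
Proof.
move=> s hs; have [hg hf] := (linf_fun_gsym g, linf_fun_gsym f).
have hqW := linf_q_gsym W; have hqU := linf_q_gsym U.
rewrite lift_sum_blk_cmp //; last exact: tagged_add_unt (gsym_madd hqW).
(* The equation of [g], applied to the images of the blocks under [f]. *)
transitivity (lift_sum fst (tag_block f) s (fun l => unsh_sum fst l (fun A B =>
    g (linf_q V (untag A) :: untag B)))).
  apply: lift_sum_ext => P hP _; apply: (linfHom_eqn charK g); exact (all_good_blocks hf hP hs).
rewrite lift_sum_coalg //.
(* The equation of [f], applied to the left part. *)
transitivity (unsh_sum fst s (fun A B => unsh_sum fst A (fun A1 A2 =>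
  lift_sum fst (tag_block f) B (fun m =>
    g (f (linf_q U (untag A1) :: untag A2) :: untag m))))).
  apply: unsh_sum_ext => A B hAB.
  have hD : additive_fun (fun v => lift_sum fst (tag_block f) B (fun m => g (v :: untag m))).
    by apply: additive_fun_ev => m; apply: multiadd_head (gsym_madd hg) _.
  rewrite -(lift_sum_morph _ _ _ _ hD) (linfHom_eqn charK f);
    first exact: (unsh_sum_morph _ _ _ hD).
  by move=> z hz; apply: hs; rewrite -(perm_mem hAB) mem_cat hz.
(* Now [A2] and [B] come from one list: the inner sum is the composite at that list preceded by a
   bracket, whose block is completed by [A2]. *)
rewrite unsh_sum_coassoc; apply: unsh_sum_ext => A B hAB.
have hA : all_good (homog_tag U) A by move=> z hz; apply: hs;
  rewrite -(perm_mem hAB) mem_cat hz.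
have hB : all_good (homog_tag U) B by move=> z hz; apply: hs;
  rewrite -(perm_mem hAB) mem_cat hz orbT.
have := comp_unt hg hf (l := (1 + degsum fst A, linf_q U (untag A)) :: B); rewrite /= => ->.
  by rewrite /comp_term lift_sum_cons.
by apply/all_good_cons; split=> //; exact (gsym_hom hqU hA).
Qed.

Definition comp_hom (U V W : Alg) (g : linfHom V W) (f : linfHom U V) : linfHom U W :=
  mk_hom charK (comp_gsym (linf_fun_gsym g) (linf_fun_gsym f) (@dg_homogZ _ _ _ U))
    (@comp_mor U V W g f).

Lemma comp_hom_unt (U V W : Alg) (g : linfHom V W) (f : linfHom U V) l :
  all_good (homog_tag U) l -> comp_hom g f (untag l) = lift_sum fst (tag_block f) l (fun m =>
    g (untag m)).
Proof. exact: (comp_unt (linf_fun_gsym g) (linf_fun_gsym f)). Qed.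

Definition idf (V : zmodType) (s : seq V) : V := if s is [:: x] then x else 0.

Lemma idf_gsym (V : Alg) : gsym_family V V 1 0 (@idf V).
Proof.
split=> //.
- move=> [|z [|t s1]] x y [|u s2] //=; rewrite ?addr0 //.
- move=> [|e0 e] [|y s1] i r x s2 _ [] // _ _ hr; last first.
    by case: s1; rewrite /= scaler0 mul0rz.
  by case: s2 => [|y s2]; rewrite /= ?scaler0 ?mul0rz // big_nil addr0 mulr0 expr0z mulr1z.
- move=> [|i [|j e]] [|x [|y s]] [] // _ h; rewrite /=; try exact: homog0.
  by rewrite big_seq1 add0r; apply: (h 0).
- by move=> i j [|z [|t s1]] x y s2 *; rewrite /= mul0rz.
Qed.

(** Only the grouping into singletons survives, and it carries no sign. *)
Lemma lift_sum_idf (V Z : zmodType) s (phi : seq (int * V) -> Z) : tagged_add phi ->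
  lift_sum fst (tag_block (@idf V)) s phi = phi s.
Proof.
have [n] := ubnP (size s); elim: n s phi => // n ih [|[i x] s] phi /ltnSE hs hphi.
  by rewrite lift_sum_nil.
rewrite lift_sum_cons unsh_sum_Anil => [|y A B hp].
  rewrite ih //; last exact: tagged_add_cons.
  by rewrite /tag_block degsum_cons degsum_nil addr0.
rewrite -[RHS](ev0 _ (lift fst (tag_block (@idf V)) (size B) B)); apply: eq_ev => l /=.
exact: addf0 (tagged_add_head _ _ hphi).
Qed.

Lemma idf_mor (V : Alg) : hom_eqn (V := V) (W := V) (@idf V).
Proof.
move=> s hs; rewrite lift_sum_idf; last exact: tagged_add_unt (gsym_madd (linf_q_gsym V)).
by rewrite unsh_sum_Bnil.
Qed.

Definition id_hom (V : Alg) : linfHom V V := mk_hom charK (idf_gsym V) (@idf_mor V).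

Lemma comp_hom1 (U V : Alg) (f : linfHom U V) : comp_hom f (id_hom U) = f.
Proof.
apply: linfHom_eq => l hl; rewrite comp_hom_unt // lift_sum_idf //.
exact: tagged_add_unt (gsym_madd (linf_fun_gsym f)).
Qed.

Lemma comp_hom1l (U V : Alg) (f : linfHom U V) : comp_hom (id_hom V) f = f.
Proof.
apply: linfHom_eq => l hl; rewrite comp_hom_unt //.
case: l hl => [|x l] hl; first by rewrite lift_sum_nil /= (gsym_nil (linf_fun_gsym f)).
by rewrite lift_sum_single.
Qed.

Lemma comp_homA (U V W Z : Alg) (h : linfHom W Z) (g : linfHom V W) (f : linfHom U V) :
  comp_hom h (comp_hom g f) = comp_hom (comp_hom h g) f.
Proof.
apply: linfHom_eq => l hl; rewrite !comp_hom_unt //.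
rewrite lift_sum_blk_cmp //; last exact: tagged_add_unt (gsym_madd (linf_fun_gsym h)).
apply: lift_sum_ext => P hP _; rewrite comp_hom_unt //.
exact (all_good_blocks (linf_fun_gsym f) hP hl).
Qed.

Definition linf_cat : category (@linfHom K R) :=
  Category comp_hom1 comp_hom1l comp_homA.

Lemma comp_homE (U V W : Alg) (g : linfHom V W) (f : linfHom U V)
      n (e : 'I_n -> int) (x : 'I_n -> U) : (1 <= n)%N ->
  (forall i, homog U (e i) (x i)) ->
  comp_hom g f [seq x i | i : 'I_n] = composition_sum g f e x.
Proof.
move=> n_gt0 hx.
rewrite (composition_sumE charK (linf_fun_gsym f) (linf_fun_gsym g)) //.
by rewrite -comp_hom_unt ?untag_tl //; apply: all_good_tl.
Qed.

Lemma linf_catP : linf_category linf_cat.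
Proof. by split=> [V s|*]; [|apply: comp_homE]. Qed.
End Category.

(** * The grading of the tensor product *)

Section Tensor.
Variables (S R : pzRingType) (phi : {rmorphism S -> R}) (V : lmodType S).
Local Notation "r ⊗ x" := (tensor phi r x) (at level 40).

Lemma tensorDl (x : V) : additive_fun (fun r => r ⊗ x).
Proof. by move=> r r'; rewrite [RHS]tens_addE; apply/tens_classP/tens_Dl. Qed.
Lemma tensorDr r : @additive_fun V _ (fun x => r ⊗ x).
Proof. by move=> x x'; rewrite [RHS]tens_addE; apply/tens_classP/tens_Dr. Qed.
Lemma tensor_bal r s (x : V) : (r * phi s) ⊗ x = r ⊗ (s *: x).
Proof. exact/tens_classP/tens_bal. Qed.
Lemma tensorZ r r' (x : V) : r *: (r' ⊗ x) = (r * r') ⊗ x.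
Proof. exact: tens_scaleE. Qed.
Lemma tens_classE (u : seq (R * V)) : tens_class phi u = \sum_(p <- u) p.1 ⊗ p.2.
Proof.
elim: u => [|p u ih]; first by rewrite big_nil.
rewrite big_cons -ih [RHS]tens_addE; by case: p.
Qed.
End Tensor.

Section ScalarTagged.
Variables (K : fieldType) (R : dgca K) (V : zmodType) (GV : grading V).

(* [((i, r), (j, x))] stands for the pure tensor of [r], of degree [i], and
   [x], of degree [j]. *)
Definition homog_tens (t : (int * R) * (int * V)) := homog_tag (dgca_gr R) t.1 /\ homog_tag
  GV t.2.
Definition tdeg (t : (int * R) * (int * V)) : int := t.1.1 + t.2.1.
End ScalarTagged.

Section TensorLift.
Variables (K : fieldType) (S R : dgca K) (phi : dgcaHom S R) (V : lmodType S).
Variable GV : grading V.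
Hypothesis homogZ : forall i j r x,
  homog (dgca_gr S) i r -> homog GV j x -> homog GV (i + j) (r *: x).
Local Notation "r ⊗ x" := (tensor phi r x) (at level 40).
Local Notation GR := (dgca_gr R).
Local Notation T := ((int * R) * (int * V))%type.

Local Notation homog_tens := (@homog_tens K R V GV).
Local Notation tdeg := (@tdeg K R V).
Definition tpure (t : T) : tens phi V := t.1.2 ⊗ t.2.2.
(** Depends on the representative of [t]; [tdec_liftable] tells which sums over it do not. *)
Definition tdec (t : tens phi V) : seq T :=
  flatten [seq [seq (a, b) | a <- homog_dec GR p.1, b <- homog_dec GV p.2] | p <- repr t].

Lemma tdec_good t u : u \in tdec t -> homog_tens u.
Proof.
by case/flatten_mapP => p _ /allpairsP[[a b] /= [/homog_dec_good ha /homog_dec_good hb ->]].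
Qed.

Section Lift.
Variables (U : zmodType) (k : T -> U).
Hypothesis kl : forall b, homog_tag GV b -> homog_additive GR (fun a => k (a, b)).
Hypothesis kr : forall a, homog_tag GR a -> homog_additive GV (fun b => k (a, b)).
Hypothesis kbal : forall i m j r s x, homog GR i r -> homog (dgca_gr S) m s -> homog GV j x ->
  k ((i + m, r * phi s), (j, x)) = k ((i, r), (m + j, s *: x)).

Let kk r x := \sum_(a <- homog_dec GR r) \sum_(b <- homog_dec GV x) k (a, b).

Lemma sum_tdec t : \sum_(u <- tdec t) k u = \sum_(p <- repr t) kk p.1 p.2.
Proof.
rewrite big_flatten big_map; apply: eq_bigr => p _.
by rewrite big_allpairs_dep /=.
Qed.

Lemma kkDl x : additive_fun (fun r => kk r x).
Proof.
move=> r r'; rewrite /kk exchange_big [X in _ = X + _]exchange_big.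
rewrite [X in _ = _ + X]exchange_big -big_split; apply: eq_big_seq => b /homog_dec_good hb.
exact: (proj1 (homog_dec_liftable (kl hb))).
Qed.
Lemma kkDr r : additive_fun (kk r).
Proof.
move=> x x'; rewrite /kk -big_split; apply: eq_big_seq => a /homog_dec_good ha.
exact: (proj1 (homog_dec_liftable (kr ha))).
Qed.
Lemma kk_homog a b : homog_tag GR a -> homog_tag GV b -> kk a.2 b.2 = k (a, b).
Proof.
move=> ha hb; rewrite /kk -[RHS](proj2 (homog_dec_liftable (kl hb)) a ha).
apply: eq_big_seq => a' /homog_dec_good ha'.
exact: (proj2 (homog_dec_liftable (kr ha')) b hb).
Qed.

Lemma kk_bal r s x : kk (r * phi s) x = kk r (s *: x).
Proof.
(* The balancing hypothesis concerns homogeneous elements, so [r], [s] and [x] are decomposed in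
   turn. *)
rewrite (homog_decE GR r) mulr_suml (addf_sum (kkDl x)).
rewrite [RHS](addf_sum (h := fun r => kk r (s *: x)) (kkDl _)).
apply: eq_big_seq => a /homog_dec_good ha.
rewrite (homog_decE (dgca_gr S) s) raddf_sum mulr_sumr (addf_sum (kkDl x)) scaler_suml.
rewrite (addf_sum (kkDr _)); apply: eq_big_seq => c /homog_dec_good hc.
rewrite (homog_decE GV x) scaler_sumr !(addf_sum (kkDr _));
  apply: eq_big_seq => b /homog_dec_good hb.
have hac : homog_tag GR (a.1 + c.1, a.2 * phi c.2).
  by apply: dgca_homogM => //; apply: dgca_fun_homog.
have hcb : homog_tag GV (c.1 + b.1, c.2 *: b.2) by apply: homogZ.
have := kk_homog hac hb; rewrite /= => ->.
have := kk_homog ha hcb; rewrite /= => ->.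
by case: a b c ha hb hc {hac hcb} => [i r'] [j x'] [m s'] ha hb hc /=; apply: kbal.
Qed.

Lemma kk_rel u v : tens_rel phi u v ->
  \sum_(p <- u) kk p.1 p.2 = \sum_(p <- v) kk p.1 p.2.
Proof.
elim=> {u v} //.
- by move=> u v w _ -> _.
- by move=> u u' v v' _ e1 _ e2; rewrite !big_cat e1 e2.
- by move=> u v; rewrite !big_cat /= addrC.
- by move=> x; rewrite big_seq1 big_nil; apply: (addf0 (kkDl x)).
- by move=> r r' x; rewrite !big_cons !big_nil !addr0; apply: (kkDl x).
- by move=> r x x'; rewrite !big_cons !big_nil !addr0; apply: kkDr.
- by move=> r s x; rewrite !big_seq1; apply: kk_bal.
Qed.

(** The universal property of the tensor product: [kl], [kr] and [kbal] make [k] biadditive and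
    balanced, hence compatible with the congruence [tens_rel]. *)
Lemma tdec_liftable : liftable tdec tpure homog_tens k.
Proof.
split=> [t u|[a b] [ha hb]]; rewrite !sum_tdec.
  rewrite -big_cat /=; apply: kk_rel; exact: repr_class.
rewrite -[RHS](kk_homog ha hb).
transitivity (\sum_(p <- [:: (a.2, b.2)]) kk p.1 p.2); last by rewrite big_seq1.
apply: kk_rel; exact: repr_class.
Qed.
End Lift.

Lemma tdecE t : t = \sum_(u <- tdec t) tpure u.
Proof.
rewrite big_flatten big_map -[LHS]reprK -/(tens_class _ _) tens_classE.
apply: eq_bigr => p _; rewrite big_allpairs_dep /=.
rewrite {1}(homog_decE GR p.1) (addf_sum (tensorDl phi p.2)); apply: eq_bigr => a _.
by rewrite {1}(homog_decE GV p.2) (addf_sum (tensorDr phi a.2)).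
Qed.

Definition tproj n (t : tens phi V) := \sum_(u <- tdec t) (if tdeg u == n then tpure u else 0).

Lemma tproj_liftable n :
  liftable tdec tpure homog_tens (fun u => if tdeg u == n then tpure u else 0).
Proof.
apply: tdec_liftable => /= [b hb i r r' _ _|a ha i x x' _ _|i m j r s x _ _ _].
- by rewrite /tdeg /=; case: ifP; rewrite ?addr0 // => _; apply: (tensorDl phi b.2).
- by rewrite /tdeg /=; case: ifP; rewrite ?addr0 // => _; apply: (tensorDr phi a.2).
- by rewrite /tdeg /= addrA /tpure /= tensor_bal.
Qed.

Lemma tprojD n : additive_fun (tproj n). Proof. exact: (proj1 (tproj_liftable n)). Qed.
Lemma tproj_pure n t : homog_tens t -> tproj n (tpure t) = if tdeg t == n then tpure t else 0.
Proof. exact: (proj2 (tproj_liftable n)). Qed.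

(** Defining degree [n] by a projection makes the directness of the grading immediate; the
    description by pure tensors is recovered in [spanned_tdec]. *)
Definition thomog n t := tproj n t = t.

Lemma thomog_pure t : homog_tens t -> thomog (tdeg t) (tpure t).
Proof. by move=> ht; rewrite /thomog tproj_pure ?eqxx. Qed.

Lemma thomog0 n : thomog n 0. Proof. exact: addf0 (tprojD n). Qed.
Lemma thomogB n x y : thomog n x -> thomog n y -> thomog n (x - y).
Proof. by rewrite /thomog tprojD (addfN (tprojD n)) => -> ->. Qed.
Lemma thomogD n x y : thomog n x -> thomog n y -> thomog n (x + y).
Proof. by rewrite /thomog tprojD => -> ->. Qed.
Lemma thomog_sum n I (r : seq I) (P : pred I) F :
  (forall j, P j -> thomog n (F j)) -> thomog n (\sum_(j <- r | P j) F j).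
Proof. by move=> h; elim/big_ind: _ => //; [apply: thomog0|apply: thomogD]. Qed.

Lemma tproj_homog n t : thomog n (tproj n t).
Proof.
rewrite /tproj big_seq; apply: thomog_sum => u /tdec_good hu.
by case: eqP => [<-|_]; [apply: thomog_pure|apply: thomog0].
Qed.

Lemma thomog_proj m n t : thomog n t -> tproj m t = if n == m then t else 0.
Proof.
case: eqP => [->|/eqP nm] // <-; rewrite {2}/tproj (addf_sum (tprojD m)) big_seq big1 //.
move=> u /tdec_good hu; case: eqP => [un|_]; last exact: addf0 (tprojD m).
by rewrite tproj_pure // un (negbTE nm).
Qed.

Lemma thomog_span x : exists (I : seq int) (c : int -> tens phi V),
    (forall i, thomog i (c i)) /\ x = \sum_(i <- I) c i.
Proof.
exists (undup (map tdeg (tdec x))), (tproj^~ x); split; first by move=> i; apply: tproj_homog.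
rewrite {1}(tdecE x) /tproj exchange_big; apply: eq_big_seq => u hu /=.
rewrite -big_mkcond -big_filter (bigD1_seq (tdeg u)) /= ?filter_uniq ?undup_uniq //; last first.
  by rewrite mem_filter eqxx mem_undup map_f.
rewrite big_filter_cond big1 ?addr0 // => i /andP[/eqP->].
by rewrite eqxx.
Qed.

Lemma thomog_free (I : seq int) (c : int -> tens phi V) :
    uniq I -> (forall i, thomog i (c i)) -> \sum_(i <- I) c i = 0 ->
    forall i, i \in I -> c i = 0.
Proof.
move=> uI hc s0 i iI; have := congr1 (tproj i) s0.
rewrite (addf0 (tprojD i)) (addf_sum (tprojD i)) (bigD1_seq i) //= big1 ?addr0.
  by rewrite (thomog_proj _ (hc i)) eqxx.
by move=> j /negbTE ji; rewrite (thomog_proj _ (hc j)) ji.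
Qed.

Definition tens_gr : grading (tens phi V) :=
  Grading thomog0 thomogB thomog_span thomog_free.

Lemma spanned_tdec n t : homog tens_gr n t ->
  spanned tpure (fun u => homog_tens u /\ tdeg u = n) t.
Proof.
move=> h; exists [seq u <- tdec t | tdeg u == n]; split.
  by move=> u; rewrite mem_filter => /andP[/eqP hu /tdec_good].
by rewrite big_filter big_mkcond; apply/esym.
Qed.

Lemma slotted_tdec (U : zmodType) (h : seq T -> U) :
  graded_symm tdeg homog_tens h ->
  (forall s b, all_good homog_tens s -> homog_tag GV b -> homog_additive GR (fun a =>
    h ((a, b) :: s))) ->
  (forall s a, all_good homog_tens s -> homog_tag GR a -> homog_additive GV (fun b =>
    h ((a, b) :: s))) ->
  (forall l i m j r s x, all_good homog_tens l ->
    homog GR i r -> homog (dgca_gr S) m s -> homog GV j x ->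
    h (((i + m, r * phi s), (j, x)) :: l) = h (((i, r), (m + j, s *: x)) :: l)) ->
  slotted tdec tpure homog_tens h.
Proof.
move=> hs hl hr hb s1 s2 g12; have [g1 g2] := (proj1 (all_good_cat _ _ _) g12).
have key t : homog_tens t ->
  h (s1 ++ t :: s2) = signed (parity (tdeg t) && parity (degsum tdeg s1)) (h (t :: s1 ++ s2)).
  by move=> ht; apply: graded_symm_move hs _; apply/all_good_cat; split=> //;
    apply/all_good_cons.
apply: tdec_liftable => /= [b gb i r r' gr gr'|a ga i x x' gx gx'|i m j r s x gr gs gx].
- by rewrite !key ?hl ?signedD //; split=> //; apply: homogD.
- by rewrite !key ?hr ?signedD //; split=> //; apply: homogD.
rewrite !key; first by rewrite hb // /tdeg /= addrA.
  by split=> //; apply: homogZ.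
by split=> //; apply: dgca_homogM => //; apply: dgca_fun_homog.
Qed.
End TensorLift.

(** * Moving scalars to the front *)

Section Sharp.
Variables (K : fieldType) (R : dgca K) (V : zmodType) (W : lmodType R).
Local Notation GR := (dgca_gr R).
Local Notation T := ((int * R) * (int * V))%type.
Implicit Types (l A B : seq T) (a : int) (phi : seq (int * V) -> W).

Local Notation tdeg := (@tdeg K R V).
Definition rdeg l : int := degsum (fun t : T => t.1.1) l.
Definition vdeg l : int := degsum (fun t : T => t.2.1) l.
Definition rprod l : R := \prod_(t <- l) t.1.2.
Definition vseq l : seq (int * V) := map snd l.

(* The Koszul sign of moving all scalars of [l] in front of a map of degree [a]. *)
Fixpoint scalar_sign a l : bool :=
  if l is t :: l' then (parity a && parity t.1.1) (+) scalar_sign (a + t.2.1) l' else false.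

(** The value on pure tensors of the extension of scalars of a map [phi] of degree [a]. *)
Definition sharp a phi l : W := signed (scalar_sign a l) (rprod l *: phi (vseq l)).

Lemma rdeg_cons t l : rdeg (t :: l) = t.1.1 + rdeg l. Proof. exact: degsum_cons. Qed.
Lemma vdeg_cons t l : vdeg (t :: l) = t.2.1 + vdeg l. Proof. exact: degsum_cons. Qed.
Lemma rprod_cons t l : rprod (t :: l) = t.1.2 * rprod l. Proof. exact: big_cons. Qed.
Lemma vdegE l : degsum fst (vseq l) = vdeg l. Proof. exact: big_map. Qed.
Lemma tdegE l : degsum tdeg l = rdeg l + vdeg l. Proof. exact: big_split. Qed.

(** Every scalar of [l] passes the additional degree [c] once. *)
Lemma scalar_signD a c l : scalar_sign (a + c) l =
  scalar_sign a l (+) (parity c && parity (rdeg l)).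
Proof.
elim: l a => [|t l ih] a /=; first by rewrite /rdeg degsum_nil andbF.
rewrite addrAC ih rdeg_cons !parityD.
by case: (parity a); case: (parity c); case: (parity t.1.1); case: scalar_sign; case: parity.
Qed.

Lemma sharp_cons a phi t l : sharp a phi (t :: l) =
  signed (parity a && parity t.1.1) (t.1.2 *: sharp (a + t.2.1) (fun v => phi (t.2 :: v)) l).
Proof. by rewrite /sharp rprod_cons /= signedZ signed_signed scalerA. Qed.

Lemma sharp_ext a phi psi l : phi (vseq l) = psi (vseq l) -> sharp a phi l = sharp a psi l.
Proof. by rewrite /sharp => ->. Qed.

Lemma sharpD a phi psi l :
  sharp a (fun v => phi v + psi v) l = sharp a phi l + sharp a psi l.
Proof. by rewrite /sharp scalerDr signedD. Qed.

Variable GV : grading V.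
Local Notation homog_tens := (@homog_tens K R V GV).

Lemma rprod_homog l : all_good homog_tens l -> homog GR (rdeg l) (rprod l).
Proof.
elim: l => [|t l ih];
  first by rewrite /rdeg degsum_nil /rprod big_nil -(rmorph1 (dgca_unit R)) => _;
    apply: dgca_homog_unit.
by move=> /all_good_cons[[ht _] /ih hl]; rewrite rdeg_cons rprod_cons; apply: dgca_homogM.
Qed.

Lemma rprod_comm l i r : all_good homog_tens l -> homog GR i r ->
  rprod l * r = signed (parity i && parity (rdeg l)) (r * rprod l).
Proof. by move=> /rprod_homog hl hr; rewrite (dgca_mulC hl hr) signE parityM andbC. Qed.

Lemma all_good_vseq l : all_good homog_tens l -> all_good (homog_tag GV) (vseq l).
Proof. by move=> hl p /mapP[t /hl[_ ht] ->]. Qed.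

Lemma sharp_symm a phi : graded_symm fst (homog_tag GV) phi ->
  graded_symm tdeg homog_tens (sharp a phi).
Proof.
move=> + s1 t u s2; elim: s1 a phi => [|z s1 ih] a phi hphi; last first.
  move=> /all_good_cons[hz hg]; rewrite !(sharp_cons _ _ z) ih //=.
    by rewrite signedZ; signed_case.
  move=> v1 x y v2 hv; apply: (hphi (z.2 :: v1)); apply/all_good_cons; split=> //; exact hz.2.
move=> hg; have [[ht hvt] /all_good_cons[[hu hvu] g2]] := (proj1 (all_good_cons _ _ _) hg).
rewrite !sharp_cons !signedZ !scalerA (dgca_mulC ht hu) signE addrAC.
have -> : phi [:: t.2, u.2 & vseq s2] =
    signed (parity t.2.1 && parity u.2.1) (phi [:: u.2, t.2 & vseq s2]).
  by apply: (hphi [::]); apply: (all_good_vseq hg).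
rewrite signedMl signedZl signedZ /tdeg; case: scalar_sign; signed_case.
Qed.

Lemma all_good_split A B l : perm_eq (A ++ B) l -> all_good homog_tens l ->
  all_good homog_tens A /\ all_good homog_tens B.
Proof. by move=> hp hl; apply/all_good_cat; apply: all_good_perm hl. Qed.

(** Unshuffling tensors and then moving the scalars out agrees with moving them out first and
    unshuffling the vectors. *)
Lemma sharp_evu a l (psi : seq (int * V) -> seq (int * V) -> W) : all_good homog_tens l ->
  unsh_sum tdeg l (fun A B => signed (scalar_sign a A (+) scalar_sign (a + vdeg A) B)
     ((rprod A * rprod B) *: psi (vseq A) (vseq B))) =
  sharp a (fun v => unsh_sum fst v psi) l.
Proof.
elim: l a psi => [|p l ih] a psi.
  by rewrite !unsh_sum_nil /sharp /rprod big_nil mulr1 scale1r /= unsh_sum_nil scale1r.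
move=> /all_good_cons[[hp _] hl]; rewrite unsh_sum_cons sharp_cons.
have -> : sharp (a + p.2.1) (fun v => unsh_sum fst (p.2 :: v) psi) l =
  sharp (a + p.2.1) (fun v => unsh_sum fst v (fun C D => psi (p.2 :: C) D) +
   unsh_sum fst v (fun C D =>
     signed (parity p.2.1 && parity (degsum fst C)) (psi C (p.2 :: D)))) l.
  by apply: sharp_ext; apply: unsh_sum_cons.
have hZ : additive_fun (fun w : W => signed (parity a && parity p.1.1) (p.1.2 *: w)).
  by move=> u v; rewrite scalerDr signedD.
rewrite sharpD -!ih // hZ !(unsh_sum_morph _ _ _ hZ); congr (_ + _).
  apply: unsh_sum_ext => A B hAB;
    rewrite signedZ scalerA mulrA -rprod_cons vdeg_cons addrA signed_signed.
  by apply: signed_eq; rewrite /= addbA.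
(* The head goes right: its scalar is commuted past those of [A], which accounts for the scalar part
   of the Koszul sign of tensors. *)
apply: unsh_sum_ext => A B hAB; have [hA hB] := all_good_split hAB hl.
rewrite vdegE rprod_cons mulrA (rprod_comm hA hp) !signedZ !scalerA mulrA tdegE /= addrAC
  !scalar_signD /tdeg.
rewrite -[_ * _ * rprod B]mulrA.
rewrite [X in signed _ (signed _ (X *: _))](_ : _ =
  signed (parity p.1.1 && parity (rdeg A)) (p.1.2 * rprod A * rprod B)).
  rewrite signedZl mulrA; repeat rewrite signed_signed; apply: signed_eq;
    repeat rewrite parityD.
  by case: (scalar_sign a A); case: (scalar_sign a B); parity_case.
by rewrite signedMl.
Qed.

Lemma sharp_homog (GW : grading W) a phi l :
  (forall i j r x, homog GR i r -> homog GW j x -> homog GW (i + j) (r *: x)) ->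
  all_good homog_tens l -> homog GW (a + vdeg l) (phi (vseq l)) ->
  homog GW (a + degsum tdeg l) (sharp a phi l).
Proof.
move=> hZ hl hphi; apply: homog_signed; rewrite tdegE addrCA.
by apply: hZ => //; apply: rprod_homog.
Qed.
End Sharp.

Section SharpLift.
Variables (K : fieldType) (R : dgca K) (V : zmodType) (GV : grading V).
Variables (U W : lmodType R) (f : seq V -> U).
Local Notation GR := (dgca_gr R).
Local Notation T := ((int * R) * (int * V))%type.
Local Notation homog_tens := (@homog_tens K R V GV).

(* The sign created by moving the scalars out of a block is absorbed in its scalar. *)
Definition sharp_blk (A : seq T) : (int * R) * (int * U) :=
  ((rdeg A, signed (scalar_sign 0 A) (rprod A)), tag_block f (vseq A)).

Lemma sharp_evf a (l : seq T) (phi : seq (int * U) -> W) : all_good homog_tens l ->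
  lift_sum (@tdeg K R V) sharp_blk l (sharp a phi) =
  sharp a (fun v => lift_sum fst (tag_block f) v phi) l.
Proof.
have [n] := ubnP (size l); elim: n a l phi => // n ih a [|p l] phi /ltnSE hs.
  by rewrite /sharp /= !lift_sum_nil /rprod !big_nil.
move=> /all_good_cons[hp hl]; rewrite lift_sum_cons sharp_cons.
transitivity (signed (parity a && parity p.1.1) (p.1.2 *: sharp (a + p.2.1) (fun v =>
  unsh_sum fst v (fun A B =>
   lift_sum fst (tag_block f) B (fun m => phi (tag_block f (p.2 :: A) :: m)))) l)); last first.
  by congr (signed _ (_ *: _)); apply: sharp_ext; rewrite lift_sum_cons.
have hZ : additive_fun (fun w : W => signed (parity a && parity p.1.1) (p.1.2 *: w)).
  by move=> u v; rewrite scalerDr signedD.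
rewrite -(sharp_evu _ _ hl) (unsh_sum_morph _ _ _ hZ); apply: unsh_sum_ext => A B hAB.
have [hA hB] := all_good_split hAB hl.
have sB : (size B < n)%N by have [_ sB] := perm_size_leq hAB; apply: leq_ltn_trans sB hs.
transitivity (lift_sum (@tdeg K R V) sharp_blk B (fun m =>
   signed (parity a && parity (rdeg (p :: A))) ((signed (scalar_sign 0 (p :: A)) (rprod (p ::
     A))) *:
     sharp (a + vdeg (p :: A)) (fun v => phi (tag_block f (p.2 :: vseq A) :: v)) m))).
  by apply: lift_sum_ext => P _ _;
    rewrite sharp_cons /= /tag_block /= -[degsum _ _]/(degsum fst (vseq (p :: A))) vdegE.
rewrite lift_sum_signed.
have hZ' : additive_fun (fun w : W => signed (scalar_sign 0 (p :: A)) (rprod (p :: A)) *: w).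
  by move=> u v; rewrite scalerDr.
rewrite -(lift_sum_morph _ _ _ _ hZ') ih // /sharp signedZ signedZl !signedZ !scalerA mulrA
  rprod_cons.
repeat rewrite signed_signed; congr signed; rewrite /= vdeg_cons rdeg_cons addrA.
rewrite !scalar_signD.
have -> : scalar_sign a A =
  scalar_sign 0 A (+) (parity a && parity (rdeg A)) by rewrite -scalar_signD add0r.
by case: (scalar_sign 0 A); case: (scalar_sign a B); parity_case.
Qed.
End SharpLift.

Section SharpLeibniz.
Variables (K : fieldType) (R : dgca K) (V : zmodType) (GV : grading V) (W : lmodType R).
Local Notation GR := (dgca_gr R).
Local Notation T := ((int * R) * (int * V))%type.
Local Notation homog_tens := (@homog_tens K R V GV).

Definition diff_scalar (t : T) : T := ((t.1.1 + 1, dgca_d R t.1.2), t.2).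

Lemma dgca_d1 : dgca_d R 1 = 0.
Proof. by rewrite -(rmorph1 (dgca_unit R)) dgca_d_unit. Qed.
Lemma dgca_d_signed b r : dgca_d R (signed b r) = signed b (dgca_d R r).
Proof. by apply: addf_signed; exact: dgca_dD. Qed.

Lemma diff_good t : homog_tens t -> homog_tens (diff_scalar t).
Proof. by case=> h1 h2; split=> //; apply: dgca_homog_d. Qed.

(** Unshuffles with one entry on the left run over the entries of [l], so the sum is the Leibniz
    rule for the product of the scalars; [parity a] is the sign of the differential passing a map of
    degree [a]. *)
Lemma sharp_leibniz a (l : seq T) (phi : seq (int * V) -> W) :
  graded_symm fst (homog_tag GV) phi -> all_good homog_tens l ->
  unsh_sum (@tdeg K R V) l (fun A B =>
    if A is [:: p] then sharp a phi (diff_scalar p :: B) else 0) =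
  signed (parity a (+) scalar_sign a l) (dgca_d R (rprod l) *: phi (vseq l)).
Proof.
elim: l a phi => [|p l ih] a phi hphi.
  by rewrite unsh_sum_nil /rprod big_nil dgca_d1 scale0r signed0.
move=> /all_good_cons[hp hl]; rewrite unsh_sum_cons unsh_sum_Anil => [|q A B _] //=.
transitivity (sharp a phi (diff_scalar p :: l) + unsh_sum (@tdeg K R V) l (fun A B =>
  signed (parity (tdeg p) (+) (parity a && parity p.1.1)) (p.1.2 *:
    if A is [:: q] then sharp (a + p.2.1) (fun v =>
      phi (p.2 :: v)) (diff_scalar q :: B) else 0))).
  congr (_ + _); apply: unsh_sum_ext => -[|q [|q' A]] B hAB;
    rewrite ?signed0 ?scaler0 ?signed0 //.
  have [hq hB] := all_good_split hAB hl.
  (* The differentiated entry [q] has been moved in front of [p]; swapping them back lets the scalar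
     of [p] be pulled out. *)
  have hs := sharp_symm a hphi.
  rewrite (hs [::]) /= ?(sharp_cons _ _ p) /tdeg /= ?/degsum ?big_seq1.
    by signed_case.
  apply/all_good_cons; split; first by apply: diff_good; apply: hq; rewrite mem_head.
  by apply/all_good_cons.
rewrite unsh_sum_signed.
have hZ : additive_fun (fun w : W => p.1.2 *: w) by move=> u v; rewrite scalerDr.
rewrite -(unsh_sum_morph _ _ _ hZ) ih //; last first.
  move=> v1 x y v2 hv; apply: (hphi (p.2 :: v1)); apply/all_good_cons; split=> //; exact hp.2.
rewrite rprod_cons (dgca_leibniz _ hp.1) signE scalerDl signedD; congr (_ + _).
  by rewrite /sharp rprod_cons /=; case: (scalar_sign (a + p.2.1) l); signed_case.
by rewrite signedZl !signedZ scalerA; case: (scalar_sign (a + p.2.1) l); signed_case.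
Qed.
End SharpLeibniz.

Section SharpPull.
Variables (K : fieldType) (R : dgca K) (U W : lmodType R).
Variables (GU : grading U) (GW : grading W) (m : nat) (a : int) (g : seq U -> W).
Hypothesis hg : @gsym_family K R U W GU GW m a g.
Local Notation T := ((int * R) * (int * U))%type.

Lemma sharp_pull (l : seq T) : (m <= size l)%N -> all_good (@homog_tens K R U GU) l ->
  g [seq t.1.2 *: t.2.2 | t <- l] = sharp a (fun v => g (untag v)) l.
Proof.
(* The vectors in [l0] have already lost their scalars; a scalar further right has to pass them as
   well as the map. *)
suff key (l0 : seq (int * U)) : (m <= size l0 + size l)%N -> all_good (homog_tag GU) l0 ->
    all_good (@homog_tens K R U GU) l ->
    g (untag l0 ++ [seq t.1.2 *: t.2.2 | t <- l]) =
    sharp (a + degsum fst l0) (fun v => g (untag l0 ++ untag v)) l.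
  by move=> hm hl; have := key [::]; rewrite degsum_nil addr0; apply.
elim: l l0 => [|[[i r] [j x]] l ih] l0 hm g0 /=.
  by rewrite /sharp /rprod big_nil scale1r.
move=> /all_good_cons[[hr hx] hl].
have e0 : homogs GU (map fst l0) (untag l0).
  split=> [|k]; rewrite !size_map // => hk.
  by rewrite !(nth_map (0, 0)) //; apply: g0; rewrite mem_nth.
rewrite (gsymZ hg _ e0 hr) ?signE; last first.
  by rewrite size_cat /= !size_map.
rewrite big_map -/(degsum fst l0) sharp_cons /= parityM andbC.
have := ih (rcons l0 (j, x)); rewrite /untag map_rcons cat_rcons => ->; last 3 first.
- by rewrite size_rcons addSnnS.
- by rewrite -cats1; apply/all_good_cat; split=> // z; rewrite inE => /eqP->.
- by [].
rewrite -cats1 degsum_cat degsum_cons degsum_nil addr0 addrA; congr (signed _ (_ *: _)).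
by apply: sharp_ext; rewrite cat_rcons.
Qed.
End SharpPull.

(** * The extension of scalars of an algebra *)

Section Insertion.
Variables (K : fieldType) (R : dgca K) (V W : lmodType R) (GV : grading V) (GW : grading W).
Variables (m m' : nat) (a : int) (q : seq V -> V) (f : seq V -> W).
Hypothesis (hq : @gsym_family K R V V GV GV m 1 q).
Hypothesis (hf : @gsym_family K R V W GV GW m' a f).

Definition insertion (s : seq (int * V)) : W := unsh_sum fst s (fun A B =>
  f (q (untag A) :: untag B)).

Lemma insertion_symm : graded_symm fst (homog_tag GV) insertion.
Proof.
move=> s1 x y s2 hs; apply: unsh_sum_swap => [A1 A2 B hp|A B1 B2 hp].
  have hA : all_good (homog_tag GV) (A1 ++ x :: y :: A2).
    by move=> z hz; apply: hs; rewrite -(perm_mem hp) mem_cat hz.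
  by rewrite (gsym_symm hq hA) (addf_signed (multiadd_head (gsym_madd hf) _)).
have [hA hB] : all_good (homog_tag GV) A /\ all_good (homog_tag GV) (B1 ++ x :: y :: B2).
  by apply/all_good_cat; apply: all_good_perm hs.
have := gsym_symm hf (s1 := (1 + degsum fst A, q (untag A)) :: B1) (x := x) (y := y) (s2 := B2).
rewrite /=; apply; apply/all_good_cons; split=> //; exact (gsym_hom hq hA).
Qed.

Lemma insertion_headD s : homog_additive GV (fun t => insertion (t :: s)).
Proof.
move=> i x y _ _; rewrite /insertion !unsh_sum_cons addrACA; congr (_ + _); rewrite -unsh_sumD.
  apply: unsh_sum_ext => A B _ /=.
  by rewrite (multiadd_head (gsym_madd hq)) (multiadd_head (gsym_madd hf)).
apply: unsh_sum_ext => A B _ /=.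
by rewrite (multiadd_slot (gsym_madd hf) [:: _]) signedD.
Qed.
End Insertion.

Section SharpSlots.
Variables (K : fieldType) (S R : dgca K) (phi : dgcaHom S R) (V : lmodType S).
Variables (GV : grading V) (W : lmodType R) (a : int) (F : seq (int * V) -> W).
Local Notation GR := (dgca_gr R).
Local Notation T := ((int * R) * (int * V))%type.
Local Notation homog_tens := (@homog_tens K R V GV).

Lemma sharp_addl (l : seq T) b : homog_additive GR (fun r => sharp a F ((r, b) :: l)).
Proof. by move=> i r r' _ _; rewrite !sharp_cons /= scalerDl signedD. Qed.

Lemma sharp_addr (l : seq T) r :
  (forall v, all_good (homog_tag GV) v -> homog_additive GV (fun x =>
    F (x :: v))) -> all_good homog_tens l ->
  homog_additive GV (fun x => sharp a F ((r, x) :: l)).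
Proof.
move=> hF hl j x x' hx hx'; rewrite !sharp_cons /= -signedD -scalerDr -sharpD.
by congr (signed _ (_ *: _)); apply: sharp_ext; apply: hF => //; apply: all_good_vseq hl.
Qed.

Lemma sharp_bal (l : seq T) i m j r s x : all_good homog_tens l -> homog GR i r ->
  homog (dgca_gr S) m s ->
  F ((m + j, s *: x) :: vseq l) =
    signed (parity m && parity a) (phi s *: F ((j, x) :: vseq l)) ->
  sharp a F (((i + m, r * phi s), (j, x)) :: l) =
  sharp a F (((i, r), (m + j, s *: x)) :: l).
Proof.
move=> hl hr /(dgca_fun_homog phi) hs e; rewrite /sharp /= e !rprod_cons /= !signedZ !scalerA.
rewrite -!mulrA (rprod_comm hl hs) signedMr signedZl [a + (m + j)]addrA [a + m +
  j]addrAC !scalar_signD.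
by case: (scalar_sign a l); signed_case.
Qed.

Lemma sharp_scale (l : seq T) i i' r r' b :
  sharp a F (((i' + i, r' * r), b) :: l) =
  signed (parity i' && parity a) (r' *: sharp a F (((i, r), b) :: l)).
Proof. by rewrite !sharp_cons /= -scalerA [in RHS]signedZ; signed_case. Qed.
End SharpSlots.

Section PureTensors.
Variables (K : fieldType) (S R : dgca K) (phi : dgcaHom S R) (V : lmodType S).
Variable GV : grading V.
Hypothesis homogZ : forall i j r x,
  homog (dgca_gr S) i r -> homog GV j x -> homog GV (i + j) (r *: x).
Local Notation T := ((int * R) * (int * V))%type.
Local Notation GR := (dgca_gr R).
Local Notation homog_tens := (@homog_tens K R V GV).
Local Notation tdeg := (@tdeg K R V).
Local Notation tpure := (@tpure K S R phi V).
Local Notation tdec := (@tdec K S R phi V GV).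
Local Notation GE := (tens_gr phi homogZ).

Definition ttag (t : T) : int * tens phi V := (tdeg t, tpure t).

Lemma homog_tpure t : homog_tens t -> homog GE (tdeg t) (tpure t).
Proof. exact: thomog_pure. Qed.

Lemma untag_ttag (l : seq T) : untag (map ttag l) = map tpure l.
Proof. by rewrite /untag -map_comp. Qed.
(** [H] takes tagged entries, but a tagged tensor is not a sum of tagged pure ones on the nose;
    extending [H] by [multilin] removes the tags, and then pure tensors suffice. *)
Lemma vanish_pure (U : zmodType) (H : seq (int * tens phi V) -> U) :
  graded_symm fst (homog_tag GE) H -> (forall s, all_good (homog_tag GE) s ->
    homog_additive GE (fun t => H (t :: s))) ->
  (forall l, all_good homog_tens l -> H (map ttag l) = 0) ->
  forall s, all_good (homog_tag GE) s -> H s = 0.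
Proof.
move=> hs hD h0 s gs; have hsl := slotted_gdec hs hD.
rewrite -(multilin_gdec hsl gs).
apply: (multiadd_ind_good (@tdec_good K S R phi V GV) (@tdecE K S R phi V GV) (P := eq^~ 0)
  (f := fun s => multilin (homog_dec GE) s H)) => //.
- by move=> u v -> ->; rewrite addr0.
- exact (multilin_madd (@homog_dec_good _ GE) hsl).
move=> l _ hl; rewrite -untag_ttag (multilin_gdec hsl) ?h0 //.
by move=> p /mapP[t /hl ht ->]; apply: homog_tpure.
Qed.

Lemma tens_homogZ i j (r : R) (x : tens phi V) :
  homog GR i r -> homog GE j x -> homog GE (i + j) (r *: x).
Proof.
move=> hr /spanned_tdec[ts [hts ->]]; rewrite scaler_sumr big_seq.
apply: homog_sum => t /hts[[h1 h2] <-].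
rewrite /tpure tensorZ addrA.
exact: (homog_tpure (t := ((i + t.1.1, r * t.1.2), t.2)) (conj (dgca_homogM hr h1) h2)).
Qed.
End PureTensors.

Section ExtensionStructure.
Variables (K : fieldType) (S R : dgca K) (phi : dgcaHom S R) (V : linfAlg S).
Local Notation T := ((int * R) * (int * V))%type.
Local Notation GR := (dgca_gr R).
Local Notation GV := (dg_gr (linf_dg V)).
Local Notation homogZ := (@dg_homogZ K S V (linf_dg V)).
Local Notation GE := (tens_gr phi homogZ).
Local Notation homog_tens := (@homog_tens K R V GV).
Local Notation tdeg := (@tdeg K R V).
Local Notation tpure := (@tpure K S R phi V).
Local Notation tdec := (@tdec K S R phi V GV).
Local Notation "r ⊗ x" := (tensor phi r x) (at level 40).
Local Notation q := (linf_q V).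

Definition etaq (v : seq (int * V)) : tens phi V := 1 ⊗ q (untag v).
Definition dtens (l : seq T) : tens phi V := if l is [:: t] then tpure (diff_scalar t) else 0.
(* [dtens] is the part of [q_1 = d (x) 1 + 1 (x) d] that is not obtained from [q_1] on [V]
   by moving the scalar out. *)
Definition tens_bracket (l : seq T) : tens phi V := sharp 1 etaq l + dtens l.

Lemma sharp_tensor a (F : seq (int * V) -> V) (l : seq T) :
  sharp a (fun v => 1 ⊗ F v) l = (signed (scalar_sign a l) (rprod l)) ⊗ F (vseq l).
Proof. by rewrite /sharp tensorZ mulr1 (addf_signed (tensorDl phi _)). Qed.

Lemma etaq_symm : graded_symm fst (homog_tag GV) etaq.
Proof.
move=> s1 x y s2 hs; rewrite /etaq (gsym_symm (linf_q_gsym V) hs).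
exact: (addf_signed (tensorDr phi 1)).
Qed.

Lemma tens_bracket_symm : graded_symm tdeg homog_tens tens_bracket.
Proof.
move=> s1 t u s2 hg; rewrite /tens_bracket (sharp_symm 1 etaq_symm hg).
have d0 s1' t' u' s2' : dtens (s1' ++ [:: t', u' & s2']) = 0.
  by case: s1' => [|? []].
by rewrite !d0 !addr0.
Qed.

Lemma etaq_headD v : homog_additive GV (fun x => etaq (x :: v)).
Proof.
move=> i x y _ _; rewrite /etaq /= (multiadd_head (gsym_madd (linf_q_gsym V))).
exact: tensorDr.
Qed.

Lemma tens_bracket_slotted : slotted tdec tpure homog_tens tens_bracket.
Proof.
apply: (slotted_tdec homogZ tens_bracket_symm) =>
  [l b hl hb i r r' hr hr'|l a hl ha j x x' hx hx'|l i m j r s x hl hr hs hx].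
- rewrite /tens_bracket (sharp_addl 1 etaq l b hr hr') addrACA; congr (_ + _).
  case: l {hl} => [|? ?] /=; rewrite ?addr0 // /tpure /= dgca_dD.
  exact: (tensorDl phi b.2).
- rewrite /tens_bracket (sharp_addr 1 _ (fun v _ => @etaq_headD v) hl hx hx') addrACA;
    congr (_ + _).
  case: l {hl} => [|? ?] /=; rewrite ?addr0 // /tpure /=.
  exact: (tensorDr phi (dgca_d R a.2)).
(* With two or more tensors [dtens] vanishes, and the bracket is linear over [S]. *)
case: l hl => [|t l] hl; last first.
  congr (_ + _); apply: (sharp_bal hl hr hs).
  rewrite /etaq /= (gsym_headZ (linf_q_gsym V) _ hs) //.
  by rewrite (addf_signed (tensorDr phi 1)) -tensor_bal mul1r tensorZ mulr1.
(* With one tensor neither summand is balanced: the Leibniz rule on [V] and the one on [R] each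
   produce a term with the differential of [s], and these two match. *)
rewrite /tens_bracket /sharp /= /rprod !big_seq1 /= /etaq /= !linf_q1 !tensorZ !mulr1 /tpure /=.
rewrite !addbF (dgca_leibniz _ hr) -(dgca_fun_d phi) (dg_leibniz _ _ hs) !signE.
rewrite !(tensorDl phi) !(tensorDr phi) !(addf_signed (tensorDl phi _)) !(addf_signed
  (tensorDr phi _)).
rewrite !tensor_bal signedD signed_signed parityD [LHS]addrA [LHS]addrAC; congr (_ + _).
by rewrite addrC.
Qed.

Lemma one_homog : homog GR 0 1.
Proof. by rewrite -(rmorph1 (dgca_unit R)); apply: dgca_homog_unit. Qed.

Lemma eta_homog n (x : V) : homog GV n x -> homog GE n (1 ⊗ x).
Proof.
move=> hx; rewrite -[n]add0r.
exact (homog_tpure phi homogZ (t := ((0, 1), (n, x))) (conj one_homog hx)).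
Qed.

Lemma dtens_homog l : all_good homog_tens l -> homog GE (1 + degsum tdeg l) (dtens l).
Proof.
case: l => [|t [|u l]] hl; try exact: homog0.
rewrite degsum_cons degsum_nil addr0 addrC /tdeg addrAC.
exact: (homog_tpure phi homogZ (diff_good (hl t (mem_head _ _)))).
Qed.

Lemma tens_bracket_homog l : all_good homog_tens l ->
  homog GE (1 + degsum tdeg l) (tens_bracket l).
Proof.
move=> hl; apply: homogD; last exact: dtens_homog.
apply: (sharp_homog (@tens_homogZ _ _ _ _ _ _ homogZ) hl); apply: eta_homog.
by rewrite -vdegE; exact (gsym_hom (linf_q_gsym V) (all_good_vseq hl)).
Qed.

Definition qE (s : seq (tens phi V)) : tens phi V := multilin tdec s tens_bracket.

Lemma qE_pure l : all_good homog_tens l -> qE (map tpure l) = tens_bracket l.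
Proof. by move=> hl; exact (multilin_pure (@tdec_good K S R phi V GV) tens_bracket_slotted
  hl). Qed.

Lemma qE_gsym : gsym_family GE GE 2 1 qE.
Proof.
apply: (gsym_lin (@tdec_good K S R phi V GV) (@tdecE K S R phi V GV)
  (@tens_homogZ _ _ _ _ _ _ homogZ) (@spanned_tdec _ _ _ _ _ _ homogZ) tens_bracket_symm
    tens_bracket_slotted).
- by rewrite /tens_bracket /sharp /etaq /= (gsym_nil (linf_q_gsym V)) (addf0 (tensorDr phi
    1)) scaler0 addr0.
- exact: tens_bracket_homog.
move=> i r t l hr ht hl sl.
pose t' : T := ((i + t.1.1, r * t.1.2), t.2).
have ht' : homog_tens t' by split; [apply: dgca_homogM => //; exact: ht.1|exact: ht.2].
have -> : r *: tpure t = tpure t' by rewrite /tpure tensorZ.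
rewrite -[_ :: _]/(map tpure (t' :: l)) -[LHS]/(qE _) qE_pure; last by apply/all_good_cons.
case: l sl hl => // u l _ hl.
rewrite /tens_bracket !addr0 /t' sharp_scale; congr (signed _ (_ *: sharp _ _ (_ :: _))).
by case: (t) => [[? ?] ?].
Qed.

(** Taken from [qE], so that the field [linf_q1] holds by conversion. *)
Definition dE (t : tens phi V) := qE [:: t].

Lemma dE_pure t : homog_tens t ->
  dE (tpure t) = signed (parity t.1.1) (t.1.2 ⊗ dg_d V t.2.2) + dgca_d R t.1.2 ⊗ t.2.2.
Proof.
move=> ht; rewrite /dE -[[:: _]]/(map tpure [:: t]) qE_pure; last first.
  by move=> u; rewrite inE => /eqP->.
rewrite /tens_bracket /sharp /rprod big_seq1 /etaq /= linf_q1 tensorZ mulr1 addbF //.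
Qed.

Lemma dED : additive_fun dE. Proof. exact: (multiadd_head (gsym_madd qE_gsym)). Qed.

Lemma dE_homog i x : homog GE i x -> homog GE (i + 1) (dE x).
Proof.
move=> hx; have := gsym_homog qE_gsym (e := [:: i]) (s := [:: x]).
rewrite big_seq1 addrC; apply; split=> // -[] //.
Qed.

Lemma dE_tensor i r x : homog GR i r ->
  dE (r ⊗ x) = dgca_d R r ⊗ x + (r ⊗ dg_d V x) *~ (-1) ^ i.
Proof.
move=> hr; rewrite signE {1 2 3}(homog_decE GV x).
have dD : additive_fun (dg_d V) by exact: dg_dD.
rewrite (addf_sum dD) !(addf_sum (tensorDr phi _)) (addf_sum dED) signed_sum -big_split.
apply: eq_big_seq => b /homog_dec_good hb.
by rewrite /= addrC; apply: (dE_pure (t := ((i, r), b))).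
Qed.

Lemma dE_dE x : dE (dE x) = 0.
Proof.
have h0 : additive_fun (fun x => dE (dE x)) by move=> u v; rewrite !dED.
rewrite (tdecE GV x); apply: etrans (addf_sum h0 _ _) _.
rewrite big_seq big1 // => t /tdec_good ht.
rewrite dE_pure // dED (addf_signed dED) (dE_tensor _ ht.1) (dE_tensor _ (dgca_homog_d ht.1)).
rewrite dg_dd dgca_dd !signE (addf0 (tensorDl phi _)) (addf0 (tensorDr phi _)) signed0 addr0
  add0r.
by rewrite parityD parity1; case: parity; rewrite /= ?addNr ?addrN.
Qed.

Lemma dE_leibniz i r x : homog GR i r ->
  dE (r *: x) = dgca_d R r *: x + (r *: dE x) *~ (-1) ^ i.
Proof.
move=> hr; rewrite signE; apply/eqP; rewrite -subr_eq0; apply/eqP.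
have h0 : additive_fun (fun x =>
  dE (r *: x) - (dgca_d R r *: x + signed (parity i) (r *: dE x))).
  by move=> u v; rewrite !scalerDr !dED scalerDr signedD addrACA opprD addrACA.
rewrite (tdecE GV x); apply: etrans (addf_sum h0 _ _) _.
rewrite big_seq big1 // => t /tdec_good ht; apply/eqP; rewrite subr_eq0; apply/eqP.
rewrite /tpure !tensorZ.
rewrite (dE_tensor _ (dgca_homogM hr ht.1)) (dE_tensor _ ht.1) (dgca_leibniz _ hr) !signE.
rewrite (tensorDl phi) (addf_signed (tensorDl phi _)) scalerDr signedZ !tensorZ signedD
  signed_signed parityD.
by rewrite addrA.
Qed.

Definition dgE : dgStr (tens phi V) :=
  @DgStr K R (tens phi V) GE dE (@tens_homogZ _ _ _ _ _ _ homogZ) dED dE_homog dE_dE dE_leibniz.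

Section InsertPure.
Variables (W : lmodType R) (a : int) (f : seq (int * V) -> W).

(** The sign of moving the scalars out of the bracket is absorbed in the scalar, so that the bracket
    of pure tensors is again one tagged pure tensor, up to [dtens]. *)
Definition qblk (l : seq T) : T :=
  ((rdeg l, signed (scalar_sign 1 l) (rprod l)), (1 + vdeg l, q (untag (vseq l)))).

Lemma qblk_good l : all_good homog_tens l -> homog_tens (qblk l).
Proof.
move=> hl; split; first by apply: homog_signed; apply: rprod_homog hl.
by rewrite /qblk -vdegE; exact (gsym_hom (linf_q_gsym V) (all_good_vseq hl)).
Qed.

Lemma sharp_etaq l : sharp 1 etaq l = tpure (qblk l).
Proof. exact: sharp_tensor. Qed.

(** The total degree is [a + 1], since the scalars also pass the inner bracket. *)
Lemma sharp_insertion l : all_good homog_tens l ->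
  unsh_sum tdeg l (fun A B => sharp a f (qblk A :: B)) =
  sharp (a + 1) (fun v => unsh_sum fst v (fun A B =>
    f ((1 + degsum fst A, q (untag A)) :: B))) l.
Proof.
move=> hl; rewrite -(sharp_evu _ _ hl); apply: unsh_sum_ext => A B _.
rewrite /sharp rprod_cons /= signedMl signedZl signed_signed vdegE; apply: signed_eq.
rewrite [a + 1 + _]addrAC -[in RHS](addrA a) [vdeg A + 1]addrC !scalar_signD.
have -> : scalar_sign 1 A =
  scalar_sign 0 A (+) parity (rdeg A) by rewrite -[in LHS](add0r 1) scalar_signD.
have -> : scalar_sign a A =
  scalar_sign 0 A (+) (parity a && parity (rdeg A)) by rewrite -[in LHS](add0r a) scalar_signD.
by case: (scalar_sign 0 A); case: (scalar_sign a B); parity_case.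
Qed.
End InsertPure.

(** Separates the part of the inserted bracket that comes from [V] from [dtens], which only sees
    left parts with one entry. *)
Lemma unsh_sum_qE (W : lmodType R) (G : seq (tens phi V) -> W) (H : seq T -> W) l :
  multiadd G -> (forall l, all_good homog_tens l -> G (map tpure l) = H l) ->
    all_good homog_tens l ->
  unsh_sum tdeg l (fun A B => G (qE (map tpure A) :: map tpure B)) =
  unsh_sum tdeg l (fun A B => H (qblk A :: B)) +
  unsh_sum tdeg l (fun A B => if A is [:: p] then H (diff_scalar p :: B) else 0).
Proof.
move=> GD hG hl; rewrite -unsh_sumD; apply: unsh_sum_ext => A B hAB.
have [hA hB] := all_good_split hAB hl.
rewrite qE_pure // /tens_bracket sharp_etaq (multiadd_head GD) -[X in X +
  _]/(G (map tpure (qblk A :: B))).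
rewrite hG; last by apply/all_good_cons; split=> //; apply: qblk_good.
congr (_ + _); case: A hA {hAB} => [|p [|p' A]] hA; rewrite /= ?(addf0 (multiadd_head GD _)) //.
rewrite -hG //; apply/all_good_cons; split=> //; apply: diff_good; apply: hA; exact: mem_head.
Qed.

Lemma qE_jacobi_pure l : all_good homog_tens l ->
  unsh_sum tdeg l (fun A B => qE (qE (map tpure A) :: map tpure B)) = 0.
Proof.
move=> hl; rewrite (unsh_sum_qE (gsym_madd qE_gsym) qE_pure hl).
(* The Jacobi identities of [V] kill the linear part; of [dtens] only the bracket of the whole list
   remains, with the differential on its scalar. *)
have -> : unsh_sum tdeg l (fun A B => tens_bracket (qblk A :: B)) = dtens [:: qblk l].
  rewrite /tens_bracket unsh_sumD sharp_insertion // [X in X + _](_ : _ = 0) ?add0r.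
    by rewrite unsh_sum_Bnil.
  have -> : sharp (1 + 1) (fun v => unsh_sum fst v (fun A B =>
    etaq ((1 + degsum fst A, q (untag A)) :: B))) l =
      sharp (1 + 1) (fun=> 0) l.
    apply: sharp_ext; rewrite /etaq -(unsh_sum_morph _ _ _ (tensorDr phi 1)).
    by rewrite jacobi_ev ?(addf0 (tensorDr phi 1)) //; apply: all_good_vseq hl.
  by rewrite /sharp scaler0 signed0.
(* The differential of [R] applied twice to one scalar gives zero. *)
rewrite [X in _ + X](_ : _ = unsh_sum tdeg l (fun A B =>
    if A is [:: p] then sharp 1 etaq (diff_scalar p :: B) else 0)); last first.
  apply: unsh_sum_ext => -[|p [|p' A]] B _ //; rewrite /tens_bracket.
  case: B => [|b B]; rewrite /= ?addr0 //.
  by rewrite /tpure /= dgca_dd (addf0 (tensorDl phi _)) addr0.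
(* The Leibniz rule gives the term already found, with the opposite sign since the bracket has
   degree 1. *)
rewrite (sharp_leibniz 1 etaq_symm hl) /dtens /tpure /= /etaq tensorZ mulr1.
rewrite dgca_d_signed (addf_signed (tensorDl phi _)) ?parity1.
by case: scalar_sign; rewrite /= ?subrr ?addNr ?opprK ?addrN.
Qed.

Lemma qE_jacobi n (e : 'I_n -> int) (x : 'I_n -> tens phi V) : (2 <= n)%N ->
    (forall i, homog GE (e i) (x i)) ->
  insertion_sum qE qE e x = 0.
Proof.
move=> _ hx; rewrite insertion_sumE ?(gsym_nil qE_gsym) //; last exact: gsym0 qE_gsym.
have hs := insertion_symm qE_gsym qE_gsym; have hD := insertion_headD qE_gsym qE_gsym.
apply: (vanish_pure hs (fun s _ => hD s)); last exact: all_good_tl.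
move=> l hl; rewrite /insertion unsh_sum_map -[RHS](qE_jacobi_pure hl).
by apply: unsh_sum_ext => A B _; rewrite !untag_ttag.
Qed.

Definition linfE : linfStr (tens phi V) :=
  @LinfStr K R (tens phi V) dgE qE (fun=> erefl) qE_gsym qE_jacobi.
End ExtensionStructure.

(** * The adjunction *)

Section Transpose.
Variables (K : fieldType) (charK : [pchar K] =i pred0).
Variables (S R : dgca K) (phi : dgcaHom S R) (V : linfAlg S) (W : linfAlg R).
Local Notation T := ((int * R) * (int * V))%type.
Local Notation GR := (dgca_gr R).
Local Notation GV := (dg_gr (linf_dg V)).
Local Notation GW := (dg_gr (linf_dg W)).
Local Notation homogZ := (@dg_homogZ K S V (linf_dg V)).
Local Notation GE := (tens_gr phi homogZ).
Local Notation homog_tensV := (@homog_tens K R V GV).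
Local Notation tdeg := (@tdeg K R V).
Local Notation tpure := (@tpure K S R phi V).
Local Notation tdec := (@tdec K S R phi V GV).
Local Notation "r ⊗ x" := (tensor phi r x) (at level 40).
Local Notation EV := (LinfAlg (linfE phi V)).

Definition eta_tens (v : seq (int * V)) : seq T := [seq ((0, 1), p) | p <- v].
Definition eta_tag (p : int * V) : int * EV := (p.1, 1 ⊗ p.2).

Lemma scalar_sign_etal a v : scalar_sign a (eta_tens v) = false.
Proof. by elim: v a => //= p v ih a; rewrite andbF ih. Qed.
Lemma rprod_etal v : rprod (eta_tens v) = 1.
Proof. by rewrite /rprod big_map big1. Qed.
Lemma vseq_etal v : vseq (eta_tens v) = v.
Proof. by rewrite /vseq -map_comp map_id. Qed.
Lemma sharp_etal a (U : lmodType R) (F : seq (int * V) -> U) v : sharp a F (eta_tens v) = F v.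
Proof. by rewrite /sharp scalar_sign_etal rprod_etal vseq_etal scale1r. Qed.
Lemma map_eta v : [seq 1 ⊗ x | x <- untag v] = map tpure (eta_tens v).
Proof. by rewrite /untag -!map_comp. Qed.
Lemma all_good_etal v : all_good (homog_tag GV) v -> all_good homog_tensV (eta_tens v).
Proof. by move=> hv t /mapP[p /hv hp ->]; split=> //; apply: one_homog. Qed.
Lemma untag_etat v : untag (map eta_tag v) = [seq 1 ⊗ x | x <- untag v].
Proof. by rewrite /untag -!map_comp. Qed.
Lemma all_good_etat v : all_good (homog_tag GV) v -> all_good (homog_tag EV) (map eta_tag v).
Proof. by move=> hv t /mapP[p /hv hp ->]; exact: (eta_homog phi hp). Qed.

(** No sign arises as 1 has degree 0, and [dtens] vanishes because the differential kills 1. *)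
Lemma qE_eta v : all_good (homog_tag GV) v ->
  qE [seq 1 ⊗ x | x <- untag v] = 1 ⊗ linf_q V (untag v).
Proof.
move=> hv; rewrite map_eta qE_pure; last exact: all_good_etal.
rewrite /tens_bracket (@sharp_etal 1 (tens phi V)) /dtens.
case: v {hv} => [|p [|? ?]]; rewrite /= ?addr0 //.
by rewrite /tpure /= dgca_d1 (addf0 (tensorDl phi _)) addr0.
Qed.

Section ExtendMorphism.
Variable f : linfHom V (restr phi W).

Definition tagged_fun (v : seq (int * V)) : W := f (untag v).
Let hf := linf_fun_gsym f.

Lemma tagged_fun_symm : graded_symm fst (homog_tag GV) tagged_fun.
Proof. exact (gsym_symm hf). Qed.

Lemma tagged_fun_headD v : homog_additive GV (fun x => tagged_fun (x :: v)).
Proof. by move=> i x y _ _; exact (multiadd_head (gsym_madd hf) (untag v) x y). Qed.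

Lemma tagged_fun_headZ j m s x v : homog (dgca_gr S) m s ->
  tagged_fun ((j, s *: x) :: v) = phi s *: tagged_fun ((j, x) :: v).
Proof.
move=> hs; have := gsym_headZ hf x (s := untag v) hs isT.
by rewrite andbF.
Qed.

Lemma tagged_fun_homog v : all_good (homog_tag GV) v -> homog GW (degsum fst v) (tagged_fun v).
Proof. by move=> hv; have := gsym_hom hf hv; rewrite add0r. Qed.

Definition scalar_ext : seq T -> W := sharp 0 tagged_fun.

Lemma scalar_ext_symm : graded_symm tdeg homog_tensV scalar_ext.
Proof. exact (sharp_symm 0 tagged_fun_symm). Qed.

Lemma scalar_ext_slotted : slotted tdec tpure homog_tensV scalar_ext.
Proof.
apply: (slotted_tdec homogZ scalar_ext_symm) => [l b _ _|l a hl _|l i m j r s x hl hr hs hx].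
- exact: sharp_addl.
- by apply: sharp_addr hl => v _; apply: tagged_fun_headD.
- by apply: (sharp_bal hl hr hs); rewrite (tagged_fun_headZ _ _ _ hs) andbF.
Qed.

Definition ext_fun (s : seq EV) : W := multilin tdec s scalar_ext.

Lemma ext_fun_pure l : all_good homog_tensV l -> ext_fun (map tpure l) = scalar_ext l.
Proof. by move=> hl; exact (multilin_pure (@tdec_good K S R phi V GV) scalar_ext_slotted hl).
  Qed.

Lemma ext_fun_gsym : gsym_family GE GW 1 0 ext_fun.
Proof.
apply: (gsym_lin (@tdec_good K S R phi V GV) (@tdecE K S R phi V GV)
  (@tens_homogZ _ _ _ _ _ _ homogZ) (@spanned_tdec _ _ _ _ _ _ homogZ) scalar_ext_symm
    scalar_ext_slotted).
- by rewrite /scalar_ext /sharp /tagged_fun /= (gsym_nil hf) scaler0.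
- move=> l hl; apply: (sharp_homog (@dg_homogZ _ _ _ W) hl).
  by rewrite add0r -vdegE; apply: tagged_fun_homog; exact (all_good_vseq hl).
move=> i r t l hr ht hl _.
pose t' : T := ((i + t.1.1, r * t.1.2), t.2).
have ht' : homog_tensV t' by split; [apply: dgca_homogM => //; exact: ht.1|exact: ht.2].
have -> : r *: tpure t = tpure t' by rewrite /tpure tensorZ.
rewrite -[_ :: _]/(map tpure (t' :: l)) -[LHS]/(ext_fun _) ext_fun_pure;
  last by apply/all_good_cons.
rewrite /scalar_ext /t' sharp_scale; congr (signed _ (_ *: sharp _ _ (_ :: _))).
by case: (t) => [[? ?] ?].
Qed.

Lemma ext_fun_mor_pure l : all_good homog_tensV l ->
  lift_sum fst (tag_block ext_fun) (map (@ttag _ _ _ phi _) l) (fun v => linf_q W (untag v)) =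
  unsh_sum tdeg l (fun A B => ext_fun (qE (map tpure A) :: map tpure B)).
Proof.
move=> hl; rewrite (unsh_sum_qE (gsym_madd ext_fun_gsym) ext_fun_pure hl).
rewrite sharp_insertion // (sharp_leibniz 0 tagged_fun_symm hl) parity0.
pose bW : seq T -> _ := @sharp_blk K R V W f.
(* The part of [d_W], applied to a single block, in which the differential hits the scalar; it will
   match the Leibniz term on the right. *)
pose dW (m : seq ((int * R) * (int * W))) : W :=
  if m is [:: t] then dgca_d R t.1.2 *: t.2.2 else 0.
have hb P : perm_eq (flatten P) l -> all_good (@homog_tens K R W GW) (map bW P).
  move=> hP t /mapP[A hA ->].
  have gA : all_good homog_tensV A.
    by move=> z hz; apply: hl; rewrite -(perm_mem hP); apply/flattenP; exists A.
  split; first by apply: homog_signed; exact (rprod_homog gA).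
  by apply: tagged_fun_homog; exact (all_good_vseq gA).
transitivity (lift_sum tdeg bW l (fun m =>
    sharp 1 (fun v => linf_q W (untag v)) m + dW m)).
  rewrite lift_sum_map [LHS]lift_sum_blocks [RHS]lift_sum_blocks;
    apply: lift_sum_ext => P hP _; rewrite map_id.
  transitivity (linf_q W [seq t.1.2 *: t.2.2 | t <- map bW P]).
    rewrite /untag -!map_comp; congr (linf_q W _); apply/eq_in_map => A hA /=.
    rewrite /= untag_ttag ext_fun_pure; last first.
      by move=> z hz; apply: hl; rewrite -(perm_mem hP); apply/flattenP; exists A.
    by rewrite /scalar_ext /sharp signedZl.
  have := hb P hP; move: (map _ P) => [|t [|t' m]] hm.
  - by rewrite /sharp /= (gsym_nil (linf_q_gsym W)) scaler0 addr0.
  - have [h1 _] := hm t (mem_head _ _).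
    rewrite /= linf_q1 (dg_leibniz _ _ h1) signE addrC; congr (_ + _).
    by rewrite /sharp /rprod big_seq1 /= linf_q1 addbF.
  - by rewrite addr0; apply: sharp_pull (linf_q_gsym W) _ _ hm.
(* The first summand is the equation of [f] with the scalars moved to the front; the second is the
   term with the differential of the product of all scalars. *)
rewrite lift_sumD; congr (_ + _).
  apply: etrans (sharp_evf _ _ _ hl) _.
  apply: sharp_ext; have := linfHom_eqn charK f (all_good_vseq hl); exact.
case: l hl {hb} => [|t l] hl.
  by rewrite lift_sum_nil /rprod big_nil dgca_d1 scale0r signed0.
rewrite lift_sum_single // /dW /= dgca_d_signed signedZl //.
Qed.

Lemma ext_fun_mor : hom_eqn (V := EV) (W := W) ext_fun.
Proof.
move=> s hs.
have hq := linf_q_gsym W; have hqE := linf_q_gsym EV; have hF := ext_fun_gsym.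
apply/eqP; rewrite -subr_eq0; apply/eqP.
apply: (vanish_pure (H := fun s =>
  comp_term (linf_q W) ext_fun s - insertion (linf_q EV) ext_fun s) _ _ _ hs).
- move=> s1 x y s2 h; rewrite (comp_term_symm hq hF h) (insertion_symm hqE hF h).
  by rewrite signedD signedN.
- move=> s' gs i x y hx hy.
  rewrite (comp_term_headD hq hF s' hx hy) (insertion_headD hqE hF s' hx hy).
  by rewrite opprD addrACA.
move=> l hl; apply/eqP; rewrite subr_eq0; apply/eqP.
rewrite [LHS](ext_fun_mor_pure hl) /insertion unsh_sum_map.
by apply: unsh_sum_ext => A B _; rewrite !untag_ttag.
Qed.

Definition transpose_inv : linfHom EV W := @mk_hom K R charK EV W ext_fun ext_fun_gsym
  ext_fun_mor.
End ExtendMorphism.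

Section RestrictMorphism.
Variable F : linfHom EV W.

Definition restr_fun (s : seq V) : restr phi W := F [seq 1 ⊗ x | x <- s].
Let hF := linf_fun_gsym F.

Lemma restr_fun_gsym : gsym_family GV (restr_gr phi W) 1 0 restr_fun.
Proof.
split.
- exact: gsym_nil hF.
- move=> s1 x y s2; rewrite /restr_fun !map_cat /= (tensorDr phi 1).
  exact: (gsymD hF).
- move=> e s1 i r x s2 hm [he hs1] hr; rewrite /restr_fun !map_cat /=.
  rewrite -tensor_bal mul1r -[phi r]mulr1 -tensorZ.
  have hm' : (0 < size (map (tensor phi 1) s1 ++ (1 ⊗ x) :: map (tensor phi 1) s2))%N.
    by rewrite size_cat addnS.
  apply: (gsymZ hF (e := e) hm' _ (dgca_fun_homog phi hr)).
  split=> [|k]; rewrite size_map // => hk; rewrite (nth_map 0) //.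
  exact: (eta_homog phi (hs1 _ hk)).
- move=> e s [he hs]; apply: (gsym_homog hF); split=> [|k]; rewrite size_map // => hk.
  rewrite (nth_map 0) //; exact: (eta_homog phi (hs _ hk)).
- move=> i j s1 x y s2 hx hy; rewrite /restr_fun !map_cat /=.
  exact: (gsymC hF _ _ (eta_homog phi hx) (eta_homog phi hy)).
Qed.

Lemma restr_fun_mor : hom_eqn (V := V) (W := restr phi W) restr_fun.
Proof.
move=> s hs; have hs' := all_good_etat hs.
have := linfHom_eqn charK F hs'; rewrite lift_sum_map unsh_sum_map => e.
apply: etrans (etrans _ e) _.
  rewrite [LHS]lift_sum_blocks [RHS]lift_sum_blocks; apply: lift_sum_ext => P _ _.
  rewrite /untag -!map_comp; congr (linf_q W _); apply: eq_map => A /=.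
  by rewrite untag_etat.
apply: unsh_sum_ext => A B hAB; rewrite !untag_etat [linf_q EV _]qE_eta //.
by move=> z hz; apply: hs; rewrite -(perm_mem hAB) mem_cat hz.
Qed.

Definition transpose : linfHom V (restr phi W) :=
  @mk_hom K S charK V (restr phi W) restr_fun restr_fun_gsym restr_fun_mor.
End RestrictMorphism.

Lemma transposeK : cancel transpose transpose_inv.
Proof.
move=> F; have hF := linf_fun_gsym F; apply: linfHom_eq => s _.
have hG := linf_fun_gsym (transpose_inv (transpose F)).
apply/eqP; rewrite -subr_eq0; apply/eqP.
apply: (multiadd_ind_good (@tdec_good K S R phi V GV) (@tdecE K S R phi V GV) (P := eq^~ 0)
  (f := fun s => transpose_inv (transpose F) s - F s)) => //.
- by move=> u v -> ->; rewrite addr0.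
- by move=> s1 x y s2; rewrite (gsymD hF) (gsymD hG) opprD addrACA.
move=> l _ hl; apply/eqP; rewrite subr_eq0; apply/eqP.
rewrite [LHS](ext_fun_pure (transpose F) hl).
case: (posnP (size l)) => [/eqP|l_gt0].
  by rewrite size_eq0 => /eqP->;
    rewrite /scalar_ext /sharp /tagged_fun /= /restr_fun /= (gsym_nil hF) scaler0.
(* Each r ⊗ x is written as r times 1 ⊗ x, so that the linearity of [F] over [R] moves all scalars
   out. *)
pose l' : seq ((int * R) * (int * EV)) := [seq (t.1, (t.2.1, 1 ⊗ t.2.2)) | t <- l].
have -> : map tpure l = [seq t.1.2 *: t.2.2 | t <- l'].
  by rewrite -map_comp; apply: eq_map => t /=; rewrite tensorZ mulr1.
rewrite (sharp_pull hF (l := l')) ?size_map //; last first.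
  move=> z /mapP[t /hl[h1 h2] ->]; split=> //; exact: (eta_homog phi h2).
rewrite /scalar_ext /sharp; congr (signed _ (_ *: _)).
- rewrite /l'; elim: (l) (0 : int) => //= t l1 ih a; by rewrite ih.
- by rewrite /rprod big_map.
- by rewrite /tagged_fun /= /restr_fun /l' /vseq /untag -!map_comp.
Qed.

Lemma transpose_invK : cancel transpose_inv transpose.
Proof.
move=> f; apply: linfHom_eq => l hl.
rewrite -[LHS]/(ext_fun f [seq 1 ⊗ x | x <- untag l]) map_eta.
by rewrite ext_fun_pure; [exact: (@sharp_etal 0 W)|exact: all_good_etal].
Qed.

Lemma transpose_bij : bijective transpose.
Proof. exact: Bijective transposeK transpose_invK. Qed.
End Transpose.

(** * Naturality, functoriality and the explicit formulas *)

Section Adjunction.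
Variables (K : fieldType) (charK : [pchar K] =i pred0).
Variables (S R : dgca K) (phi : dgcaHom S R).
Local Notation "r ⊗ x" := (tensor phi r x) (at level 40).
Local Notation E V := (LinfAlg (linfE phi V)).
Local Notation Phi := (transpose charK (phi := phi)).
Local Notation "g \oR f" := (comp_hom (R := R) charK g f) (at level 50).
Local Notation "g \oS f" := (comp_hom (R := S) charK g f) (at level 50).

Definition unit_hom (V : linfAlg S) : linfHom V (restr phi (E V)) :=
  Phi (id_hom charK (E V)).

(** Defined through the adjunction, so that being a morphism requires no new computation; the
    formula on pure tensors is recovered in [extend_homP]. *)
Definition extend_hom (V W : linfAlg S) (f : linfHom V W) : linfHom (E V) (E W) :=
  transpose_inv charK (unit_hom W \oS f).

Lemma transpose_extend (V W : linfAlg S) (f : linfHom V W) :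
  Phi (extend_hom f) = unit_hom W \oS f.
Proof. exact: transpose_invK. Qed.

(** The unit has only a linear component, so composing with it leaves a single block. *)
Lemma unit_comp (V W : linfAlg S) (f : linfHom V W) v : all_good (homog_tag V) v ->
  (unit_hom W \oS f) (untag v) = 1 ⊗ f (untag v).
Proof.
move=> hv; rewrite comp_hom_unt //; case: v hv => [|x v] hv.
  by rewrite lift_sum_nil /= (gsym_nil (linf_fun_gsym f)) (addf0 (tensorDr phi 1)).
by rewrite lift_sum_single.
Qed.

Lemma extend_hom_eta (V W : linfAlg S) (f : linfHom V W) v : all_good (homog_tag V) v ->
  extend_hom f [seq 1 ⊗ x | x <- untag v] = 1 ⊗ f (untag v).
Proof.
move=> hv; rewrite -unit_comp // -[unit_hom W \oS f](transpose_invK charK) //.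
Qed.

Lemma transpose_post (X : linfAlg S) (Y Y' : linfAlg R) (g : linfHom Y Y')
    (k : linfHom (E X) Y) :
  Phi (g \oR k) = restr_hom phi g \oS Phi k.
Proof.
apply: linfHom_eq => l hl; rewrite comp_hom_unt //.
rewrite -[LHS]/((g \oR k) [seq 1 ⊗ x | x <- untag l]) -untag_etat.
rewrite comp_hom_unt; last exact: all_good_etat.
rewrite lift_sum_map [LHS]lift_sum_blocks [RHS]lift_sum_blocks; apply: lift_sum_ext => P _ _.
rewrite /untag -!map_comp; congr (linf_fun g _); apply: eq_map => A /=.
by rewrite untag_etat.
Qed.

Lemma transpose_pre (X X' : linfAlg S) (Y : linfAlg R) (f : linfHom (E X) Y)
    (h : linfHom X' X) :
  Phi (f \oR extend_hom h) = Phi f \oS h.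
Proof.
apply: linfHom_eq => l hl; rewrite comp_hom_unt //.
rewrite -[LHS]/((f \oR extend_hom h) [seq 1 ⊗ x | x <- untag l]) -untag_etat.
rewrite comp_hom_unt; last exact: all_good_etat.
rewrite lift_sum_map [LHS]lift_sum_blocks [RHS]lift_sum_blocks; apply: lift_sum_ext => P hP _.
rewrite /= /restr_fun /untag -!map_comp; congr (linf_fun f _); apply/eq_in_map => A hA /=.
rewrite untag_etat; apply: extend_hom_eta.
by move=> z hz; apply: hl; rewrite -(perm_mem hP); apply/flattenP; exists A.
Qed.

Lemma extend_functor : is_functor (linf_cat S charK) (linf_cat R charK) extend_hom.
Proof.
split=> [V|U V W g f] /=; apply: (bij_inj (@transpose_bij _ charK _ _ phi _ _)).
  by rewrite transpose_extend comp_hom1.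
by rewrite transpose_pre !transpose_extend comp_homA.
Qed.

Lemma restr_functor : is_functor (linf_cat R charK) (linf_cat S charK) (@restr_hom K S R phi).
Proof.
split=> [V|U V W g f] /=; apply: linfHom_eq => l hl //.
by rewrite comp_hom_unt // [LHS](comp_hom_unt charK g f).
Qed.

Lemma extension_adjunction :
  is_adjunction (linf_cat S charK) (linf_cat R charK) extend_hom (@restr_hom K S R phi)
    (fun V W => Phi (V := V) (W := W)).
Proof.
split; [exact: extend_functor|exact: restr_functor|exact: transpose_bij|].
by move=> X X' Y Y' h f g; rewrite /= transpose_post transpose_pre.
Qed.

Lemma scalar_sign_index n (a b : 'I_n -> int) (r : 'I_n -> R) (V : zmodType) (x : 'I_n -> V) :
  scalar_sign 0 [seq ((a i, r i), (b i, x i)) | i <- enum 'I_n] =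
  parity (\sum_(i < n) \sum_(j < n | (i < j)%N) b i * a j).
Proof.
(* Increasing lists of indices, in place of the full enumeration, allow an induction on the list. *)
have key l : sorted (@ord_lt n) l -> scalar_sign 0 [seq ((a i, r i), (b i, x i)) | i <- l] =
    parity (\sum_(i <- l) \sum_(j <- l | (i < j)%N) b i * a j).
  elim: l => [|i l ih] hl /=; first by rewrite big_nil.
  rewrite scalar_signD ih ?(path_sorted hl) // !big_cons ltnn parityD addbC;
    congr (_ (+) parity _).
    rewrite -parityM /rdeg /degsum big_map mulr_sumr; congr parity.
    rewrite big_seq_cond [RHS]big_seq_cond; apply: eq_bigl => j.
    by case hj: (j \in l) => //=; rewrite (allP (ord_lt_path hl) _ hj).
  apply: eq_big_seq => j hj; rewrite big_cons.
  by have /ltnW := allP (ord_lt_path hl) _ hj; rewrite leqNgt => /negbTE ->.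
rewrite key ?enum_olt // big_enum; congr parity.
by apply: eq_bigr => i _; rewrite big_enum_cond.
Qed.

Section IndexedTensors.
Variables (V : linfAlg S) (n : nat) (a b : 'I_n -> int) (r : 'I_n -> R) (x : 'I_n -> V).
Hypotheses (hr : forall i, homog (dgca_gr R) (a i) (r i)) (hx : forall i, homog V (b i) (x i)).

Let l := [seq ((a i, r i), (b i, x i)) | i <- enum 'I_n].

Lemma indexed_good : all_good (homog_tens V) l.
Proof. by move=> t /mapP[i _ ->]; split; [apply: hr|apply: hx]. Qed.
Lemma indexed_tensors : [seq r i ⊗ x i | i : 'I_n] = map (@tpure K S R phi V) l.
Proof. by rewrite -map_comp. Qed.
Lemma indexed_rprod : rprod l = \prod_(i < n) r i.
Proof. by rewrite /rprod big_map enumT [index_enum _]unlock. Qed.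
Lemma indexed_vseq : untag (vseq l) = [seq x i | i : 'I_n].
Proof. by rewrite /untag /vseq /l -map_comp -map_comp. Qed.
Lemma indexed_rdeg : rdeg l = \sum_(i < n) a i.
Proof. by rewrite /rdeg /degsum big_map big_enum. Qed.
End IndexedTensors.

Lemma extend_homP (V W : linfAlg S) (f : linfHom V W) :
  extension_hom (E := fun V => linfE phi V) f (extend_hom f).
Proof.
move=> n a b r x _ hr hx; have hl := indexed_good hr hx.
rewrite (indexed_tensors a b) [LHS](ext_fun_pure (unit_hom W \oS f) hl).
rewrite /scalar_ext /sharp /tagged_fun unit_comp; last exact: all_good_vseq hl.
by rewrite tensorZ mulr1 indexed_rprod indexed_vseq scalar_sign_index signE.
Qed.

Lemma linfE_extension (V : linfAlg S) : extension_str (linfE phi V).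
Proof.
split=> [n t|i r x hr|n a b r x n2 hr hx].
- split=> [/spanned_tdec[ts [hts ->]]|[l [hl ->]]].
    exists [seq (t.1.2, t.2.2) | t <- ts]; split; last by rewrite big_map.
    by move=> p /mapP[u /hts[[h1 h2] <-] ->]; exists u.1.1, u.2.1.
  rewrite big_seq; apply: homog_sum => p /hl[i [j [hi hj <-]]].
  exact (homog_tpure phi (@dg_homogZ K S V V) (t := ((i, p.1), (j, p.2))) (conj hi hj)).
- exact: dE_tensor.
have hl := indexed_good hr hx.
rewrite (indexed_tensors a b) [LHS](qE_pure phi hl) /tens_bracket.
rewrite [dtens _ _](_ : _ = 0) ?addr0; last first.
  set l := map _ _; have : (2 <= size l)%N by rewrite size_map size_enum_ord.
  by case: l => [|? [|? ?]].
rewrite /sharp /etaq tensorZ mulr1 indexed_rprod indexed_vseq signE; apply: signed_eq.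
(* Passing the bracket itself, of degree 1, costs the sum of the degrees of the scalars; the double
   sum is as for morphisms. *)
by rewrite -[1]add0r scalar_signD scalar_sign_index indexed_rdeg parityD addbC.
Qed.
End Adjunction.

(** Restriction keeps the grading, the differential and the underlying function, so the two
    conditions are convertible. *)
Lemma restr_quasi_iso (K : fieldType) (S R : dgca K) (phi : dgcaHom S R)
    (V W : linfAlg R) (f : linfHom V W) : quasi_iso f -> quasi_iso (restr_hom phi f).
Proof. by []. Qed.

Theorem proposition2p21 (K : fieldType) (charK : [pchar K] =i pred0)
    (S R : dgca K) (phi : dgcaHom S R) :
  (exists (CR : category (@linfHom K R)) (CS : category (@linfHom K S))
      (E : forall V : linfAlg S, linfStr (R := R) (tens phi V))
      (Em : forall V W : linfAlg S,
         linfHom V W -> linfHom (LinfAlg (E V)) (LinfAlg (E W)))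
      (Phi : forall (V : linfAlg S) (W : linfAlg R),
         linfHom (LinfAlg (E V)) W -> linfHom V (restr phi W)),
    [/\ linf_category CR /\ linf_category CS,
        forall V, extension_str (E V),
        forall V W (f : linfHom V W), extension_hom f (Em V W f) &
        is_adjunction CS CR Em (@restr_hom K S R phi) Phi]) /\
  (forall (V W : linfAlg R) (f : linfHom V W),
     quasi_iso f -> quasi_iso (restr_hom phi f)).
Proof.
split; last exact: restr_quasi_iso.
exists (linf_cat R charK), (linf_cat S charK), (linfE phi), (extend_hom charK phi).
exists (fun V W => transpose charK (V := V) (W := W)); split.
- by split; apply: linf_catP.
- exact: linfE_extension.
- by move=> V W f; apply: extend_homP.
- exact: extension_adjunction.
Qed.
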